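(* In both parts, for a nilpotent $G$-orbit $\mathcal O$ with $\overline{\mathcal O}\cap\mathfrak m=\{0\}$, let $\Omega_{\mathcal O}$ be the dense $H$-orbit in $\mathcal O$ and $\boldsymbol\varphi:\overline{\mathcal O}\to\mathfrak h$ the projection along $\mathfrak m=\mathfrak h^\perp$. (i) Let $G=SO_N$ and $H=SO_{N-1}$ (standard embedding), $N=4k+m$ with $k\ge2$ and $m\ge0$. If $m>0$ and $\mathcal O=\mathcal O(2^{2k},1^m)\subset\mathfrak{so}_N$, then $\boldsymbol\varphi(\Omega_{\mathcal O})=\mathcal O(3,2^{2k-2},1^m)\subset\mathfrak{so}_{N-1}$. For $m=0$, there are two very even orbits $\mathcal O(2^{2k})_{\mathrm I}$ and $\mathcal O(2^{2k})_{\mathrm{II}}$ in $\mathfrak{so}_{4k}$, both satisfy $\overline{\mathcal O}\cap\mathfrak m=\{0\}$, and the projections of both yield the same $SO_{4k-1}$-orbit, i.e., $\boldsymbol\varphi(\Omega_{\mathcal O})=\mathcal O(3,2^{2k-2})$ for either of them. In all cases, $\tilde{\mathcal O}:=SO_N\cdot\boldsymbol\varphi(\Omega_{\mathcal O})=\mathcal O(3,2^{2k-2},1^{m+1})$, $\mathrm{ht}(\mathcal O)=2$ and $\mathrm{ht}(\tilde{\mathcal O})=3$. (ii) Let $G=SO_7$ and let $H$ be the subgroup of type $G_2$ embedded via its simple $7$-dimensional module. If $\mathcal O=\mathcal O(3,1^4)\subset\mathfrak{so}_7$, then $\boldsymbol\varphi(\Omega_{\mathcal O})$ is the subregular nilpotent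 orbit of $\mathfrak h$ and $\tilde{\mathcal O}:=G\cdot\boldsymbol\varphi(\Omega_{\mathcal O})=\mathcal O(3,3,1)$. Here $\mathrm{ht}(\mathcal O)=2$ and $\mathrm{ht}(\tilde{\mathcal O})=4$.
   Context: The ground field is algebraically closed of characteristic $0$; $\mathfrak g=\mathrm{Lie}\,G$, $\mathfrak h=\mathrm{Lie}\,H$, and $\mathfrak m=\mathfrak h^\perp$ is the orthogonal complement with respect to the Killing form of $\mathfrak g$. $\mathcal O(\boldsymbol\mu)$ is the nilpotent orbit of an orthogonal Lie algebra with partition $\boldsymbol\mu$ (exponents denote multiplicities); in $\mathfrak{so}_{4k}$ the very even partition $(2^{2k})$ gives two $SO_{4k}$-orbits, marked I and II, whose union is one $O_{4k}$-orbit. All orbits $\mathcal O$ in the statement satisfy $\overline{\mathcal O}\cap\mathfrak m=\{0\}$, and therefore $H$ has a dense orbit $\Omega_{\mathcal O}$ in $\mathcal O$. The height of a nonzero nilpotent $e$ is $\mathrm{ht}(e)=\max\{k\mid(\mathrm{ad}\,e)^k\neq0\}$ (computed in $\mathfrak g$), and $\mathrm{ht}(G\cdot e)=\mathrm{ht}(e)$. The subregular orbit is the dense orbit in the complement of the regular orbit in the nilpotent cone. *)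

(* Defs.v *)
From HB Require Import structures.
From mathcomp Require Import all_boot all_order all_algebra.
From mathcomp Require Import boolp classical_sets.
From mathcomp Require Import mpoly ring.

Set Implicit Arguments.
Unset Strict Implicit.
Unset Printing Implicit Defensive.

Import GRing.Theory.

Local Open Scope ring_scope.
Local Open Scope classical_set_scope.

Section Zariski.
Variables (K : fieldType) (n : nat).
Implicit Types S : set 'M[K]_n.

Definition mx_eval (p : {mpoly K[n * n]}) (x : 'M[K]_n) : K :=
  p.@[fun i => mxvec x 0 i].

Definition zclosure S : set 'M[K]_n :=
  [set x | forall p : {mpoly K[n * n]},
             (forall y, S y -> mx_eval p y = 0) -> mx_eval p x = 0].

End Zariski.

Section Orbits.
Variables (K : fieldType) (n : nat).
Implicit Types (G H : set 'M[K]_n) (O Omega : set 'M[K]_n).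

(* Groups are given as sets of invertible matrices, acting by conjugation. *)
Definition conj_orbit G (x : 'M[K]_n) : set 'M[K]_n :=
  [set g *m x *m invmx g | g in G].

Definition is_orbit G O : Prop := exists x, O = conj_orbit G x.

Definition saturation G (S : set 'M[K]_n) : set 'M[K]_n :=
  \bigcup_(y in S) conj_orbit G y.

Definition dense_orbit H O Omega : Prop :=
  [/\ is_orbit H Omega, Omega `<=` O & O `<=` zclosure Omega].

End Orbits.

Section LieAlgebra.
Variables (K : fieldType) (n : nat).
Implicit Types (g h : {vspace 'M[K]_n}) (x y e : 'M[K]_n).

Definition lie x y : 'M[K]_n := x *m y - y *m x.

(* The trace of ad x \o ad y on g, computed in a basis of g. *)
Definition killing g x y : K :=
  \sum_(i < \dim g) coord (vbasis g) i (lie x (lie y (vbasis g)`_i)).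

Definition killing_row g h x : 'rV[K]_(\dim h) :=
  \row_(i < \dim h) killing g x (vbasis h)`_i.

Definition killing_orth g h : {vspace 'M[K]_n} :=
  (g :&: lker (linfun (killing_row g h)))%VS.

Lemma lie_is_linear x : linear (lie x).
Proof.
move=> a y z; rewrite /lie mulmxDr mulmxDl -scalemxAr -scalemxAl opprD addrACA.
by rewrite scalerBr.
Qed.

Lemma lie_is_linear_l y : linear (lie^~ y).
Proof.
move=> a x z; rewrite /lie mulmxDr mulmxDl -scalemxAr -scalemxAl opprD addrACA.
by rewrite scalerBr.
Qed.

Lemma killingDZl g a x y z :
  killing g (a *: x + y) z = a * killing g x z + killing g y z.
Proof.
rewrite /killing mulr_sumr -big_split; apply: eq_bigr => i _ /=.
by rewrite lie_is_linear_l linearP.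
Qed.

Lemma killingDZr g a x y z :
  killing g z (a *: x + y) = a * killing g z x + killing g z y.
Proof.
rewrite /killing mulr_sumr -big_split; apply: eq_bigr => i _ /=.
by rewrite lie_is_linear_l lie_is_linear linearP.
Qed.

Lemma killing_row_is_linear g h : linear (killing_row g h).
Proof. by move=> a x y; apply/rowP => i; rewrite !mxE killingDZl. Qed.

HB.instance Definition _ g h :=
  GRing.isLinear.Build K 'M[K]_n 'rV[K]_(\dim h) *:%R (killing_row g h)
    (killing_row_is_linear g h).

Lemma mem_killing_orth g h x :
  x \in killing_orth g h <->
  x \in g /\ forall y, y \in h -> killing g x y = 0.
Proof.
rewrite memv_cap memv_ker lfunE /=; split.
  case/andP=> xg /eqP/rowP kx; split=> // y yh.
  have killr0 : killing g x 0 = 0.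
    by have := killingDZr g 1 0 0 x; rewrite scale1r addr0 mul1r => /esym/eqP;
       rewrite -[X in _ == X]addr0 (inj_eq (addrI _)) => /eqP.
  rewrite (coord_vbasis yh).
  elim/big_rec: _ => // i z _ kz; rewrite killingDZr kz addr0.
  by have := kx i; rewrite !mxE => ->; rewrite mulr0.
case=> -> kx /=; apply/eqP/rowP => i; rewrite !mxE kx //.
by rewrite vbasis_mem // mem_nth // size_tuple.
Qed.

(* Projection onto h along the orthogonal complement of h in g. *)
Definition killing_proj g h : 'End('M[K]_n) := daddv_pi h (killing_orth g h).

Definition is_height g e (k : nat) : Prop :=
  (exists2 y, y \in g & iter k (lie e) y != 0) /\
  (forall j, (exists2 y, y \in g & iter j (lie e) y != 0) -> (j <= k)%N).

Definition orbit_height g (O : set 'M[K]_n) (k : nat) : Prop :=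
  O !=set0 /\ forall e, O e -> is_height g e k.

(* For the semisimple algebras considered here, an element is nilpotent in h
   if and only if it is a nilpotent matrix. *)
Definition nilcone h : set 'M[K]_n :=
  [set x | x \in h /\ exists k, x ^+ k = 0].

Definition is_subregular (H : set 'M[K]_n) h (O : set 'M[K]_n) : Prop :=
  exists2 Oreg, dense_orbit H (nilcone h) Oreg
              & dense_orbit H (nilcone h `\` Oreg) O.

End LieAlgebra.

Section Orthogonal.
Variable (K : fieldType).

Definition SO (n : nat) : set 'M[K]_n :=
  [set a | a^T *m a = 1%:M /\ \det a = 1].
Arguments SO : clear implicits.

Definition so (n : nat) : {vspace 'M[K]_n} :=
  lker (linfun (fun x : 'M[K]_n => x^T) + \1)%VF.

Lemma mem_so n (x : 'M[K]_n) : x \in so n <-> x^T = - x.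
Proof.
rewrite memv_ker add_lfunE id_lfunE lfunE /= addr_eq0.
by split => [/eqP|->].
Qed.

(* The nilpotent matrix in Jordan form whose successive blocks have the sizes
   listed in mu: a superdiagonal entry vanishes exactly when its column is a
   partial sum of mu, i.e. starts a new block. *)
Definition jordan_nilp (n : nat) (mu : seq nat) : 'M[K]_n :=
  \matrix_(i, j)
    ((j == i.+1 :> nat) && (val j \notin scanl addn 0%N mu))%:R.

(* O(mu). For very even mu this is the union of the orbits I and II. *)
Definition nilp_orbit (n : nat) (mu : seq nat) : set 'M[K]_n :=
  [set x | x \in so n /\
     exists2 P, P \in unitmx & x = P *m jordan_nilp n mu *m invmx P].

Definition embed_grp n (a : 'M[K]_n) : 'M[K]_(n + 1) := block_mx a 0 0 1%:M.

Definition embed_lie n (x : 'M[K]_n) : 'M[K]_(n + 1) := block_mx x 0 0 0.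

Lemma embed_lie_is_linear n : linear (@embed_lie n).
Proof.
by move=> a x y; rewrite /embed_lie scale_block_mx add_block_mx !scaler0 !addr0.
Qed.

HB.instance Definition _ n :=
  GRing.isLinear.Build K 'M[K]_n 'M[K]_(n + 1) *:%R (@embed_lie n)
    (@embed_lie_is_linear n).

Definition SO_sub n : set 'M[K]_(n + 1) := @embed_grp n @` SO n.
Arguments SO_sub : clear implicits.

Definition so_sub n : {vspace 'M[K]_(n + 1)} :=
  (linfun (@embed_lie n) @: so n)%VS.

Lemma mem_so_sub n (x : 'M[K]_(n + 1)) :
  x \in so_sub n <-> exists2 y, y \in so n & x = embed_lie y.
Proof.
split=> [/memv_imgP[y yso ->]|[y yso ->]].
  by exists y; rewrite // lfunE.
by apply/memv_imgP; exists y; rewrite // lfunE.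
Qed.

End Orthogonal.

Arguments SO : clear implicits.
Arguments so : clear implicits.
Arguments nilp_orbit : clear implicits.
Arguments SO_sub : clear implicits.
Arguments so_sub : clear implicits.
Arguments jordan_nilp : clear implicits.

Section G2.
Variable (K : fieldType).

(* The cross product of trace-zero octonions in the orthonormal basis with
   e_i x e_(i+1) = e_(i+3), indices modulo 7, and all cyclic rotations of this
   rule. The additions below take place in 'I_7, hence modulo 7. *)
Definition cross (u v : 'cV[K]_7) : 'cV[K]_7 :=
  let w (i j : 'I_7) := u i 0 * v j 0 - u j 0 * v i 0 in
  \col_(k < 7) (w (k + 1) (k + 3%:R) + w (k + 2%:R) (k + 6%:R)
                   + w (k + 4%:R) (k + 5%:R)).

Lemma cross_norm (u v : 'cV[K]_7) :
  \sum_k (cross u v k 0) ^+ 2 =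
  (\sum_k (u k 0) ^+ 2) * (\sum_k (v k 0) ^+ 2) - (\sum_k u k 0 * v k 0) ^+ 2.
Proof.
have E n (f : 'I_n.+1 -> K) :
    \sum_k f k = f (inord 0) + \sum_(k < n) f (inord k.+1).
  rewrite big_ord_recl; congr (f _ + _).
    by apply: val_inj; rewrite /= inordK.
  by apply: eq_bigr => i _; congr f; apply: val_inj; rewrite /= inordK ?ltnS.
pose o i : 'I_7 := inord i.
have S (f : 'I_7 -> K) : \sum_k f k = f (o 0%N) + f (o 1%N) + f (o 2%N)
    + f (o 3%N) + f (o 4%N) + f (o 5%N) + f (o 6%N).
  by rewrite E !big_ord_recr big_ord0 /= add0r !addrA.
have A i j : (i < 7)%N -> o i + (j%:R : 'I_7) = o ((i + j) %% 7)%N.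
  move=> hi; apply: val_inj; rewrite /o /= !inordK ?ltn_mod //.
  have -> : ((j%:R : 'I_7) : nat) = (j %% 7)%N by exact: (val_Zp_nat (p:=7)).
  by rewrite modnDmr.
have A1 i : (i < 7)%N -> o i + (1 : 'I_7) = o ((i + 1) %% 7)%N.
  by move=> ?; rewrite -A.
rewrite !S !mxE !A1 ?A //=; ring.
Qed.

(* The automorphism group of the octonions, acting on their simple
   7-dimensional module of trace-zero elements. *)
Definition G2 : set 'M[K]_7 :=
  [set a | SO K 7 a /\ forall u v, a *m cross u v = cross (a *m u) (a *m v)].

Lemma cross_is_linear u : linear (cross u).
Proof. by move=> a v w; apply/colP => k; rewrite !mxE; ring. Qed.

Lemma cross_is_linear_l v : linear (cross^~ v).
Proof. by move=> a u w; apply/colP => k; rewrite !mxE; ring. Qed.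

Definition derivation_defect (u v : 'cV[K]_7) (d : 'M[K]_7) : 'cV[K]_7 :=
  d *m cross u v - cross (d *m u) v - cross u (d *m v).

(* Lie G2 = Der(octonions), obtained by linearizing the equations of G2. *)
Definition g2 : {vspace 'M[K]_7} :=
  (so K 7 :&: \bigcap_(i < 7) \bigcap_(j < 7)
     lker (linfun (derivation_defect (delta_mx i 0%R) (delta_mx j 0%R))))%VS.

Lemma derivation_defect_is_linear u v : linear (derivation_defect u v).
Proof.
move=> a x y; rewrite /derivation_defect !mulmxDl -!scalemxAl.
rewrite cross_is_linear cross_is_linear_l.
by apply/colP => k; rewrite ![in LHS]mxE ![in RHS]mxE; ring.
Qed.

HB.instance Definition _ u v :=
  GRing.isLinear.Build K 'M[K]_7 'cV[K]_7 *:%R (derivation_defect u v)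
    (derivation_defect_is_linear u v).

Lemma derivation_defect_linear1 v d :
  linear (fun u => derivation_defect u v d).
Proof.
move=> a x y; rewrite /derivation_defect !cross_is_linear_l !mulmxDr.
rewrite -!scalemxAr !cross_is_linear_l.
by apply/colP => k; rewrite ![in LHS]mxE ![in RHS]mxE; ring.
Qed.

Lemma derivation_defect_linear2 u d :
  linear (fun v => derivation_defect u v d).
Proof.
move=> a x y; rewrite /derivation_defect !cross_is_linear !mulmxDr.
rewrite -!scalemxAr !cross_is_linear.
by apply/colP => k; rewrite ![in LHS]mxE ![in RHS]mxE; ring.
Qed.

Lemma linear_col_eq0 (f : 'cV[K]_7 -> 'cV[K]_7) :
  linear f -> (forall i, f (delta_mx i 0) = 0) -> forall u, f u = 0.
Proof.
move=> lf f0 u; have fZD a x y : f (a *: x + y) = a *: f x + f y by exact: lf.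
have f00 : f 0 = 0.
  by have /eqP := fZD 1 0 0; rewrite !scale1r addr0 -subr_eq0 opprD addNKr
     oppr_eq0 => /eqP.
rewrite [u]matrix_sum_delta; elim/big_rec: _ => // i x _ fx.
by rewrite big_ord1 fZD f0 fx scaler0 addr0.
Qed.

Lemma mem_g2 (d : 'M[K]_7) :
  d \in g2 <-> d \in so K 7 /\
    forall u v, d *m cross u v = cross (d *m u) v + cross u (d *m v).
Proof.
rewrite memv_cap; split.
  case/andP=> dso /subv_bigcapP dd; split=> // u v.
  apply/eqP; rewrite -subr_eq0 opprD addrA -/(derivation_defect u v d).
  apply/eqP; move: u; apply: (linear_col_eq0 (derivation_defect_linear1 v d)).
  move=> i; move: v; apply: (linear_col_eq0 (derivation_defect_linear2 _ d)).
  move=> j; have /subv_bigcapP/(_ j isT) := dd i isT.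
  by rewrite -memvE memv_ker lfunE => /eqP.
case=> -> dd; apply/subv_bigcapP => i _; apply/subv_bigcapP => j _.
by rewrite -memvE memv_ker lfunE /= /derivation_defect dd addrAC addrK subrr.
Qed.

End G2.

Arguments G2 : clear implicits.
Arguments g2 : clear implicits.

(* Main.v *)
(* A nilpotent orbit is recognised by the ranks of the powers of its elements, and points are put into
   Zariski closures by polynomial curves.

   (i) The orbit consists of the skew [x] with [x x = 0] of rank [2k], and the projection adds
   [wedge e (x e)] to [x], where [e] is the vector fixed by [H]; the square of the image is [u u^T] for
   [u = x e], and [x] is recovered from the image and [u]. The dense orbit is [x e != 0]: hyperbolic
   bases adapted to [x] and to a unit vector outside its kernel show that [O_N] acts transitively on
   such pairs, and the determinant can be corrected unless [m = 0], when every orthogonal matrix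
   commuting with [x] has determinant 1, so that [O_N x] splits into two orbits.

   (ii) The elements of the orbit are the [wedge p w] with [p] isotropic, orthogonal to [w], and [w]
   anisotropic; the projection adds a third of the cross product by [p x w]. The dense orbit is
   [p x w] not in [K p], because [G2] acts transitively on such pairs with [w] of norm 1. A nilpotent
   element of [g2] kills an isotropic vector, hence can be moved into the nilradical of a Borel
   subalgebra; if both simple root coordinates are nonzero, a torus and four root subgroups bring it to
   a fixed element, and otherwise it can be rearranged so that, after solving a cubic equation, it is
   the projection of some [wedge p w], a limit of projections from the dense orbit. *)
From HB Require Import structures.
Require Import Defs.
From mathcomp Require Import all_boot all_order all_algebra.
From mathcomp Require Import boolp classical_sets.
From mathcomp Require Import mpoly ring zify.

Set Implicit Arguments.
Unset Strict Implicit.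
Unset Printing Implicit Defensive.

Import GRing.Theory.
Local Open Scope ring_scope.
Local Open Scope classical_set_scope.

(** * Nilpotent matrices and ranks *)

(** Closures are defined by the polynomials vanishing on a set, so both directions are elementary: a
    curve puts a point into a closure, and a polynomial identity valid on the orbit keeps a point
    out. The identities used are [x x = 0] in (i) and [Lmx (nvec e) e + e e = 0] in (ii); they force
    the intersection with the complement of the subalgebra to be zero. The dense orbits are
    non-vanishing sets of polynomial maps on the orbit, which makes them unique; for this the
    condition that [cross p w] is off the line of [p] has to be expressed through the matrix
    [wedge p w] alone.

    The obstacle in the very even case is that [u u^T] determines [u] only up to sign. The two lifts
    of one image differ by a reflection along [e], so each of the two orbits contains one of them.

    Forms are handled by factorisations: a matrix [M] with [C^T M = 1] records that the columns of
    [C] are independent, and isometries are written down directly from two adapted bases. Heights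
    are read off [e e]: when [e^3 = 0], the fourth power of [ad e] sends [y] to [6 e e y e e], and
    the fifth vanishes. *)

Lemma addmxE (K : fieldType) m n (A B : 'M[K]_(m, n)) i j :
  (A + B) i j = A i j + B i j.
Proof. by rewrite mxE. Qed.

Lemma oppmxE (K : fieldType) m n (A : 'M[K]_(m, n)) i j : (- A) i j = - A i j.
Proof. by rewrite mxE. Qed.

Lemma scalemxE (K : fieldType) m n a (A : 'M[K]_(m, n)) i j :
  (a *: A) i j = a * A i j.
Proof. by rewrite mxE. Qed.

Lemma const0mxE (K : fieldType) m n i j : (0 : 'M[K]_(m, n)) i j = 0.
Proof. by rewrite mxE. Qed.

Definition mxentE := (addmxE, oppmxE, scalemxE, const0mxE).

Ltac mxring := apply/matrixP => ? ?; rewrite !mxentE; ring.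
Ltac mxfield := apply/matrixP => ? ?; rewrite !mxentE; field.

Lemma col_mulmx (K : fieldType) m n p j (A : 'M[K]_(m, n)) (B : 'M_(n, p)) :
  col j (A *m B) = A *m col j B.
Proof. by rewrite !colE mulmxA. Qed.

Section Jordan.
Variable K : fieldType.

(** In a rank factorisation [E = W V] the factor [W] cancels on the left and [V] on the right, so
    [W V W V = W V] leaves [V W = 1]. *)
Lemma idem_factor n r (E : 'M[K]_n) :
  E *m E = E -> \rank E = r ->
  exists (W : 'M_(n, r)) (V : 'M_(r, n)), E = W *m V /\ V *m W = 1%:M.
Proof.
move=> EE <-; exists (col_base E), (row_base E); rewrite mulmx_base; split=> //.
apply: (row_full_inj (col_base_full E)); apply: (row_free_inj (row_base_free E)).
by rewrite mulmxA mulmx_base -mulmxA mulmx_base EE mulmx1 mulmx_base.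
Qed.

Lemma rank_idem_compl n (E : 'M[K]_n) :
  E *m E = E -> (\rank E + \rank (1%:M - E)%R = n)%N.
Proof.
move=> EE; apply/eqP; rewrite eqn_leq; apply/andP; split.
  by apply: mulmx0_rank_max; rewrite mulmxBr mulmx1 EE subrr.
rewrite -{1}(mxrank1 K n) -{1}(subrK E 1%:M) addrC; exact: mxrank_add.
Qed.

Lemma block_diag_exp n m (A : 'M[K]_n) (B : 'M[K]_m) k :
  (block_mx A 0 0 B) ^+ k = block_mx (A ^+ k) 0 0 (B ^+ k).
Proof.
elim: k => [|k IH]; first by rewrite !expr0 -scalar_mx_block.
by rewrite !exprS IH -!mulmxE mulmx_block !mul0mx !mulmx0 !addr0 !add0r.
Qed.

Lemma conj_exp n (P x : 'M[K]_n) k :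
  P \in unitmx -> (P *m x *m invmx P) ^+ k = P *m x ^+ k *m invmx P.
Proof.
move=> uP; elim: k => [|k IH]; first by rewrite !expr0 mulmx1 mulmxV.
by rewrite !exprS IH -!mulmxE !mulmxA mulmxKV.
Qed.

Lemma rank_conj n (P x : 'M[K]_n) :
  P \in unitmx -> \rank (P *m x *m invmx P) = \rank x.
Proof.
move=> uP; rewrite mxrankMfree ?row_free_unit ?unitmx_inv //.
by rewrite -mxrank_tr trmx_mul mxrankMfree ?row_free_unit ?unitmx_tr // mxrank_tr.
Qed.

Lemma jordan_block_exp s k :
  jordan_nilp K s [:: s] ^+ k = \matrix_(i, j) (j == i + k :> nat)%N%:R.
Proof.
elim: k => [|k IH].
  by rewrite expr0; apply/matrixP=> i j; rewrite !mxE addn0 eq_sym.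
rewrite exprS IH; apply/matrixP=> i j; rewrite -mulmxE !mxE.
under eq_bigr => l _ do rewrite !mxE /= inE neq_ltn ltn_ord andbT.
case: (ltnP i.+1 s) => hi.
  rewrite (bigD1 (Ordinal hi)) //= eqxx mul1r big1 ?addr0; last first.
    by move=> l; rewrite -val_eqE /= => /negPf->; rewrite mul0r.
  by rewrite addSnnS.
rewrite big1 => [|l _]; first by case: eqP => // E; have := ltn_ord j; lia.
by case: eqP => [E|]; rewrite ?mul0r //; have := ltn_ord l; lia.
Qed.

Lemma rank_jordan_block s k : \rank (jordan_nilp K s [:: s] ^+ k) = (s - k)%N.
Proof.
rewrite jordan_block_exp.
pose U : 'M[K]_(s, s - k) := \matrix_(a, b) (a == b :> nat)%:R.
pose V : 'M[K]_(s - k, s) := \matrix_(a, b) (b == a + k :> nat)%N%:R.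
have -> : (\matrix_(i, j) (j == i + k :> nat)%N%:R : 'M[K]_s) = U *m V.
  apply/matrixP=> i j; rewrite !mxE.
  under eq_bigr => l _ do rewrite !mxE.
  case: (ltnP i (s - k)) => hi.
    rewrite (bigD1 (Ordinal hi)) //= eqxx mul1r big1 ?addr0 //.
    by move=> l; rewrite -val_eqE /= eq_sym => /negPf->; rewrite mul0r.
  rewrite big1 => [|l _]; first by case: eqP => // E; have := ltn_ord j; lia.
  by case: eqP => [E|]; rewrite ?mul0r //; have := ltn_ord l; lia.
have hk (a : 'I_(s - k)) : (a + k < s)%N by have := ltn_ord a; lia.
have hs (a : 'I_(s - k)) : (a < s)%N by have := ltn_ord a; lia.
have VV : V *m V^T = 1%:M.
  apply/matrixP=> a b; rewrite !mxE (bigD1 (Ordinal (hk a))) //= !mxE /= eqxx.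
  rewrite mul1r big1 ?addr0 ?eqn_add2r //.
  by move=> l; rewrite -val_eqE /= !mxE => /negPf->; rewrite mul0r.
have UU : U^T *m U = 1%:M.
  apply/matrixP=> a b; rewrite !mxE (bigD1 (Ordinal (hs a))) //= !mxE /= eqxx.
  rewrite mul1r big1 ?addr0 //.
  by move=> l; rewrite -val_eqE /= !mxE => /negPf->; rewrite mul0r.
apply/eqP; rewrite eqn_leq; apply/andP; split.
  by apply: (leq_trans (mxrankM_maxl _ _)); rewrite rank_leq_col.
have E : U^T *m (U *m V) *m V^T = 1%:M by rewrite mulmxA UU mul1mx VV.
rewrite -{1}(mxrank1 K (s - k)) -E.
exact: leq_trans (mxrankM_maxl _ _) (mxrankM_maxr _ _).
Qed.

Lemma jordan_nilp_cons s n mu : (0 < s)%N ->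
  jordan_nilp K (s + n) (s :: mu) =
  block_mx (jordan_nilp K s [:: s]) 0 0 (jordan_nilp K n mu).
Proof.
move=> s0.
have ge t (l : seq nat) j : (j < t)%N -> j \notin scanl addn t l.
  elim: l t => //= a l IH t jt; rewrite inE negb_or IH ?(leq_trans jt) ?leq_addr //.
  by rewrite neq_ltn (leq_trans jt) ?leq_addr.
have shift (l : seq nat) t j : (s + j \in scanl addn (s + t)%N l) = (j \in scanl addn t l).
  by elim: l t => //= a l IH t; rewrite !inE -addnA IH eqn_add2l.
apply/matrixP=> i j; rewrite mxE.
case: (split_ordP i) => {}i ->; case: (split_ordP j) => {}j ->.
- by rewrite block_mxEul mxE /= !inE (negPf (ge _ _ _ _)) ?ltn_ord // add0n orbF.
- rewrite block_mxEur mxE /=; case: eqP => // E.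
  have -> : (s + j = s)%N by have := ltn_ord i; lia.
  by rewrite add0n inE eqxx.
- rewrite block_mxEdl mxE /=; case: eqP => // E.
  by have := ltn_ord j; lia.
rewrite block_mxEdr mxE /= inE -addnS eqn_add2l add0n.
have := shift mu 0%N j; rewrite addn0 => ->; rewrite negb_or.
by case: eqP => //= ji; rewrite -{2}[s]addn0 eqn_add2l ji.
Qed.

Lemma rank_jordan_nilp mu n k : all (ltn 0) mu -> n = sumn mu ->
  \rank (jordan_nilp K n mu ^+ k) = sumn [seq (j - k)%N | j <- mu].
Proof.
elim: mu n => [|s mu IH] n /=; first by move=> _ ->; rewrite flatmx0 mxrank0.
case/andP=> s0 mu0 ->.
by rewrite jordan_nilp_cons // block_diag_exp rank_diag_block_mx rank_jordan_block IH.
Qed.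

(** A longest chain splits off. The columns of [Z] are [x^s z, ..., x z, z], the rows of [F] are
    [f, f x, ..., f x^s], and [f x^s z = 1]. Their pairing [T = F Z] is upper unitriangular because
    [x^(s+1) = 0]. Hence [E = Z T^-1 F] is a projector onto the chain; it commutes with [x], and its
    complement is an invariant complement. *)
Lemma jordan_split s n (x : 'M[K]_(s.+1 + n)) :
  x ^+ s.+1 = 0 -> x ^+ s != 0 ->
  exists P x', P \in unitmx /\
    x = P *m block_mx (jordan_nilp K s.+1 [:: s.+1]) 0 0 x' *m invmx P.
Proof.
move=> xs0 /matrix0Pn [a [b xab]].
pose z : 'cV[K]_(s.+1 + n) := delta_mx b 0.
pose f : 'rV[K]_(s.+1 + n) := ((x ^+ s) a b)^-1 *: delta_mx 0 a.
have fxz : (f *m x ^+ s *m z) = 1%:M.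
  rewrite -!scalemxAl -rowE -colE; apply/matrixP=> i j.
  by rewrite !mxE !ord1 eqxx mulVf.
pose J := jordan_nilp K s.+1 [:: s.+1].
pose Z : 'M_(s.+1 + n, s.+1) := \matrix_(i, j) (x ^+ (s - j) *m z) i 0.
pose F : 'M_(s.+1, s.+1 + n) := \matrix_(i, j) (f *m x ^+ i) 0 j.
have xpow k : (s < k)%N -> x ^+ k = 0.
  by move=> sk; rewrite -(subnK sk) exprD xs0 mulr0.
have colZ j : col j Z = x ^+ (s - j) *m z.
  by apply/colP=> i; rewrite !mxE.
have rowF i : row i F = f *m x ^+ i.
  by apply/rowP=> j; rewrite !mxE.
have JE i j : J i j = (j == i.+1 :> nat)%:R.
  by have := jordan_block_exp s.+1 1; rewrite expr1 => /matrixP /(_ i j); rewrite !mxE addn1.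
have xZ : x *m Z = Z *m J.
  apply/matrixP=> i j.
  have -> : (x *m Z) i j = (x *m col j Z) i 0 by rewrite -col_mulmx [RHS]mxE.
  rewrite colZ mulmxA mulmxE -exprS.
  rewrite [RHS]mxE; under eq_bigr => l _ do rewrite JE.
  case: (posnP j) => [j0 | jp].
    rewrite j0 subn0 xs0 mul0mx mxE big1 // => l _.
    by rewrite mulr0.
  have jm : (j.-1 < s.+1)%N by have := ltn_ord j; lia.
  rewrite (bigD1 (Ordinal jm)) //= prednK // eqxx mulr1 big1 => [|l].
    rewrite addr0 [RHS]mxE /=; congr ((x ^+ _ *m z) i 0).
    by have := ltn_ord j; lia.
  rewrite -val_eqE /= => lj; case: eqP => [E|]; rewrite ?mulr0 //.
  by case/eqP: lj; rewrite E.
have Fx : F *m x = J *m F.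
  apply/row_matrixP=> i; rewrite !row_mul rowF -mulmxA mulmxE -exprSr.
  apply/rowP=> j; rewrite [RHS]mxE; under eq_bigr => l _ do rewrite [row i J 0 l]mxE JE.
  case: (ltnP i.+1 s.+1) => si.
    rewrite (bigD1 (Ordinal si)) //= eqxx mul1r big1 ?addr0 ?mxE //.
    by move=> l; rewrite -val_eqE /= => /negPf->; rewrite mul0r.
  rewrite (xpow i.+1) // mulmx0 mxE big1 // => l _.
  by case: eqP => [E|]; rewrite ?mul0r //; have := ltn_ord l; lia.
pose T := F *m Z.
have TE (i j : 'I_s.+1) : (j <= i)%N -> T i j = (i == j)%:R.
  move=> ji; have -> : T i j = (row i F *m col j Z) 0 0.
    by rewrite -row_mul -col_mulmx !mxE.
  rewrite rowF colZ mulmxA -[_ *m _ *m x ^+ _]mulmxA mulmxE -exprD.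
  move: ji; rewrite leq_eqVlt => /orP [/eqP/val_inj E | ji].
    have js : (j <= s)%N by have := ltn_ord j; lia.
    by rewrite -E eqxx subnKC // fxz mxE.
  rewrite xpow ?mulmx0 ?mul0mx ?mxE; first by case: eqP ji => // ->; rewrite ltnn.
  by have := ltn_ord j; lia.
have uT : T \in unitmx.
  rewrite unitmxE -det_tr det_trig.
    by rewrite big1 ?unitr1 // => i _; rewrite mxE TE ?eqxx.
  by apply/is_trig_mxP=> i j ij; rewrite mxE TE ?(ltnW ij) //; case: eqP ij => // ->; rewrite ltnn.
(* Both sides are [F x Z]; this is what makes the projector [E] commute with [x]. *)
have JT : J *m T = T *m J by rewrite /T mulmxA -Fx -mulmxA xZ mulmxA.
have JTi : J *m invmx T = invmx T *m J.
  by apply: (can_inj (mulKmx uT)); rewrite mulmxA -JT mulmxK // mulKVmx.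
pose E := Z *m invmx T *m F.
have EE : E *m E = E.
  by rewrite /E -!mulmxA (mulmxA F) -/T (mulmxA (invmx T) T) mulVmx // mul1mx.
have xE : x *m E = E *m x.
  by rewrite /E -!mulmxA Fx mulmxA xZ -!mulmxA; congr (_ *m _); rewrite !mulmxA JTi.
have rE : \rank E = s.+1.
  apply/eqP; rewrite eqn_leq; apply/andP; split.
    by apply: leq_trans (mxrankM_maxr _ _) (rank_leq_row _).
  have FEZ : F *m E *m Z = T by rewrite /E !mulmxA -/T mulmxV // mul1mx.
  apply: (@leq_trans (\rank T)); first by rewrite mxrank_unit.
  rewrite -FEZ; exact: leq_trans (mxrankM_maxl _ _) (mxrankM_maxr _ _).
pose E' := 1%:M - E.
have EE' : E' *m E' = E'.
  by rewrite /E' mulmxBl mul1mx mulmxBr mulmx1 EE subrr subr0.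
have rE' : \rank E' = n by have := rank_idem_compl EE; rewrite rE; apply: addnI.
have [W [V [E'W VW]]] := idem_factor EE' rE'.
have E'E : E' *m E = 0 by rewrite mulmxBl mul1mx EE subrr.
pose P := row_mx Z W; pose Q := col_mx (invmx T *m F) V.
have PQ : P *m Q = 1%:M by rewrite mul_row_col mulmxA -/E -E'W addrC subrK.
have [uP uQ] := mulmx1_unit PQ.
have iP : invmx P = Q.
  by rewrite -[LHS]mulmx1 -PQ mulmxA mulVmx // mul1mx.
exists P, (V *m x *m W); split=> //.
rewrite iP mul_row_block !mulmx0 add0r addr0 mul_row_col.
have -> : Z *m J *m (invmx T *m F) = x *m E by rewrite -xZ /E !mulmxA.
have -> : W *m (V *m x *m W) *m V = E' *m x *m E' by rewrite E'W !mulmxA.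
have -> : E' *m x *m E' = x *m E'.
  have -> : E' *m x = x *m E' by rewrite mulmxBl mulmxBr mul1mx mulmx1 xE.
  by rewrite -mulmxA EE'.
by rewrite -mulmxDr addrC subrK mulmx1.
Qed.

Lemma mx_eq_of_rank0 m n (A : 'M[K]_(m, n)) : \rank A = 0%N -> A = 0.
Proof. by move/eqP; rewrite mxrank_eq0 => /eqP. Qed.

Lemma rank_jordan_similar mu n (x : 'M[K]_n) :
  all (ltn 0) mu -> sorted geq mu -> n = sumn mu ->
  (forall k, \rank (x ^+ k) = sumn [seq (j - k)%N | j <- mu]) ->
  exists2 P, P \in unitmx & x = P *m jordan_nilp K n mu *m invmx P.
Proof.
elim: mu n x => [|s mu IH] n x /=.
  by move=> _ _ E; subst n => _; exists 1%:M; rewrite ?unitmx1 //; apply/matrixP=> - [].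
case/andP=> s0 mu0; rewrite path_sortedE => [/andP [smu srt]|a b c /= ba]; last first.
  by move/leq_trans; apply.
case: s s0 smu => // s _ smu E; subst n => rk.
have xs0 : x ^+ s.+1 = 0.
  apply: mx_eq_of_rank0; rewrite rk subnn add0n; apply/eqP.
  elim: mu smu {IH mu0 srt x rk} => //= a mu IH /andP [as1 /IH /eqP ->].
  by rewrite addn0 subn_eq0.
have xs : x ^+ s != 0.
  by rewrite -mxrank_eq0 rk subSnn.
have [P [x' [uP xE]]] := jordan_split xs0 xs.
have rk' k : \rank (x' ^+ k) = sumn [seq (j - k)%N | j <- mu].
  apply/eqP; rewrite -(eqn_add2l (s.+1 - k)) -rk xE conj_exp // rank_conj // block_diag_exp.
  by rewrite rank_diag_block_mx rank_jordan_block.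
have [Q uQ x'E] := IH _ x' mu0 srt erefl rk'.
pose R := block_mx 1%:M 0 0 Q : 'M_(s.+1 + sumn mu).
have uR : R \in unitmx by rewrite unitmxE det_ublock det1 mul1r -unitmxE.
exists (P *m R); first by rewrite unitmx_mul uP.
have iR : invmx R = block_mx 1%:M 0 0 (invmx Q).
  rewrite -[RHS]mul1mx -(mulVmx uR) -mulmxA mulmx_block.
  by rewrite !mul0mx !mulmx0 !addr0 !add0r mulmxV // mulmx1 -scalar_mx_block mulmx1.
have -> : invmx (P *m R) = invmx R *m invmx P.
  have uPR : P *m R \in unitmx by rewrite unitmx_mul uP.
  by apply: (can_inj (mulKmx uPR)); rewrite mulmxV // mulmxA mulmxK // mulmxV.
rewrite {1}xE jordan_nilp_cons // !mulmxA; congr (_ *m _).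
rewrite -!mulmxA; congr (_ *m _); rewrite iR {1}x'E !mulmx_block.
by rewrite !(mul1mx, mulmx1, mul0mx, mulmx0, addr0, add0r) mulmxA.
Qed.

End Jordan.

(** * Skew matrices and adapted bases *)

(** The bivector of [u] and [v] when so_n is identified with the exterior square of the standard
    module. It is locked so that simplification does not expand it. *)
HB.lock Definition wedge (K : fieldType) n (u v : 'cV[K]_n) : 'M[K]_n :=
  u *m v^T - v *m u^T.

Section Dot.
Variable K : fieldType.

Lemma scalar_mx0 n : (0 : K)%:M = 0 :> 'M_n.
Proof. by rewrite raddf0. Qed.

Definition dot n (u v : 'cV[K]_n) : K := (u^T *m v) 0 0.

Lemma dotE n (u v : 'cV[K]_n) : u^T *m v = (dot u v)%:M.
Proof. by apply/matrixP=> i j; rewrite !ord1 [RHS]mxE eqxx. Qed.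

Lemma dotC n (u v : 'cV[K]_n) : dot u v = dot v u.
Proof. by rewrite /dot -[u^T *m v]trmxK trmx_mul trmxK mxE. Qed.

Lemma dot_sum n (u v : 'cV[K]_n) : dot u v = \sum_i u i 0 * v i 0.
Proof. by rewrite /dot mxE; apply: eq_bigr => i _; rewrite mxE. Qed.

Lemma dotDl n (u v w : 'cV[K]_n) : dot (u + v) w = dot u w + dot v w.
Proof. by rewrite /dot linearD mulmxDl mxE. Qed.
Lemma dotDr n (u v w : 'cV[K]_n) : dot w (u + v) = dot w u + dot w v.
Proof. by rewrite /dot mulmxDr mxE. Qed.
Lemma dotNl n (u v : 'cV[K]_n) : dot (- u) v = - dot u v.
Proof. by rewrite /dot linearN mulNmx mxE. Qed.
Lemma dotNr n (u v : 'cV[K]_n) : dot u (- v) = - dot u v.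
Proof. by rewrite /dot mulmxN mxE. Qed.
Lemma dotZl n a (u v : 'cV[K]_n) : dot (a *: u) v = a * dot u v.
Proof. by rewrite /dot linearZ -scalemxAl mxE. Qed.
Lemma dotZr n a (u v : 'cV[K]_n) : dot u (a *: v) = a * dot u v.
Proof. by rewrite /dot -scalemxAr mxE. Qed.
Lemma dot0l n (u : 'cV[K]_n) : dot 0 u = 0.
Proof. by rewrite /dot trmx0 mul0mx mxE. Qed.
Lemma dot0r n (u : 'cV[K]_n) : dot u 0 = 0.
Proof. by rewrite /dot mulmx0 mxE. Qed.

Definition dot_lin := (dotDl, dotDr, dotNl, dotNr, dotZl, dotZr, dot0l, dot0r).

Lemma outer_mul n m (u : 'cV[K]_m) (v w : 'cV[K]_n) :
  u *m v^T *m w = dot v w *: u.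
Proof. by rewrite -mulmxA dotE mul_mx_scalar. Qed.

Lemma dot_mulmxl n m (A : 'M[K]_(n, m)) u v : dot (A *m u) v = dot u (A^T *m v).
Proof. by rewrite /dot trmx_mul mulmxA. Qed.

Lemma dot_delta n (u : 'cV[K]_n) i : dot (delta_mx i 0) u = u i 0.
Proof. by rewrite /dot trmx_delta -rowE mxE. Qed.

Lemma dot_eq0 n (u : 'cV[K]_n) : (forall v, dot v u = 0) -> u = 0.
Proof. by move=> h; apply/colP=> i; rewrite -dot_delta h mxE. Qed.

Lemma dot_ex1 n (u : 'cV[K]_n) : u != 0 -> exists v, dot u v = 1.
Proof.
case/cV0Pn=> i ui; exists ((u i 0)^-1 *: delta_mx i 0).
by rewrite dotZr dotC dot_delta mulVf.
Qed.

Lemma dot_orth n (g : 'M[K]_n) u v : g^T *m g = 1%:M -> dot (g *m u) (g *m v) = dot u v.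
Proof. by move=> gg; rewrite dot_mulmxl mulmxA gg mul1mx. Qed.

Lemma skew_dot n (x : 'M[K]_n) u v : x^T = - x -> dot u (x *m v) = - dot v (x *m u).
Proof. by move=> xT; rewrite dotC dot_mulmxl xT mulNmx dotNr. Qed.

Lemma wedgeE n (u v : 'cV[K]_n) : wedge u v = u *m v^T - v *m u^T.
Proof. by rewrite wedge.unlock. Qed.

Lemma wedge_mul n (u v w : 'cV[K]_n) :
  wedge u v *m w = dot v w *: u - dot u w *: v.
Proof. by rewrite wedgeE mulmxBl !outer_mul. Qed.

Lemma wedge_tr n (u v : 'cV[K]_n) : (wedge u v)^T = - wedge u v.
Proof. by rewrite wedgeE linearB /= !trmx_mul !trmxK opprB. Qed.

Lemma wedgeC n (u v : 'cV[K]_n) : wedge u v = - wedge v u.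
Proof. by rewrite !wedgeE opprB. Qed.
Lemma wedgeZl n a (u v : 'cV[K]_n) : wedge (a *: u) v = a *: wedge u v.
Proof. by rewrite !wedgeE linearZ /= -scalemxAl -scalemxAr scalerBr. Qed.
Lemma wedgeZr n a (u v : 'cV[K]_n) : wedge u (a *: v) = a *: wedge u v.
Proof. by rewrite wedgeC wedgeZl -scalerN -wedgeC. Qed.
Lemma wedgeNl n (u v : 'cV[K]_n) : wedge (- u) v = - wedge u v.
Proof. by rewrite -scaleN1r wedgeZl scaleN1r. Qed.
Lemma wedgeNr n (u v : 'cV[K]_n) : wedge u (- v) = - wedge u v.
Proof. by rewrite wedgeC wedgeNl -wedgeC. Qed.
Lemma wedge0l n (u : 'cV[K]_n) : wedge 0 u = 0.
Proof. by rewrite -(scale0r 0) wedgeZl scale0r. Qed.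
Lemma wedge0r n (u : 'cV[K]_n) : wedge u 0 = 0.
Proof. by rewrite wedgeC wedge0l oppr0. Qed.

Lemma wedge_conj n (g : 'M[K]_n) u v :
  g *m wedge u v *m g^T = wedge (g *m u) (g *m v).
Proof. by rewrite !wedgeE mulmxBr mulmxBl !trmx_mul !mulmxA. Qed.

Lemma mx_cV_ext n m (A B : 'M[K]_(m, n)) : (forall u : 'cV_n, A *m u = B *m u) -> A = B.
Proof.
move=> h; apply/matrixP=> i j; have := h (delta_mx j 0).
by rewrite -!colE => /colP /(_ i); rewrite !mxE.
Qed.

End Dot.
Global Opaque dot.

Section Factor.
Variable K : fieldType.

Definition alt2 : 'M[K]_(1 + 1) := block_mx 0 1%:M (- 1%:M) 0.

Fixpoint altJ (s : nat) : 'M[K]_s :=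
  if s is s'.+2 then block_mx alt2 0 0 (altJ s') : 'M_(2 + s') else 0.

Lemma alt2_sqr : alt2 *m alt2 = - 1%:M.
Proof.
rewrite /alt2 mulmx_block !(mul0mx, mulmx0, mulmxN, mulmx1, addr0, add0r, mulNmx, mul1mx).
by rewrite scalar_mx_block opp_block_mx !oppr0.
Qed.

Lemma alt2_tr : alt2^T = - alt2.
Proof. by rewrite /alt2 tr_block_mx opp_block_mx !trmx0 linearN /= trmx1 opprK oppr0. Qed.

Lemma altJ_tr s : (altJ s)^T = - altJ s.
Proof.
have [n] := ubnP s; elim: n s => // n IH [|[|s]] ns; rewrite /= ?trmx0 ?oppr0 //.
by rewrite (@tr_block_mx _ 2 s 2 s) (@opp_block_mx _ 2 s 2 s) alt2_tr IH ?trmx0 ?oppr0 //; lia.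
Qed.

Lemma altJ_sqr s : ~~ odd s -> altJ s *m altJ s = - 1%:M.
Proof.
have [n] := ubnP s; elim: n s => // n IH [|[|s]] ns //=.
  by move=> _; apply/matrixP=> - [].
rewrite negbK => os.
rewrite (@mulmx_block _ 2 s 2 s 2 s) !mul0mx !mulmx0 !addr0 !add0r alt2_sqr IH //; last by lia.
by rewrite (scalar_mx_block 2 s) (@opp_block_mx _ 2 s 2 s) !oppr0.
Qed.

Lemma altJ_unit s : ~~ odd s -> altJ s \in unitmx.
Proof.
move/altJ_sqr=> h; have : altJ s *m (- altJ s) = 1%:M by rewrite mulmxN h opprK.
by case/mulmx1_unit.
Qed.

Definition d0 s : 'cV[K]_s := \col_i (i == 0 :> nat)%:R.

Hypothesis two : 2%:R != 0 :> K.

Lemma skew_dot0 N (x : 'M[K]_N) v : x^T = - x -> dot v (x *m v) = 0.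
Proof.
move=> xT; have /eqP := skew_dot v v xT.
by rewrite -addr_eq0 -mulr2n -mulr_natl mulf_eq0 (negPf two) => /eqP.
Qed.

(** With [w] scaled so that [(x v, w) = -1], the choice [a = x w], [b = - x v] makes [wedge a b]
    agree with [x] on [v] and [w]. The difference [x'] kills both; its row space lies in that of [x]
    but misses [v^T x], which takes the value 1 on [w]. So the rank drops. *)
Lemma skew_step N (x : 'M[K]_N) (v : 'cV_N) : x^T = - x -> x *m v != 0 ->
  exists a b w : 'cV_N, let x' := x - wedge a b in
    [/\ dot a v = 1, dot b v = 0, dot a w = 0, dot b w = 1 &
        [/\ x'^T = - x', x' *m v = 0, x' *m w = 0 & (\rank x' < \rank x)%N]].
Proof.
move=> xT xv; have [w0 h] := dot_ex1 xv; pose w := - w0.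
have xvw : dot (x *m v) w = -1 by rewrite dotNr h.
have xwv : dot (x *m w) v = 1 by rewrite dotC skew_dot // dotC xvw opprK.
have xvv : dot (x *m v) v = 0 by rewrite dotC skew_dot0.
have xww : dot (x *m w) w = 0 by rewrite dotC skew_dot0.
exists (x *m w), (- (x *m v)), w => x'.
have x'T : x'^T = - x' by rewrite /x' [LHS]linearB /= xT wedge_tr -opprD.
have x'v : x' *m v = 0.
  rewrite /x' mulmxBl wedge_mul dotNl xvv xwv oppr0 scale0r scale1r.
  by rewrite sub0r opprK subrr.
have x'w : x' *m w = 0.
  by rewrite /x' mulmxBl wedge_mul dotNl xvw xww opprK scale0r scale1r subr0 subrr.
rewrite !dotNl xvv xvw xwv xww oppr0 opprK; do 2!split=> //.
have x'x : (x' <= x)%MS.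
  have -> : x' = (1%:M - (x *m w) *m v^T + (x *m v) *m w^T) *m x; last exact: submxMl.
  have bT u : (x *m u)^T = - (u^T *m x) by rewrite trmx_mul xT mulmxN.
  rewrite /x' wedgeE [(- _)^T]linearN /= !bT opprK !mulmxDl mul1mx !mulNmx mulmxN -!mulmxA.
  by rewrite opprD !opprK addrA.
have := mxrank_leqif_sup x'x; rewrite ltn_neqAle => h'; rewrite h'.2 h'.1 andbT.
apply/negP=> xx'; have : (v^T *m x <= x')%MS by exact: submx_trans (submxMl _ _) xx'.
case/submxP=> D /(congr1 (mulmxr w)) /=.
rewrite -[RHS]mulmxA x'w mulmx0 -mulmxA dotE skew_dot // dotC xvw opprK.
by move/matrixP/(_ 0 0)/eqP; rewrite !mxE /= ?oner_eq0.
Qed.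

(** Symplectic Gram-Schmidt: planes are peeled off by [skew_step] until nothing remains. The first
    plane is built from the given [v], which makes [v] the first coordinate vector for [C^T]; in
    later steps any vector outside the kernel serves. *)
Lemma skew_factor_exists N (x : 'M[K]_N) (v : 'cV_N) : x^T = - x -> x *m v != 0 ->
  exists s (C M : 'M_(N, s)),
    [/\ ~~ odd s, x = C *m altJ s *m C^T, C^T *m M = 1%:M & C^T *m v = d0 s].
Proof.
move: {2}(\rank x).+1 (ltnSn (\rank x)) => r; elim: r x v => // r IH x v xr xT xv.
have [a [b [w]]] := skew_step xT xv.
set x' := x - _ => - [av bv aw bw [x'T x'v x'w x'r]].
have [s [C [M [os x'E CM]]]] : exists s (C M : 'M_(N, s)),
    [/\ ~~ odd s, x' = C *m altJ s *m C^T & C^T *m M = 1%:M].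
  have [->|] := eqVneq x' 0.
    by exists 0%N, 0, 0; split=> //; [rewrite mulmx0 mul0mx|apply/matrixP=> - []].
  case/matrix0Pn=> i [j xij].
  have xv' : x' *m (delta_mx j 0 : 'cV_N) != 0.
    by apply/eqP=> /colP /(_ i); rewrite -colE !mxE; apply/eqP; rewrite !mxE in xij.
  have [|s [C [M [os x'E CM _]]]] := IH x' _ _ x'T xv'; first exact: leq_trans x'r _.
  by exists s, C, M.
have Cx' u : x' *m u = 0 -> C^T *m u = 0.
  move=> x'u; have MC : M^T *m C = 1%:M by rewrite -[C]trmxK -trmx_mul CM trmx1.
  have JC : altJ s *m (C^T *m u) = 0.
    by rewrite -[LHS]mul1mx -MC -!mulmxA (mulmxA C) (mulmxA _ C^T) -x'E x'u mulmx0.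
  apply: oppr_inj; rewrite oppr0 -[RHS](mulmx0 _ (altJ s)) -JC mulmxA altJ_sqr //.
  by rewrite mulNmx mul1mx.
have x_E : x = x' + wedge a b by rewrite subrK.
exists s.+2, (row_mx (row_mx a b) C : 'M_(N, 1 + 1 + s)).
exists (row_mx (row_mx v w) (M - v *m (a^T *m M) - w *m (b^T *m M)) : 'M_(N, 1 + 1 + s)).
have Cv : col_mx (col_mx a^T b^T) C^T *m v = d0 s.+2.
  rewrite (@mul_col_mx _ 2 s N 1) (@mul_col_mx _ 1 1 N 1) !dotE av bv (Cx' _ _ x'v).
  apply/colP=> i; rewrite scalar_mx0.
  case: (@split_ordP 2 s i) => {}i ->.
    rewrite (@col_mxEu _ 2 s 1); case: (@split_ordP 1 1 i) => {}i ->.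
      by rewrite (@col_mxEu _ 1 1 1) ord1 !mxE.
    by rewrite (@col_mxEd _ 1 1 1) ord1 !mxE.
  by rewrite (@col_mxEd _ 2 s 1) !mxE.
split=> //=; first by rewrite negbK.
  rewrite (@tr_row_mx _ N 2 s) (@mul_row_block _ N 2 s 2 s) !mulmx0 addr0 add0r (@mul_row_col _ N 2 s N) -x'E (@tr_row_mx _ N 1 1).
  rewrite /alt2 (@mul_row_block _ N 1 1 1 1) !mulmx0 addr0 add0r mulmxN !mulmx1 (@mul_row_col _ N 1 1 N).
  by rewrite mulNmx {1}x_E addrC wedgeE; congr (_ + _); rewrite addrC.
rewrite (@tr_row_mx _ N 2 s) (@tr_row_mx _ N 1 1) (@mul_col_row _ 2 s N 2 s) (@mul_col_row _ 1 1 N 1 1) (@mul_col_mx _ 1 1 N s) (@mul_mx_row _ s N 1 1).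
rewrite !(Cx' _ _ x'v) !(Cx' _ _ x'w) !dotE av bv aw bw.
rewrite !mulmxBr !mulmxA !dotE av bv aw bw !(Cx' _ _ x'v) !(Cx' _ _ x'w) CM.
rewrite !scalar_mx0 !mul0mx !subr0 !mul1mx !subrr ?subr0 ?sub0r ?subrr.
rewrite ?oppr0 ?addr0 (@col_mx0 _ 1 1 s) (@row_mx0 _ s 1 1) -(scalar_mx_block 1 1).
by rewrite -(scalar_mx_block 2 s).
by rewrite (@tr_row_mx _ N 2 s) (@tr_row_mx _ N 1 1).
Qed.

End Factor.

Section Frames.
Variable K : closedFieldType.
Hypothesis two : 2%:R != 0 :> K.

Lemma sqrt_exists (a : K) : exists b, b * b = a.
Proof.
have [b h] := @solve_monicpoly K 2 (nth 0 [:: a]) isT.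
exists b; move: h; rewrite !big_ord_recl big_ord0 /= expr2 => ->.
by rewrite expr0 mulr1 mul0r !addr0.
Qed.

Lemma sym_unit N (S : 'M[K]_N) : S^T = S -> S != 0 -> exists v, dot v (S *m v) = 1.
Proof.
move=> ST S0.
suff [v vv] : exists v : 'cV_N, dot v (S *m v) != 0.
  have [b bb] := sqrt_exists (dot v (S *m v))^-1; exists (b *: v).
  by rewrite -scalemxAr dotZl dotZr mulrA bb mulVf.
case/matrix0Pn: S0 => i [j Sij].
have dE a b : dot (delta_mx a 0) (S *m delta_mx b 0) = S a b.
  by rewrite dot_delta -colE mxE.
case: (eqVneq (S i i) 0) => [ii|]; last by exists (delta_mx i 0); rewrite dE.
case: (eqVneq (S j j) 0) => [jj|]; last by exists (delta_mx j 0); rewrite dE.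
exists (delta_mx i 0 + delta_mx j 0).
rewrite mulmxDr !dot_lin !dE ii jj.
have -> : S j i = S i j by rewrite -[in LHS]ST mxE.
by rewrite add0r addr0 -mulr2n -mulr_natl mulf_neq0.
Qed.

(** Gram-Schmidt for a possibly degenerate form: with [(v, S v) = 1] and [c = S v], the matrix
    [S - c c^T] kills [v] in addition to the kernel of [S], so the rank drops. *)
Lemma sym_factor_exists N (S : 'M[K]_N) : S^T = S ->
  exists s (D M : 'M_(N, s)), S = D *m D^T /\ D^T *m M = 1%:M.
Proof.
move: {2}(\rank S).+1 (ltnSn (\rank S)) => r; elim: r S => // r IH S Sr ST.
have [->|S0] := eqVneq S 0.
  by exists 0%N, 0, 0; split=> //; [rewrite mul0mx|apply/matrixP=> - []].
have [v vv] := sym_unit ST S0; pose c := S *m v; pose S' := S - c *m c^T.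
have cT : c^T = v^T *m S by rewrite trmx_mul ST.
have cv : dot c v = 1 by rewrite dotC.
have S'T : S'^T = S' by rewrite linearB /= ST trmx_mul trmxK.
have S'v : S' *m v = 0 by rewrite mulmxBl outer_mul cv scale1r subrr.
have S'S : (S' <= S)%MS.
  have -> : S' = (1%:M - c *m v^T) *m S; last exact: submxMl.
  by rewrite mulmxBl mul1mx -mulmxA -cT.
have S'r : (\rank S' < \rank S)%N.
  have := mxrank_leqif_sup S'S; rewrite ltn_neqAle => h; rewrite h.2 h.1 andbT.
  apply/negP=> SS'; have : (v^T *m S <= S')%MS by exact: submx_trans (submxMl _ _) SS'.
  case/submxP=> E; rewrite -cT => /(congr1 (mulmxr v)) /=.
  rewrite -[RHS]mulmxA S'v mulmx0 dotE cv.
  by move/matrixP/(_ 0 0)/eqP; rewrite !mxE /= ?oner_eq0.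
have [|s [D [M [S'E DM]]]] := IH S' _ S'T; first exact: leq_trans S'r _.
have Dv : D^T *m v = 0.
  have MD : M^T *m D = 1%:M by rewrite -[D]trmxK -trmx_mul DM trmx1.
  by rewrite -[LHS]mul1mx -MD -!mulmxA (mulmxA D) -S'E S'v mulmx0.
exists s.+1, (row_mx c D : 'M_(N, 1 + s)), (row_mx v (M - v *m (c^T *m M)) : 'M_(N, 1 + s)).
split.
  by rewrite (@tr_row_mx _ N 1 s) (@mul_row_col _ N 1 s N) -S'E addrC subrK.
rewrite (@tr_row_mx _ N 1 s) (@mul_col_row _ 1 s N 1 s) !mulmxBr !mulmxA Dv dotE cv.
by rewrite !mul0mx subr0 mul1mx subrr DM -(scalar_mx_block 1 s).
Qed.

Lemma mxrank_factor N s (D M : 'M[K]_(N, s)) (E : 'M_s) :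
  D^T *m M = 1%:M -> \rank (D *m E *m D^T) = \rank E.
Proof.
move=> DM; have MD : M^T *m D = 1%:M by rewrite -[D]trmxK -trmx_mul DM trmx1.
apply/eqP; rewrite eqn_leq; apply/andP; split.
  exact: leq_trans (mxrankM_maxl _ _) (mxrankM_maxr _ _).
have {1}-> : E = M^T *m (D *m E *m D^T) *m M.
  by rewrite !mulmxA MD mul1mx -mulmxA DM mulmx1.
exact: leq_trans (mxrankM_maxl _ _) (mxrankM_maxr _ _).
Qed.

Lemma sym_factor N s (S : 'M[K]_N) : S^T = S -> \rank S = s ->
  exists (D M : 'M_(N, s)), S = D *m D^T /\ D^T *m M = 1%:M.
Proof.
move=> ST; have [r [D [M [SE DM]]]] := sym_factor_exists ST.
have -> : \rank S = r by rewrite SE -[X in X *m _]mulmx1 (mxrank_factor _ DM) mxrank1.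
by move=> rs; subst r; exists D, M.
Qed.

(** For an orthogonal projector, [S S = S] reads [D (D^T D) D^T = D D^T]; cancelling [D] with [M]
    gives an orthonormal basis of the image. *)
Lemma proj_factor N s (S : 'M[K]_N) : S^T = S -> S *m S = S -> \rank S = s ->
  exists D : 'M_(N, s), S = D *m D^T /\ D^T *m D = 1%:M.
Proof.
move=> ST SS /(sym_factor ST) [D [M [SE DM]]]; exists D; split=> //.
have MD : M^T *m D = 1%:M by rewrite -[D]trmxK -trmx_mul DM trmx1.
have := congr1 (fun A => M^T *m A *m M) SS; rewrite {1 2}SE SE !mulmxA MD mul1mx.
by rewrite -!mulmxA DM !mulmx1.
Qed.

Lemma skew_factor N s (x : 'M[K]_N) (v : 'cV_N) :
  x^T = - x -> \rank x = s -> x *m v != 0 ->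
  exists (C M : 'M_(N, s)),
    [/\ ~~ odd s, x = C *m altJ K s *m C^T, C^T *m M = 1%:M & C^T *m v = d0 K s].
Proof.
move=> xT rx xv; have [r [C [M [os xE CM Cv]]]] := skew_factor_exists two xT xv.
have rs : r = s by rewrite -rx xE (mxrank_factor _ CM) mxrank_unit ?altJ_unit.
by subst r; exists C, M.
Qed.

End Frames.

(** A Witt basis: [A] and [C] are dual bases of two totally isotropic subspaces, [D] is an
    orthonormal basis of the orthogonal complement of their sum, and the last identity is
    completeness. *)
Definition hyp_frame (K : fieldType) N s m (A C : 'M[K]_(N, s)) (D : 'M[K]_(N, m)) :=
  [/\ A^T *m A = 0, C^T *m C = 0, A^T *m C = 1%:M, D^T *m D = 1%:M &
      [/\ D^T *m A = 0, D^T *m C = 0 & A *m C^T + C *m A^T + D *m D^T = 1%:M]].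

Lemma rank_retract (K : fieldType) N r (U : 'M[K]_(N, r)) (V : 'M_(r, N)) :
  V *m U = 1%:M -> \rank (U *m V) = r.
Proof.
move=> VU; apply/eqP; rewrite eqn_leq; apply/andP; split.
  exact: leq_trans (mxrankM_maxl _ _) (rank_leq_col _).
have E : V *m (U *m V) *m U = 1%:M by rewrite !mulmxA VU mul1mx VU.
apply: (@leq_trans (\rank (1%:M : 'M[K]_r))); first by rewrite mxrank1.
by rewrite -E; exact: leq_trans (mxrankM_maxl _ _) (mxrankM_maxr _ _).
Qed.

Lemma trmx_eq (K : fieldType) n m p (A : 'M[K]_(n, m)) (B : 'M_(n, p)) C :
  A^T *m B = C -> B^T *m A = C^T.
Proof. by move<-; rewrite trmx_mul trmxK. Qed.

Section HypFrame.
Variable K : closedFieldType.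
Hypothesis two : 2%:R != 0 :> K.

(** [E = A C^T + C A^T] is the orthogonal projector onto the hyperbolic part; [1 - E] is a symmetric
    idempotent of rank [m], hence of the form [D D^T]. *)
Lemma hyp_complement N s m (A C : 'M[K]_(N, s)) : (N = s + s + m)%N ->
  A^T *m A = 0 -> C^T *m C = 0 -> A^T *m C = 1%:M ->
  exists D : 'M_(N, m), hyp_frame A C D.
Proof.
move=> NE AA CC hAC; have CA : C^T *m A = 1%:M by rewrite (trmx_eq hAC) trmx1.
pose E := A *m C^T + C *m A^T; pose S := 1%:M - E.
have rE : \rank E = (s + s)%N.
  rewrite /E -(@mul_row_col _ N s s N) rank_retract //.
  by rewrite mul_col_row AA CC hAC CA -scalar_mx_block.
have EA : E *m A = A by rewrite mulmxDl -!mulmxA CA AA mulmx1 mulmx0 addr0.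
have EC : E *m C = C by rewrite mulmxDl -!mulmxA CC hAC mulmx1 mulmx0 add0r.
have EE : E *m E = E by rewrite {2}/E mulmxDr !mulmxA EA EC.
have ET : E^T = E by rewrite linearD /= !trmx_mul !trmxK addrC.
have ST : S^T = S by rewrite linearB /= trmx1 ET.
have SS : S *m S = S by rewrite mulmxBl mul1mx mulmxBr mulmx1 EE subrr subr0.
have rS : \rank S = m.
  by apply/eqP; rewrite -(eqn_add2l (s + s)) -NE -{1}rE rank_idem_compl.
have [D [SD DD]] := proj_factor two ST SS rS.
have DS : D^T *m S = D^T by rewrite SD mulmxA DD mul1mx.
have SA : S *m A = 0 by rewrite mulmxBl mul1mx EA subrr.
have SC : S *m C = 0 by rewrite mulmxBl mul1mx EC subrr.
exists D; do 2!split=> //.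
- by rewrite -DS -mulmxA SA mulmx0.
- by rewrite -DS -mulmxA SC mulmx0.
by rewrite -/E -SD addrC subrK.
Qed.

(** Writing [x = C J C^T] with [J] invertible, [x x = 0] says that the image, spanned by [C], is
    totally isotropic. What remains is a dual isotropic [A] adjusted to [v]: in the plane of the
    first columns of [A] and [C], the vector with coordinates 1 and 1/2 has norm 1, and it has to be
    [v]. In such a basis [x] and [v] have fixed coordinates. *)
Lemma null2_frame N s m (x : 'M[K]_N) (v : 'cV_N) : (N = s + s + m)%N ->
  x^T = - x -> x *m x = 0 -> \rank x = s -> dot v v = 1 -> x *m v != 0 ->
  exists (A C : 'M_(N, s)) (D : 'M_(N, m)),
    [/\ hyp_frame A C D, x = C *m altJ K s *m C^T, ~~ odd s, (0 < s)%N &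
        v = A *m d0 K s + 2%:R^-1 *: (C *m d0 K s)].
Proof.
move=> NE xT xx rx vv xv.
have [C [M [os xE CM Cv]]] := skew_factor two xT rx xv.
have s0 : (0 < s)%N.
  case: s rx {NE C M os xE CM Cv} => // /eqP; rewrite mxrank_eq0 => /eqP x0.
  by rewrite x0 mul0mx eqxx in xv.
have MC : M^T *m C = 1%:M by rewrite (trmx_eq CM) trmx1.
have uJ := altJ_unit K os; set J := altJ K s in xE uJ.
have CC : C^T *m C = 0.
  have h : J *m (C^T *m C) *m J = 0.
    have := congr1 (fun B => M^T *m B *m M) xx.
    rewrite mulmx0 mul0mx xE -!mulmxA CM mulmx1 (mulmxA M^T) MC mul1mx !mulmxA.
    by move->.
  rewrite -[LHS](mulKmx uJ) -[X in _ *m X](mulmxK uJ) h mul0mx mulmx0 //.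
set d := d0 K s in Cv *.
have dd1 : dot d d = 1.
  rewrite dot_sum (bigD1 (Ordinal s0)) //= !mxE mulr1 big1 ?addr0 // => i.
  by rewrite -val_eqE /= !mxE => /negPf ->; rewrite mul0r.
have dd : d^T *m d = 1%:M by rewrite dotE dd1.
(* The prescribed first column of [A]. It is isotropic because [(v, v) = 1], [(v, C d) = 1] and
   [C d] is isotropic. *)
pose a := v - 2%:R^-1 *: (C *m d).
pose A0 := M + (a - M *m d) *m d^T.
have Ca : C^T *m a = d by rewrite mulmxBr Cv -scalemxAr mulmxA CC mul0mx scaler0 subr0.
have CA0 : C^T *m A0 = 1%:M.
  by rewrite mulmxDr CM mulmxA mulmxBr Ca mulmxA CM mul1mx subrr mul0mx addr0.
have A0C : A0^T *m C = 1%:M by rewrite (trmx_eq CA0) trmx1.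
have A0d : A0 *m d = a.
  by rewrite mulmxDl -mulmxA dd mulmx1 addrC subrK.
have aa : a^T *m a = 0.
  rewrite dotE /a !dot_lin vv.
  have -> : dot (C *m d) (C *m d) = 0 by rewrite dot_mulmxl mulmxA CC mul0mx dot0r.
  have -> : dot v (C *m d) = 1.
    by rewrite dotC dot_mulmxl Cv.
  have -> : dot (C *m d) v = 1 by rewrite dot_mulmxl Cv.
  by rewrite -[RHS]scalar_mx0; congr _%:M; field.
have aE : a = v - 2%:R^-1 *: (C *m d) by [].
clearbody A0 a; pose P := d *m d^T; have [Q QE] : {Q | Q = 1%:M - P} by exists (1%:M - P).
pose G := A0^T *m A0.
pose h : K := 2%:R^-1.
(* [C T] must cancel the Gram matrix [G] of [A0] and leave the first column alone, that is
   [T + T^T = - G] and [T d = 0]. On the block [Q G Q] half of [- G] does it; the mixed blocks are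
   put entirely into [P G Q], which kills [d]; and [P G P] vanishes because [a] is isotropic. *)
pose T := - (h *: (Q *m G *m Q)) - P *m G *m Q.
have PT : P^T = P by rewrite trmx_mul trmxK.
have QT : Q^T = Q by rewrite QE linearB /= trmx1 PT.
have GT : G^T = G by rewrite trmx_mul trmxK.
have trG X Y : (X *m G *m Y)^T = Y^T *m G *m X^T.
  by rewrite (trmx_mul _ Y) (trmx_mul X) GT mulmxA.
have PGP : P *m G *m P = 0.
  have -> : P *m G *m P = (A0 *m P)^T *m (A0 *m P) by rewrite trmx_mul PT !mulmxA.
  have -> : A0 *m P = a *m d^T by rewrite mulmxA A0d.
  by rewrite trmx_mul trmxK mulmxA -(mulmxA d) aa mulmx0 mul0mx.
have Qd : Q *m d = 0 by rewrite QE mulmxBl mul1mx -mulmxA dd mulmx1 subrr.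
have Td : T *m d = 0.
  by rewrite mulmxBl mulNmx -scalemxAl -!(mulmxA _ Q d) Qd !mulmx0 scaler0 !oppr0 addr0.
have TT : T^T + T = - G.
  have -> : T^T = - (h *: (Q *m G *m Q)) - Q *m G *m P.
    by rewrite [LHS]linearB /= linearN linearZ /= !trG QT PT.
  have -> : - G = - (P + Q) *m G *m (P + Q).
    by rewrite QE addrC subrK mulmx1 mulNmx mul1mx.
  rewrite !(mulmxDr, mulmxDl, mulNmx, mulmxN) PGP.
  rewrite /T /h; set X := Q *m G *m Q; set Y := P *m G *m Q; set Z := Q *m G *m P.
  by mxfield.
pose A := A0 + C *m T.
have AE : A = A0 + C *m T by [].
have AT : A^T = A0^T + T^T *m C^T by rewrite -trmx_mul -linearD.
have AA : A^T *m A = 0.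
  rewrite AT mulmxDl {1 2}AE !(mulmxDr (A0^T), mulmxDr (T^T *m C^T)) -/G (mulmxA A0^T) A0C mul1mx.
  rewrite -(mulmxA _ _ A0) CA0 mulmx1 (mulmxA _ C) -(mulmxA _ C^T C) CC mulmx0 mul0mx addr0 -addrA.
  by rewrite (addrC T) TT subrr.
have hAC : A^T *m C = 1%:M.
  by rewrite AT mulmxDl A0C -mulmxA CC mulmx0 addr0.
have [D fr] := hyp_complement NE AA CC hAC.
exists A, C, D; split=> //.
by rewrite AE mulmxDl -mulmxA Td mulmx0 addr0 A0d aE subrK.
Qed.

Lemma frame_conj N s m (A C A' C' : 'M[K]_(N, s)) (D D' : 'M[K]_(N, m)) :
  hyp_frame A C D -> hyp_frame A' C' D' ->
  let g := A' *m C^T + C' *m A^T + D' *m D^T in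
  [/\ g^T *m g = 1%:M, g *m A = A', g *m C = C' & g *m D = D'].
Proof.
move=> [AA CC hAC DD [DA DC PP]] [AA' CC' hAC' DD' [DA' DC' PP']] g.
have CA : C^T *m A = 1%:M by rewrite (trmx_eq hAC) trmx1.
have CA' : C'^T *m A' = 1%:M by rewrite (trmx_eq hAC') trmx1.
have AD : A^T *m D = 0 by rewrite (trmx_eq DA) trmx0.
have CD : C^T *m D = 0 by rewrite (trmx_eq DC) trmx0.
have AD' : A'^T *m D' = 0 by rewrite (trmx_eq DA') trmx0.
have CD' : C'^T *m D' = 0 by rewrite (trmx_eq DC') trmx0.
have gA : g *m A = A'.
  by rewrite !mulmxDl -!mulmxA CA AA DA !mulmx0 mulmx1 !addr0.
have gC : g *m C = C'.
  by rewrite !mulmxDl -!mulmxA CC hAC DC !mulmx0 mulmx1 add0r addr0.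
have gD : g *m D = D'.
  by rewrite !mulmxDl -!mulmxA CD AD DD !mulmx0 mulmx1 !add0r.
split=> //.
have gT : g^T = C *m A'^T + A *m C'^T + D *m D'^T.
  by rewrite !linearD /= !trmx_mul !trmxK.
have gTA : g^T *m A' = A.
  by rewrite gT !mulmxDl -!mulmxA CA' AA' DA' !mulmx0 mulmx1 !(addr0, add0r).
have gTC : g^T *m C' = C.
  by rewrite gT !mulmxDl -!mulmxA CC' hAC' DC' !mulmx0 mulmx1 !(addr0, add0r).
have gTD : g^T *m D' = D.
  by rewrite gT !mulmxDl -!mulmxA CD' AD' DD' !mulmx0 mulmx1 !(addr0, add0r).
by rewrite {2}/g !mulmxDr !mulmxA gTA gTC gTD.
Qed.

End HypFrame.

(** * Orthogonal groups *)

Section Orth.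
Variable K : closedFieldType.
Hypothesis two : 2%:R != 0 :> K.

Lemma orth_r n (g : 'M[K]_n) : g^T *m g = 1%:M -> g *m g^T = 1%:M.
Proof. exact: mulmx1C. Qed.

Lemma orth_unit n (g : 'M[K]_n) : g^T *m g = 1%:M -> g \in unitmx.
Proof. by case/mulmx1_unit. Qed.

Lemma orth_inv n (g : 'M[K]_n) : g^T *m g = 1%:M -> invmx g = g^T.
Proof.
move=> gg; have ug := orth_unit gg.
by apply: (can_inj (mulKmx ug)); rewrite mulmxV // orth_r.
Qed.

Lemma orth_mul n (g h : 'M[K]_n) :
  g^T *m g = 1%:M -> h^T *m h = 1%:M -> (g *m h)^T *m (g *m h) = 1%:M.
Proof. by move=> gg hh; rewrite trmx_mul -mulmxA (mulmxA g^T) gg mul1mx. Qed.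

Lemma orth_tr n (g : 'M[K]_n) : g^T *m g = 1%:M -> (g^T)^T *m g^T = 1%:M.
Proof. by move=> gg; rewrite trmxK orth_r. Qed.

Lemma orth_det n (g : 'M[K]_n) : g^T *m g = 1%:M -> \det g = 1 \/ \det g = -1.
Proof.
move/(congr1 determinant); rewrite det_mulmx det_tr det1 => /eqP.
by rewrite -expr2 -subr_eq0 subr_sqr_1 mulf_eq0 subr_eq0 addr_eq0 => /orP [] /eqP; [left|right].
Qed.

Lemma orth_conj n (g x y : 'M[K]_n) : g^T *m g = 1%:M -> g *m x = y *m g ->
  g *m x *m invmx g = y.
Proof. by move=> gg gx; rewrite gx mulmxK // orth_unit. Qed.

Lemma conj_skew n (g x : 'M[K]_n) : g^T *m g = 1%:M -> x^T = - x ->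
  (g *m x *m invmx g)^T = - (g *m x *m invmx g).
Proof.
move=> gg xT; rewrite orth_inv // !trmx_mul trmxK xT mulNmx mulmxN mulmxA.
by [].
Qed.

Lemma SO_mul n (g h : 'M[K]_n) : SO K n g -> SO K n h -> SO K n (g *m h).
Proof. by move=> [gg dg] [hh dh]; split; [exact: orth_mul | rewrite det_mulmx dg dh mulr1]. Qed.

Lemma SO_tr n (g : 'M[K]_n) : SO K n g -> SO K n g^T.
Proof. by move=> [gg dg]; split; [exact: orth_tr | rewrite det_tr]. Qed.

Lemma SO1 n : SO K n 1%:M.
Proof. by split; rewrite ?trmx1 ?mulmx1 ?det1. Qed.

Definition elast n : 'cV[K]_(n + 1) := col_mx 0 1%:M.

Lemma dot_elast n : dot (elast n) (elast n) = 1.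
Proof.
have : (elast n)^T *m elast n = 1%:M.
  by rewrite tr_col_mx mul_row_col trmx0 mul0mx add0r trmx1 mulmx1.
by rewrite dotE => /matrixP /(_ 0 0); rewrite !mxE !eqxx.
Qed.

Lemma dot_sqr1 n (d : 'cV[K]_n) : dot d d = 1 -> d^T *m d = 1%:M.
Proof. by rewrite dotE => ->. Qed.

Definition flip n : 'M[K]_n :=
  diag_mx (\row_j (if j == 0 :> nat then -1 else 1)).

Lemma flip_orth n : (flip n)^T *m flip n = 1%:M.
Proof.
rewrite tr_diag_mx mulmx_diag -diag_const_mx; congr diag_mx.
apply/rowP=> j; rewrite !mxE; case: ifP => _; rewrite ?mulr1 // mulrNN mulr1 //.
Qed.

Lemma det_flip n : (0 < n)%N -> \det (flip n) = -1.
Proof.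
case: n => // n _; rewrite det_diag (bigD1 ord0) //= mxE eqxx big1 ?mulr1 // => i.
by rewrite -val_eqE /= mxE => /negPf->.
Qed.

Lemma unit_transitive n (f : 'cV[K]_(n + 1)) : (0 < n)%N -> dot f f = 1 ->
  exists2 g, SO K (n + 1) g & g *m elast n = f.
Proof.
move=> n0 ff; have ff1 := dot_sqr1 ff.
pose E := f *m f^T; pose S := 1%:M - E.
have EE : E *m E = E by rewrite mulmxA outer_mul ff scale1r.
have ET : E^T = E by rewrite trmx_mul trmxK.
have ST : S^T = S by rewrite linearB /= trmx1 ET.
have SS : S *m S = S by rewrite mulmxBl mul1mx mulmxBr mulmx1 EE subrr subr0.
have rS : \rank S = n.
  have := rank_idem_compl EE; rewrite [\rank E]rank_retract ?ff1 // -/S; lia.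
have [D [SD DD]] := proj_factor two ST SS rS.
have Sf : S *m f = 0 by rewrite mulmxBl mul1mx outer_mul ff scale1r subrr.
have Df : D^T *m f = 0.
  by rewrite -[LHS]mul1mx -DD -!mulmxA (mulmxA D) -SD Sf mulmx0.
have fD : f^T *m D = 0 by rewrite (trmx_eq Df) trmx0.
have gg (R : 'M_n) : R^T *m R = 1%:M ->
    (row_mx (D *m R) f)^T *m (row_mx (D *m R) f) = 1%:M.
  move=> RR; rewrite tr_row_mx mul_col_row trmx_mul -!mulmxA (mulmxA D^T D) DD mul1mx RR.
  by rewrite (mulmxA f^T) fD mul0mx Df mulmx0 ff1 -scalar_mx_block.
have ge (R : 'M_n) : row_mx (D *m R) f *m elast n = f.
  by rewrite mul_row_col mulmx0 add0r mulmx1.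
have /gg g1 : (1%:M : 'M[K]_n)^T *m 1%:M = 1%:M by rewrite trmx1 mulmx1.
have /gg g2 := flip_orth n.
have detg : \det (row_mx (D *m flip n) f) = - \det (row_mx (D *m 1%:M) f).
  have -> : row_mx (D *m flip n) f = row_mx (D *m 1%:M) f *m block_mx (flip n) 0 0 1%:M.
    by rewrite mul_row_block !mulmx0 !mulmx1 addr0 add0r.
  by rewrite det_mulmx det_ublock det1 mulr1 det_flip // mulrN1.
case: (orth_det g1) => dg.
  by exists (row_mx (D *m 1%:M) f).
by exists (row_mx (D *m flip n) f) => //; split=> //; rewrite detg dg opprK.
Qed.

Definition refl n (d : 'cV[K]_n) : 'M[K]_n := 1%:M - 2%:R *: (d *m d^T).

Lemma refl_mul n (d v : 'cV[K]_n) : refl d *m v = v - (2%:R * dot d v) *: d.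
Proof. by rewrite mulmxBl mul1mx -scalemxAl outer_mul scalerA. Qed.

Lemma refl_tr n (d : 'cV[K]_n) : (refl d)^T = refl d.
Proof. by rewrite linearB linearZ /= trmx1 trmx_mul trmxK. Qed.

Lemma refl_sqr n (d : 'cV[K]_n) : dot d d = 1 -> refl d *m refl d = 1%:M.
Proof.
move=> dd; apply: mx_cV_ext => u; rewrite -mulmxA !refl_mul !dot_lin dd mul1mx.
by mxring.
Qed.

Lemma refl_orth n (d : 'cV[K]_n) : dot d d = 1 -> (refl d)^T *m refl d = 1%:M.
Proof. by move=> dd; rewrite refl_tr refl_sqr. Qed.

Lemma det_refl n (d : 'cV[K]_(n + 1)) : (0 < n)%N -> dot d d = 1 -> \det (refl d) = -1.
Proof.
move=> n0 dd; have [g [gg dg] ge] := unit_transitive n0 dd.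
have -> : refl d = g *m refl (elast n) *m g^T.
  rewrite /refl mulmxBr mulmxBl mulmx1 orth_r // -scalemxAr -scalemxAl.
  by rewrite -ge trmx_mul !mulmxA.
rewrite !det_mulmx det_tr dg mul1r mulr1.
have -> : refl (elast n) = block_mx 1%:M 0 0 (- 1%:M).
  rewrite /refl /elast tr_col_mx mul_col_row trmx0 trmx1 !mulmx0 !mul0mx mulmx1.
  rewrite scale_block_mx !scaler0 scalar_mx_block opp_block_mx add_block_mx !oppr0 !addr0.
  congr block_mx; by mxring.
by rewrite det_ublock det1 mul1r det_mx11 !mxE.
Qed.

(** An orthogonal matrix fixing the last basis vector also has a transpose fixing it, which makes
    both off-diagonal blocks zero. *)
Lemma SO_subP n (g : 'M[K]_(n + 1)) :
  SO_sub K n g <-> SO K (n + 1) g /\ g *m elast n = elast n.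
Proof.
split=> [[a [aa da] <-]|[[gg dg] ge]].
  split; last by rewrite mul_block_col !mul0mx mulmx0 mul1mx !add0r.
  split; last by rewrite det_ublock da det1 mulr1.
  rewrite tr_block_mx !trmx0 trmx1 mulmx_block !mul0mx !mulmx0 mulmx1 !add0r !addr0 aa.
  by rewrite -scalar_mx_block.
have gte : g^T *m elast n = elast n by rewrite -{1}ge mulmxA gg mul1mx.
move: gg dg ge gte (submxK g).
move: (ulsubmx g) (ursubmx g) (dlsubmx g) (drsubmx g) => a b c d gg dg ge gte gE.
rewrite -{g}gE in gg dg ge gte *.
move: ge gte; rewrite /elast tr_block_mx !mul_block_col !mulmx0 !mulmx1 !add0r.
move=> /eq_col_mx [b0 d1] /eq_col_mx [cT _].
have c0 : c = 0 by rewrite -[LHS]trmxK cT trmx0.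
subst b c d; exists a => //.
move: gg dg; rewrite det_ublock det1 mulr1 => gg dg; split=> //.
move: gg; rewrite tr_block_mx !trmx0 trmx1 mulmx_block !mul0mx !mulmx0 mulmx1 !add0r !addr0.
by rewrite scalar_mx_block => /eq_block_mx [].
Qed.

Lemma isotropic_mx n m (A : 'M[K]_(m, n)) :
  (forall u : 'rV_m, u *m A *m (u *m A)^T = 0) -> A *m A^T = 0.
Proof.
move=> h; have q u v : dot u (A *m A^T *m v) + dot v (A *m A^T *m u) = 0.
  have z u' : dot u' (A *m A^T *m u') = 0.
    have := h u'^T; rewrite trmx_mul trmxK -!mulmxA (mulmxA A) dotE.
    by move/matrixP /(_ 0 0); rewrite !mxE eqxx.
  have := z (u + v); rewrite mulmxDr !dot_lin !z add0r addr0 addrC.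
  by rewrite addrC.
apply: mx_cV_ext => v; rewrite mul0mx; apply: dot_eq0 => u.
have := q u v; rewrite [dot v _]dotC dot_mulmxl trmx_mul trmxK -mulr2n -mulr_natl.
by move/eqP; rewrite mulf_eq0 (negPf two) => /eqP.
Qed.

(** Without a vector of nonzero norm the kernel is totally isotropic, so [N - rank z <= rank z].
    Together with the bound on the rank this gives [N = 2 rank z], and the kernel equals its own
    orthogonal, which is the image; then [z z = 0]. Either alternative of the hypothesis excludes
    this. *)
Lemma kernel_unit N (z : 'M[K]_N) : z^T = - z -> ((\rank z).*2 <= N)%N ->
  N != (\rank z).*2 \/ z *m z != 0 ->
  exists2 d, dot d d = 1 & z *m d = 0.
Proof.
move=> zT rN h; pose A := kermx z.
have Az : A *m z = 0 by exact: mulmx_ker.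
have zA : z *m A^T = 0.
  by rewrite -[z]opprK -zT mulNmx -trmx_mul Az trmx0 oppr0.
suff [u uu] : exists u : 'rV_N, u *m A *m (u *m A)^T != 0.
  pose v := (u *m A)^T; have vv : dot v v != 0.
    apply: contraNneq uu => vv.
    by have := dotE v v; rewrite trmxK vv scalar_mx0 => ->.
  have [b bb] := sqrt_exists (dot v v)^-1; exists (b *: v).
    by rewrite dotZl dotZr mulrA bb mulVf.
  by rewrite -scalemxAr /v trmx_mul mulmxA zA mul0mx scaler0.
apply: contrapT => /forallNP hh; have AA : A *m A^T = 0.
  by apply: isotropic_mx => u; apply/eqP; have := hh u; move/negP; rewrite negbK.
have rA : (\rank A + \rank z = N)%N by rewrite mxrank_ker subnK ?rank_leq_row.
have rA' : (\rank A + \rank A^T <= N)%N by exact: mulmx0_rank_max.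
rewrite mxrank_tr in rA'.
have rE : \rank A = \rank z by lia.
case: h => [|/eqP]; first by rewrite -addnn -{1}rE rA eqxx.
apply; have Ak : (A <= kermx A^T)%MS by apply/sub_kermxP.
have zk : (z <= kermx A^T)%MS by apply/sub_kermxP.
have := mxrank_leqif_sup Ak; rewrite mxrank_ker mxrank_tr => -[_].
have -> : (\rank A == N - \rank A)%N by apply/eqP; lia.
move=> /esym kA; have zA' : (z <= A)%MS by exact: submx_trans zk kA.
by apply/sub_kermxP.
Qed.

End Orth.

(** * Zariski closure and the Killing form *)

Section PolyFun.
Variable K : fieldType.
Hypothesis char0 : [pchar K] =i pred0.

Lemma natr_neq0 n : n.+1%:R != 0 :> K.
Proof. by rewrite (pcharf0P K).1. Qed.

Lemma poly_ext0 (p : {poly K}) : (forall t, p.[t] = 0) -> p = 0.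
Proof.
move=> h; apply/eqP/negPn/negP => p0.
pose s := [seq (i%:R : K) | i <- iota 0 (size p)].
have := max_poly_roots p0 (rs := s); rewrite /s size_map size_iota ltnn => c.
suff : false by []; apply: c; first by apply/allP=> a _; apply/eqP; exact: h.
rewrite map_inj_uniq ?iota_uniq // => i j; wlog ij : i j / (i <= j)%N.
  by move=> w e; case/orP: (leq_total i j) => /w; [apply|move/(_ (esym e))].
move=> e; have : (j - i)%:R = 0 :> K by rewrite natrB // e subrr.
by move/eqP; rewrite (pcharf0P K).1 // subn_eq0 => ji; apply/eqP; rewrite eqn_leq ij.
Qed.

Definition polyfun (f : K -> K) := exists p : {poly K}, forall t, f t = p.[t].

Lemma polyfun_ext f g : f =1 g -> polyfun f -> polyfun g.
Proof. by move=> fg [p fp]; exists p => t; rewrite -fg. Qed.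
Lemma polyfun_cst c : polyfun (fun=> c).
Proof. by exists c%:P => t; rewrite hornerC. Qed.
Lemma polyfun_id : polyfun id.
Proof. by exists 'X => t; rewrite hornerX. Qed.
Lemma polyfunD f g : polyfun f -> polyfun g -> polyfun (fun t => f t + g t).
Proof. by move=> [p fp] [q gq]; exists (p + q) => t; rewrite hornerD fp gq. Qed.
Lemma polyfunM f g : polyfun f -> polyfun g -> polyfun (fun t => f t * g t).
Proof. by move=> [p fp] [q gq]; exists (p * q) => t; rewrite hornerM fp gq. Qed.
Lemma polyfunN f : polyfun f -> polyfun (fun t => - f t).
Proof. by move=> [p fp]; exists (- p) => t; rewrite hornerN fp. Qed.
Lemma polyfunB f g : polyfun f -> polyfun g -> polyfun (fun t => f t - g t).
Proof. by move=> pf pg; apply: polyfunD => //; apply: polyfunN. Qed.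
Lemma polyfunX f n : polyfun f -> polyfun (fun t => f t ^+ n).
Proof. by move=> [p fp]; exists (p ^+ n) => t; rewrite horner_exp fp. Qed.
Lemma polyfun_sum (I : Type) (r : seq I) (P : pred I) (F : I -> K -> K) :
  (forall i, polyfun (F i)) -> polyfun (fun t => \sum_(i <- r | P i) F i t).
Proof.
move=> pF; elim: r => [|a r IH].
  by apply: polyfun_ext (polyfun_cst 0) => t; rewrite big_nil.
case Pa : (P a).
  by apply: polyfun_ext (polyfunD (pF a) IH) => t; rewrite big_cons Pa.
by apply: polyfun_ext IH => t; rewrite big_cons Pa.
Qed.
Lemma polyfun_prod (I : Type) (r : seq I) (P : pred I) (F : I -> K -> K) :
  (forall i, polyfun (F i)) -> polyfun (fun t => \prod_(i <- r | P i) F i t).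
Proof.
move=> pF; elim: r => [|a r IH].
  by apply: polyfun_ext (polyfun_cst 1) => t; rewrite big_nil.
case Pa : (P a).
  by apply: polyfun_ext (polyfunM (pF a) IH) => t; rewrite big_cons Pa.
by apply: polyfun_ext IH => t; rewrite big_cons Pa.
Qed.

Lemma polyfun_mul0 f g : polyfun f -> polyfun g -> (forall t, f t * g t = 0) ->
  (forall t, f t = 0) \/ (forall t, g t = 0).
Proof.
move=> [p fp] [q gq] fg.
have /eqP : p * q = 0 by apply: poly_ext0 => t; rewrite hornerM -fp -gq.
rewrite mulf_eq0 => /orP [] /eqP e; [left|right] => t.
  by rewrite fp e horner0.
by rewrite gq e horner0.
Qed.

Definition polycurve m n (X : K -> 'M[K]_(m, n)) := forall i j, polyfun (fun t => X t i j).

Lemma polycurve_cst m n (A : 'M[K]_(m, n)) : polycurve (fun=> A).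
Proof. by move=> i j; exact: polyfun_cst. Qed.
Lemma polycurveD m n (X Y : K -> 'M[K]_(m, n)) :
  polycurve X -> polycurve Y -> polycurve (fun t => X t + Y t).
Proof.
move=> pX pY i j; apply: (@polyfun_ext (fun t => X t i j + Y t i j)); last exact: polyfunD.
by move=> t; rewrite mxE.
Qed.
Lemma polycurveN m n (X : K -> 'M[K]_(m, n)) : polycurve X -> polycurve (fun t => - X t).
Proof.
move=> pX i j; apply: (@polyfun_ext (fun t => - X t i j)); last exact: polyfunN.
by move=> t; rewrite mxE.
Qed.
Lemma polycurveZ m n f (X : K -> 'M[K]_(m, n)) : polyfun f ->
  polycurve X -> polycurve (fun t => f t *: X t).
Proof.
move=> pf pX i j; apply: (@polyfun_ext (fun t => f t * X t i j)); last exact: polyfunM.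
by move=> t; rewrite mxE.
Qed.
Lemma polycurveM m n p (X : K -> 'M[K]_(m, n)) (Y : K -> 'M[K]_(n, p)) :
  polycurve X -> polycurve Y -> polycurve (fun t => X t *m Y t).
Proof.
move=> pX pY i j; apply: (@polyfun_ext (fun t => \sum_k X t i k * Y t k j)).
  by move=> t; rewrite mxE.
by apply: polyfun_sum => k; exact: polyfunM.
Qed.
Lemma polycurve_tr m n (X : K -> 'M[K]_(m, n)) : polycurve X -> polycurve (fun t => (X t)^T).
Proof.
move=> pX i j; apply: (@polyfun_ext (fun t => X t j i)); last exact: pX.
by move=> t; rewrite mxE.
Qed.
Lemma polyfun_dot n (X Y : K -> 'cV[K]_n) :
  polycurve X -> polycurve Y -> polyfun (fun t => dot (X t) (Y t)).
Proof.
move=> pX pY; apply: (@polyfun_ext (fun t => \sum_i X t i 0 * Y t i 0)).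
  by move=> t; rewrite dot_sum.
by apply: polyfun_sum => i; exact: polyfunM.
Qed.
Lemma polyfun_det n (X : K -> 'M[K]_n) : polycurve X -> polyfun (fun t => \det (X t)).
Proof.
move=> pX; rewrite /determinant; apply: polyfun_sum => s.
by apply: polyfunM; [exact: polyfun_cst|apply: polyfun_prod => i; exact: pX].
Qed.

Lemma polyfun_eval n (p : {mpoly K[n * n]}) (X : K -> 'M[K]_n) :
  polycurve X -> polyfun (fun t => mx_eval p (X t)).
Proof.
move=> pX; apply: polyfun_ext (fun t => esym (mevalE _ _)) _ => /=.
apply: polyfun_sum => m; apply: polyfunM; first exact: polyfun_cst.
apply: polyfun_prod => i; apply: polyfunX; case/mxvec_indexP: i => i j.
by apply: polyfun_ext (pX i j) => t; rewrite mxvecE.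
Qed.

(** If [p] vanishes on [S], the product of [p (X t)] and [r t] is zero for every [t]. Polynomial
    functions over an infinite field have no zero divisors, so [p (X t)] is identically zero, also
    at the parameters removed by [r]. *)
Lemma curve_zclosure n (S : set 'M[K]_n) (X : K -> 'M[K]_n) (r : K -> K) t0 t1 :
  polycurve X -> polyfun r -> r t0 != 0 ->
  (forall t, r t != 0 -> S (X t)) -> zclosure S (X t1).
Proof.
move=> pX pr r0 rS p pS.
have [t||h] := polyfun_mul0 (polyfun_eval p pX) pr.
- have [->|rt] := eqVneq (r t) 0; first by rewrite mulr0.
  by rewrite (pS _ (rS _ rt)) mul0r.
- exact.
by rewrite h eqxx in r0.
Qed.

Lemma zclosure_sub n (S : set 'M[K]_n) x : S x -> zclosure S x.
Proof. by move=> Sx p; apply. Qed.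

Definition mxpoly n (f : 'M[K]_n -> K) :=
  exists p : {mpoly K[n * n]}, forall x, f x = mx_eval p x.

Lemma mxpoly_ext n (f g : 'M[K]_n -> K) : f =1 g -> mxpoly f -> mxpoly g.
Proof. by move=> fg [p fp]; exists p => t; rewrite -fg. Qed.
Lemma mxpoly_cst n c : mxpoly (fun _ : 'M[K]_n => c).
Proof. by exists c%:MP => t; rewrite /mx_eval mevalC. Qed.
Lemma mxpoly_entry n i j : mxpoly (fun x : 'M[K]_n => x i j).
Proof. by exists 'X_(mxvec_index i j) => t; rewrite /mx_eval mevalXU mxvecE. Qed.
Lemma mxpolyD n (f g : 'M[K]_n -> K) : mxpoly f -> mxpoly g -> mxpoly (fun t => f t + g t).
Proof. by move=> [p fp] [q gq]; exists (p + q) => t; rewrite /mx_eval mevalD fp gq. Qed.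
Lemma mxpolyM n (f g : 'M[K]_n -> K) : mxpoly f -> mxpoly g -> mxpoly (fun t => f t * g t).
Proof. by move=> [p fp] [q gq]; exists (p * q) => t; rewrite /mx_eval mevalM fp gq. Qed.
Lemma mxpoly_sum n (I : Type) (r : seq I) (F : I -> 'M[K]_n -> K) :
  (forall i, mxpoly (F i)) -> mxpoly (fun t => \sum_(i <- r) F i t).
Proof.
move=> pF; elim: r => [|a r IH].
  by apply: mxpoly_ext (@mxpoly_cst n 0) => t; rewrite big_nil.
by apply: mxpoly_ext (mxpolyD (pF a) IH) => t; rewrite big_cons.
Qed.

Lemma mxpoly_zclosure n (f : 'M[K]_n -> K) (S : set 'M[K]_n) :
  mxpoly f -> (forall y, S y -> f y = 0) -> forall x, zclosure S x -> f x = 0.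
Proof.
by move=> [p fp] fS x; rewrite fp; apply=> y Sy; rewrite -fp fS.
Qed.

Definition polymap n a b (F : 'M[K]_n -> 'M[K]_(a, b)) :=
  forall i j, mxpoly (fun x => F x i j).

Lemma polymap_id n : polymap (fun x : 'M[K]_n => x).
Proof. by move=> i j; exact: mxpoly_entry. Qed.
Lemma polymap_cst n a b (A : 'M[K]_(a, b)) : polymap (fun _ : 'M[K]_n => A).
Proof. by move=> i j; exact: mxpoly_cst. Qed.
Lemma polymapD n a b (F G : 'M[K]_n -> 'M[K]_(a, b)) :
  polymap F -> polymap G -> polymap (fun x => F x + G x).
Proof.
by move=> pF pG i j; apply: mxpoly_ext (mxpolyD (pF i j) (pG i j)) => x; rewrite mxE.
Qed.
Lemma polymapN n a b (F : 'M[K]_n -> 'M[K]_(a, b)) :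
  polymap F -> polymap (fun x => - F x).
Proof.
move=> pF i j; apply: mxpoly_ext (mxpolyM (@mxpoly_cst n (-1)) (pF i j)) => x.
by rewrite mxE mulN1r.
Qed.
Lemma polymapM n a b c (F : 'M[K]_n -> 'M[K]_(a, b)) (G : 'M[K]_n -> 'M[K]_(b, c)) :
  polymap F -> polymap G -> polymap (fun x => F x *m G x).
Proof.
move=> pF pG i j; apply: (@mxpoly_ext _ (fun x => \sum_k F x i k * G x k j)).
  by move=> x; rewrite mxE.
by apply: mxpoly_sum => k; exact: mxpolyM.
Qed.
Lemma polymap_tr n a b (F : 'M[K]_n -> 'M[K]_(a, b)) :
  polymap F -> polymap (fun x => (F x)^T).
Proof. by move=> pF i j; apply: mxpoly_ext (pF j i) => x; rewrite mxE. Qed.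

Lemma polymap_zclosure n a b (F : 'M[K]_n -> 'M[K]_(a, b)) (S : set 'M[K]_n) :
  polymap F -> (forall y, S y -> F y = 0) -> forall x, zclosure S x -> F x = 0.
Proof.
move=> pF FS x Sx; apply/matrixP=> i j; rewrite mxE.
by apply: (mxpoly_zclosure (pF i j) _ Sx) => y Sy; rewrite FS // mxE.
Qed.

End PolyFun.

(** * The Killing form of so_n and the projection it defines *)

Section Killing.
Variable K : fieldType.
Hypothesis char0 : [pchar K] =i pred0.

(** A map with values in [g] has the same trace on [g] as on the whole matrix space. This trades the
    abstract basis of [g] for the elementary matrices. *)
Lemma trace_on n (g : {vspace 'M[K]_n}) (f : {linear 'M[K]_n -> 'M[K]_n}) :
  (forall z, f z \in g) ->
  \sum_(l < \dim g) coord (vbasis g) l (f (vbasis g)`_l) =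
  \sum_i \sum_j f (delta_mx i j) i j.
Proof.
move=> fg; under [RHS]eq_bigr => i _ do under eq_bigr => j _ do
  rewrite (coord_vbasis (fg (delta_mx i j))) summxE.
under [RHS]eq_bigr => i _ do rewrite exchange_big /=.
rewrite [RHS]exchange_big /=; apply: eq_bigr => l _.
rewrite {1}[(vbasis g)`_l]matrix_sum_delta linear_sum linear_sum /=.
apply: eq_bigr => i _; rewrite linear_sum linear_sum /=; apply: eq_bigr => j _.
by rewrite !linearZ /= mxE mulrC.
Qed.

Lemma sum_delta_ij n (a b : 'M[K]_n) :
  \sum_i \sum_j (a *m delta_mx i j *m b) i j = \tr a * \tr b.
Proof.
rewrite /mxtrace mulr_suml; apply: eq_bigr => i _; rewrite mulr_sumr; apply: eq_bigr => j _.
rewrite -[a *m _]/(a *m delta_mx i j) -(mul_delta_mx (0 : 'I_1)) mulmxA -colE -mulmxA -rowE.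
by rewrite mxE big_ord1 !mxE.
Qed.

Lemma sum_delta_ji n (a b : 'M[K]_n) :
  \sum_i \sum_j (a *m delta_mx j i *m b) i j = \tr (a *m b^T).
Proof.
rewrite /mxtrace; apply: eq_bigr => i _; rewrite mxE; apply: eq_bigr => j _.
rewrite -(mul_delta_mx (0 : 'I_1)) mulmxA -colE -mulmxA -rowE.
by rewrite mxE big_ord1 !mxE.
Qed.

(** [ad x] after [ad y], preceded by the skew part projection. It is defined on all matrices and
    takes values in so_n when [x] and [y] do, as [trace_on] requires. *)
Definition ad2skew n (x y z : 'M[K]_n) := lie x (lie y (2%:R^-1 *: (z - z^T))).

Lemma ad2skew_linear n (x y : 'M[K]_n) : linear (ad2skew x y).
Proof.
move=> a u v; rewrite /ad2skew.
have -> : 2%:R^-1 *: (a *: u + v - (a *: u + v)^T) =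
    a *: (2%:R^-1 *: (u - u^T)) + 2%:R^-1 *: (v - v^T).
  by move: 2%:R^-1 => h; rewrite [(_ + v)^T]linearD /= [(a *: u)^T]linearZ /=; mxring.
by rewrite !lie_is_linear.
Qed.

HB.instance Definition _ n (x y : 'M[K]_n) :=
  GRing.isLinear.Build K 'M[K]_n 'M[K]_n *:%R (ad2skew x y) (ad2skew_linear x y).

Lemma so_lie n (x y : 'M[K]_n) : x \in so K n -> y \in so K n -> lie x y \in so K n.
Proof.
move=> /mem_so xT /mem_so yT; apply/mem_so.
by rewrite /lie linearB /= !trmx_mul xT yT !mulmxN !mulNmx !opprK opprB.
Qed.

(** In the trace over elementary matrices the terms with [delta_mx i j] give [2 n tr(x y)], because
    [x] and [y] have trace zero, and those with [delta_mx j i] give [4 tr(x y)]. Half the difference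
    is [(n - 2) tr(x y)]. *)
Lemma killing_so n (x y : 'M[K]_n) : x \in so K n -> y \in so K n ->
  killing (so K n) x y = (n%:R - 2%:R) * \tr (x *m y).
Proof.
move=> xs ys; have two := natr_neq0 char0 1.
have ss z : ad2skew x y z \in so K n.
  do 2!apply: so_lie => //; apply/mem_so.
  by rewrite linearZ linearB /= trmxK -scalerN opprB.
transitivity (\sum_(l < \dim (so K n))
    coord (vbasis (so K n)) l (ad2skew x y (vbasis (so K n))`_l)).
  apply: eq_bigr => l _; congr (coord _ _ (lie x (lie y _))).
  have /mem_so -> : (vbasis (so K n))`_l \in so K n.
    by rewrite vbasis_mem // mem_nth // size_tuple.
  by rewrite opprK -mulr2n -scaler_nat scalerA mulVf // scale1r.
rewrite (trace_on ss).
have trT (z : 'M[K]_n) : z \in so K n -> \tr z = 0.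
  move/mem_so/(congr1 mxtrace); rewrite mxtrace_tr linearN /= => /eqP.
  by rewrite -addr_eq0 -mulr2n -mulr_natl mulf_eq0 (negPf two) => /eqP.
have E i j : ad2skew x y (delta_mx i j) i j = 2%:R^-1 *
   ((x *m y *m delta_mx i j *m 1%:M) i j - (x *m delta_mx i j *m y) i j
    - (y *m delta_mx i j *m x) i j + (1%:M *m delta_mx i j *m (y *m x)) i j
    - ((x *m y *m delta_mx j i *m 1%:M) i j - (x *m delta_mx j i *m y) i j
    - (y *m delta_mx j i *m x) i j + (1%:M *m delta_mx j i *m (y *m x)) i j)).
  rewrite /ad2skew trmx_delta !mulmx1 !mul1mx /lie.
  rewrite !(mulmxBl, mulmxBr, mulmxA, =^~ scalemxAl, =^~ scalemxAr, scalerBr).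
  by move: 2%:R^-1 => h; rewrite !mxentE; ring.
under eq_bigr => i _ do under eq_bigr => j _ do rewrite E.
under eq_bigr => i _ do rewrite -mulr_sumr !(big_split, sumrN) /=.
rewrite -mulr_sumr !(big_split, sumrN) /= !(sum_delta_ij, sum_delta_ji).
rewrite (trT x xs) (trT y ys) !mul0r !mxtrace1 trmx1 mulmx1 mul1mx.
have yxT : (y *m x)^T = x *m y.
  by move/mem_so: xs => xT; move/mem_so: ys => yT; rewrite trmx_mul xT yT mulmxN mulNmx opprK.
rewrite yxT (mem_so x).1 // (mem_so y).1 // !mulmxN !linearN /= (mxtrace_mulC y x).
by field.
Qed.

Lemma killing_orth_so n (h : {vspace 'M[K]_n}) x : (2 < n)%N -> (h <= so K n)%VS ->
  x \in killing_orth (so K n) h <->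
  x \in so K n /\ forall y, y \in h -> \tr (x *m y) = 0.
Proof.
move=> n2 hs; have n0 : n%:R - 2%:R != 0 :> K.
  by rewrite -natrB 1?ltnW // -(subnSK n2); exact: natr_neq0.
split=> [/mem_killing_orth [xs xh]|[xs xh]].
  split=> // y yh; have := xh y yh; rewrite killing_so ?(subvP hs _ yh) // => /eqP.
  by rewrite mulf_eq0 (negPf n0) => /eqP.
apply/mem_killing_orth; split=> // y yh.
by rewrite killing_so ?(subvP hs _ yh) // xh // mulr0.
Qed.

Lemma tr_so_eq0 n (x : 'M[K]_n) : x \in so K n ->
  (forall y, y \in so K n -> \tr (x *m y) = 0) -> x = 0.
Proof.
move=> xs h; have two := natr_neq0 char0 1.
have xT := (mem_so x).1 xs; apply/matrixP=> i j.
have ds : delta_mx i j - delta_mx j i \in so K n.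
  by apply/mem_so; rewrite linearB /= !trmx_delta opprB.
have tr_delta a b : \tr (x *m delta_mx a b) = x b a.
  rewrite -(mul_delta_mx (0 : 'I_1)) mulmxA mxtrace_mulC -colE -rowE.
  by rewrite trace_mx11 !mxE.
have := h _ ds; rewrite mulmxBr linearB /= !tr_delta mxE.
have -> : x j i = - x i j by rewrite -[x in LHS]trmxK mxE xT mxE.
rewrite -opprD => /eqP; rewrite oppr_eq0 -mulr2n -mulr_natl mulf_eq0 (negPf two).
by move/eqP.
Qed.

Lemma killing_projE n (h : {vspace 'M[K]_n}) x y : (2 < n)%N -> (h <= so K n)%VS ->
  (forall z, z \in so K n -> exists2 w, w \in h & z - w \in killing_orth (so K n) h) ->
  y \in h -> x - y \in killing_orth (so K n) h ->
  killing_proj (so K n) h x = y.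
Proof.
move=> n2 hs dec yh xy.
have cap0 : (h :&: killing_orth (so K n) h = 0)%VS.
  apply/eqP; rewrite -subv0; apply/subvP=> z; rewrite memv_cap memv0 => /andP [zh].
  move/(killing_orth_so _ n2 hs) => [zs zo]; apply/eqP/tr_so_eq0 => // w ws.
  have [v vh /(killing_orth_so _ n2 hs) [_ wv]] := dec w ws.
  by rewrite -[w](subrK v) mulmxDr linearD /= (zo v) // mxtrace_mulC wv // addr0.
rewrite /killing_proj -[x](subrK y) addrC linearD /= daddv_pi_id //.
have /eqP := daddv_pi_add cap0 (subvP (addvSr h _) _ xy).
rewrite [X in _ + X]daddv_pi_id //; last by rewrite capvC.
by rewrite -subr_eq0 addrK => /eqP ->; rewrite addr0.
Qed.

End Killing.

(** * Orbits and heights *)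

Section OrbitTheory.
Variables (K : fieldType) (n : nat).
Implicit Types (G H S O : set 'M[K]_n).

Definition mxgroup G := [/\ G 1%:M, forall g, G g -> g \in unitmx,
  forall g h, G g -> G h -> G (g *m h) & forall g, G g -> G (invmx g)].

Lemma conj_orbit_refl G x : mxgroup G -> conj_orbit G x x.
Proof. by move=> [G1 _ _ _]; exists 1%:M => //; rewrite invmx1 mul1mx mulmx1. Qed.

Lemma invmx_mul (g h : 'M[K]_n) : g \in unitmx -> h \in unitmx ->
  invmx (g *m h) = invmx h *m invmx g.
Proof.
move=> ug uh; have ugh : g *m h \in unitmx by rewrite unitmx_mul ug.
by apply: (can_inj (mulKmx ugh)); rewrite mulmxV // mulmxA mulmxK // mulmxV.
Qed.

Lemma conj_orbit_mul G g x y : mxgroup G -> G g -> conj_orbit G x y ->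
  conj_orbit G x (g *m y *m invmx g).
Proof.
move=> [_ Gu GM _] Gg [h Gh <-]; exists (g *m h); first exact: GM.
by rewrite invmx_mul ?Gu // !mulmxA.
Qed.

Lemma conj_orbit_eq G x y : mxgroup G -> conj_orbit G x y -> conj_orbit G x = conj_orbit G y.
Proof.
move=> gG [g Gg <-]; have [_ Gu GM GV] := gG; apply/seteqP; split=> z.
  move=> [h Gh <-]; exists (h *m invmx g); first by apply: GM => //; exact: GV.
  rewrite invmx_mul ?unitmx_inv ?Gu // invmxK !mulmxA.
  by rewrite -(mulmxA h) mulVmx ?Gu // mulmx1 -(mulmxA _ (invmx g) g) mulVmx ?Gu // mulmx1.
move=> [h Gh <-]; apply: conj_orbit_mul => //; first by exists g.
Qed.

Lemma is_orbitI G S x : mxgroup G -> S x ->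
  (forall g y, G g -> S y -> S (g *m y *m invmx g)) ->
  (forall y, S y -> exists2 g, G g & g *m x = y *m g) -> is_orbit G S.
Proof.
move=> [_ Gu _ _] Sx Sc St; exists x; apply/seteqP; split=> y.
  by move=> /St [g Gg gx]; exists g => //; rewrite gx mulmxK ?Gu.
by move=> [g Gg <-]; apply: Sc.
Qed.

(** If a dense orbit [W'] missed [W], then [F] would vanish on [W'], so on its closure, which
    contains [O] and therefore [W]. Two orbits that meet are equal. *)
Lemma dense_orbit_unique H O W W' m p (F : 'M[K]_n -> 'M[K]_(m, p)) : mxgroup H ->
  polymap F -> is_orbit H W -> W = O `&` [set x | F x != 0] ->
  dense_orbit H O W' -> W' = W.
Proof.
move=> gH pF [x Wx] WF [[y W'y] W'O OW'].
have [[z W'z Fz]|h] := pselect (exists2 z, W' z & F z != 0).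
  have Wz : W z by rewrite WF; split=> //; exact: W'O.
  rewrite Wx in Wz; rewrite Wx W'y in W'z *.
  by rewrite (conj_orbit_eq gH W'z) (conj_orbit_eq gH Wz).
have F0 z : zclosure W' z -> F z = 0.
  apply: polymap_zclosure => // {}z W'z; apply/eqP/negPn/negP => Fz.
  by apply: h; exists z.
have : W x by rewrite Wx; exact: conj_orbit_refl.
by rewrite WF => -[Ox /=]; rewrite F0 ?eqxx //; exact: OW'.
Qed.

End OrbitTheory.

Section SOGroup.
Variable K : closedFieldType.

Lemma mxgroup_SO n : mxgroup (SO K n).
Proof.
split; first exact: SO1.
- by move=> g [/orth_unit].
- exact: SO_mul.
by move=> g Gg; rewrite orth_inv; [exact: SO_tr|case: Gg].
Qed.

Lemma mxgroup_SO_sub n : mxgroup (SO_sub K n).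
Proof.
split.
- by apply/SO_subP; split; [exact: SO1 | rewrite mul1mx].
- by move=> g /SO_subP [[/orth_unit]].
- move=> g h /SO_subP [Gg ge] /SO_subP [Gh he]; apply/SO_subP; split; first exact: SO_mul.
  by rewrite -mulmxA he ge.
move=> g /SO_subP [Gg ge]; apply/SO_subP; have [gg _] := Gg.
rewrite orth_inv //; split; first exact: SO_tr.
by rewrite -{1}ge mulmxA gg mul1mx.
Qed.

End SOGroup.

(** * Powers of [ad e] when the cube of [e] is zero *)

Section Heights.
Variable K : closedFieldType.
Hypothesis char0 : [pchar K] =i pred0.

Lemma lie0r n (e : 'M[K]_n) : lie e 0 = 0.
Proof. by rewrite /lie mulmx0 mul0mx subrr. Qed.

Lemma is_heightI n (g : {vspace 'M[K]_n}) e k :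
  (exists2 y, y \in g & iter k (lie e) y != 0) ->
  (forall y, y \in g -> iter k.+1 (lie e) y = 0) -> is_height g e k.
Proof.
move=> ek e0; split=> // j [y yg ey]; rewrite leqNgt; apply: contra ey => kj.
rewrite -(subnK kj) iterD e0 //; elim: (j - k.+1)%N => //= i /eqP ->.
by rewrite lie0r.
Qed.

Lemma iter2_lie n (e y : 'M[K]_n) :
  iter 2 (lie e) y = e *m e *m y - 2%:R *: (e *m y *m e) + y *m e *m e.
Proof. by rewrite /= /lie !(mulmxBl, mulmxBr, mulmxA); mxring. Qed.

Lemma mul_cube0 n (e : 'M[K]_n) p (X : 'M_(p, n)) : e *m e *m e = 0 -> X *m e *m e *m e = 0.
Proof. by move=> e3; rewrite -!mulmxA (mulmxA e) e3 mulmx0. Qed.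

(** In the binomial expansion of the powers of [ad e], only terms with at most two factors [e] on
    each side survive: two terms in degree 3, the middle one in degree 4, none in degree 5. *)
Lemma iter3_lie n (e y : 'M[K]_n) : e *m e *m e = 0 ->
  iter 3 (lie e) y = 3%:R *: (e *m y *m e *m e - e *m e *m y *m e).
Proof.
move=> e3; rewrite iterS iter2_lie /lie.
rewrite !(mulmxBl, mulmxBr, mulmxDl, mulmxDr, mulmxA, =^~ scalemxAl, =^~ scalemxAr) e3 mul0mx.
by rewrite mul_cube0 //; mxring.
Qed.

Lemma iter4_lie n (e y : 'M[K]_n) : e *m e *m e = 0 ->
  iter 4 (lie e) y = 6%:R *: (e *m e *m y *m e *m e).
Proof.
move=> e3; rewrite iterS iter3_lie // /lie.
rewrite !(mulmxBl, mulmxBr, mulmxDl, mulmxDr, mulmxA, =^~ scalemxAl, =^~ scalemxAr, scalerBr) e3.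
by rewrite !mul_cube0 // !mul0mx; mxring.
Qed.

Lemma iter5_lie n (e y : 'M[K]_n) : e *m e *m e = 0 -> iter 5 (lie e) y = 0.
Proof.
move=> e3; rewrite iterS iter4_lie // /lie -scalemxAr -scalemxAl !mulmxA e3 !mul0mx.
by rewrite mul_cube0 // scaler0 subrr.
Qed.

Lemma wedge_so n (u v : 'cV[K]_n) : wedge u v \in so K n.
Proof. by apply/mem_so; exact: wedge_tr. Qed.

Lemma sandwich_wedge n (e : 'M[K]_n) u v : e^T = - e ->
  e *m wedge u v *m e = - wedge (e *m u) (e *m v).
Proof. by move=> eT; rewrite -wedge_conj eT mulmxN opprK. Qed.

(** Here the square of [ad e] is [y -> - 2 e y e]. For [y = wedge v w] with [(e v, w) = 1] it is
    nonzero: otherwise, evaluating at [w], where [(e w, w) = 0], would give [e w = 0], against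
    [(e v, w) = - (v, e w)]. *)
Lemma height2 n (e : 'M[K]_n) : e^T = - e -> e *m e = 0 -> e != 0 ->
  is_height (so K n) e 2.
Proof.
move=> eT ee e0; have two := natr_neq0 char0 1.
have e3 : e *m e *m e = 0 by rewrite ee mul0mx.
apply: is_heightI => [|y _]; last first.
  by rewrite iter3_lie // -(mulmxA _ e e) ee !mul0mx mulmx0 subrr scaler0.
case/matrix0Pn: e0 => i [j eij]; pose v : 'cV[K]_n := delta_mx j 0.
have ev : e *m v != 0 by apply/eqP=> /colP /(_ i); rewrite -colE !mxE; apply/eqP.
have [w vw] := dot_ex1 ev; exists (wedge v w); first exact: wedge_so.
rewrite iter2_lie ee mul0mx -(mulmxA (wedge v w)) ee mulmx0 addr0 sub0r.
rewrite oppr_eq0 scaler_eq0 (negPf two) /= sandwich_wedge // oppr_eq0.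
apply/eqP=> /(congr1 (mulmxr w)) /=; rewrite mul0mx wedge_mul vw scale1r.
have -> : dot (e *m w) w = 0 by rewrite dotC skew_dot0.
rewrite scale0r sub0r => /eqP; rewrite oppr_eq0 => /eqP ew.
by move/eqP: vw; rewrite dotC skew_dot // ew dot0r oppr0 eq_sym oner_eq0.
Qed.

Lemma skew_sqr_sym n (e : 'M[K]_n) : e^T = - e -> (e *m e)^T = e *m e.
Proof. by move=> eT; rewrite trmx_mul eT mulmxN mulNmx opprK. Qed.

Lemma sym_rank1 n (S : 'M[K]_n) : S^T = S -> \rank S = 1%N ->
  exists2 u : 'cV_n, u != 0 & S = u *m u^T.
Proof.
move=> ST rS; have [D [M [SD DM]]] := sym_factor (natr_neq0 char0 1) ST rS.
exists D => //; apply: contra_eq_neq rS => D0; by rewrite SD D0 mul0mx mxrank0.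
Qed.

(** With [e e = u u^T], the fourth power of [ad e] contains the factor [u^T y u], which is zero for
    skew [y]. If the third power vanished too, then testing it on [wedge a f] with [a] orthogonal to
    [u] would put [e a] on the line of [u], and [e] would have rank at most 2. *)
Lemma height3 n (e : 'M[K]_n) : e^T = - e -> e *m e *m e = 0 -> \rank (e *m e) = 1%N ->
  (2 < \rank e)%N -> is_height (so K n) e 3.
Proof.
move=> eT e3 r2 r1; have two := natr_neq0 char0 1.
have [u u0 ee] := sym_rank1 (skew_sqr_sym eT) r2.
have [f uf] := dot_ex1 u0.
have eu : e *m u = 0.
  have := e3; rewrite -mulmxA ee mulmxA => /(congr1 (mulmxr f)) /=.
  by rewrite outer_mul uf scale1r mul0mx.
apply: is_heightI => [|y /mem_so yT]; last first.
  rewrite iter4_lie // -mulmxA ee -!mulmxA (mulmxA y) (mulmxA u^T) dotE skew_dot0 //.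
  by rewrite scalar_mx0 mul0mx mulmx0 scaler0.
apply: contrapT => h; suff : (\rank e <= 2)%N by rewrite leqNgt r1.
pose P := 1%:M - f *m u^T.
have key (a : 'cV_n) : dot a u = 0 -> e *m a = u *m (f^T *m (e *m a)).
  move=> ua; pose y := wedge a f.
  have yu : y *m u = a by rewrite wedge_mul -[dot f u]dotC uf ua scale1r scale0r subr0.
  have : e *m y *m e *m e = e *m e *m y *m e.
    apply/eqP; rewrite -subr_eq0; apply/negPn/negP => hy; apply: h; exists y.
      exact: wedge_so.
    by rewrite iter3_lie // scaler_eq0 negb_or hy natr_neq0.
  have yT : y^T = - y by exact: wedge_tr.
  have -> : e *m e *m y *m e = (e *m y *m (e *m e))^T.
    by rewrite trmx_mul skew_sqr_sym // trmx_mul yT eT !(mulNmx, mulmxN, opprK) !mulmxA.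
  rewrite -(mulmxA _ e e) ee !mulmxA -(mulmxA e y u) yu [(_ *m u^T)^T]trmx_mul trmxK.
  move/(congr1 (mulmxr f)); rewrite /= outer_mul uf scale1r => ea.
  by rewrite {1}ea -!mulmxA !dotE dotC.
have eP : e *m P = u *m (f^T *m e *m P).
  apply: mx_cV_ext => w; rewrite -[LHS]mulmxA key ?mulmxA //.
  by rewrite mulmxBl mul1mx outer_mul !dot_lin -[dot f u]dotC uf mulr1 dotC subrr.
have -> : e = u *m (f^T *m e *m P) + (e *m f) *m u^T.
  by rewrite -eP -mulmxA -mulmxDr subrK mulmx1.
apply: leq_trans (mxrank_add _ _) _; apply: (@leq_add _ _ 1 1).
  by apply: leq_trans (mxrankM_maxl _ _) (rank_leq_col _).
by apply: leq_trans (mxrankM_maxl _ _) (rank_leq_col _).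
Qed.

End Heights.

(** * The orbits of the statement described by ranks of powers *)

Section NilpRanks.
Variable K : closedFieldType.

Lemma nilp_orbitP n mu (x : 'M[K]_n) : all (ltn 0) mu -> sorted geq mu -> n = sumn mu ->
  nilp_orbit K n mu x <-> x^T = - x /\ forall k, \rank (x ^+ k) = sumn [seq (j - k)%N | j <- mu].
Proof.
move=> mu0 smu nE; split.
  move=> [/mem_so xT [P uP xE]]; split=> // k.
  by rewrite xE conj_exp // rank_conj // (rank_jordan_nilp _ _ mu0 nE).
by move=> [xT rk]; split; [exact/mem_so | exact: rank_jordan_similar].
Qed.

Lemma sumn_nseq_sub s a k : sumn [seq (j - k)%N | j <- nseq s a] = ((a - k) * s)%N.
Proof. by rewrite map_nseq sumn_nseq. Qed.

Lemma pairwise_geq_nseq s a : pairwise geq (nseq s a).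
Proof. by elim: s => //= s ->; rewrite andbT; apply/allP=> b /nseqP [-> _] /=. Qed.

Lemma nilp2P n s m (x : 'M[K]_n) : (n = s + s + m)%N ->
  nilp_orbit K n (nseq s 2 ++ nseq m 1) x <-> [/\ x^T = - x, x *m x = 0 & \rank x = s].
Proof.
move=> nE; have srt : sorted geq (nseq s 2 ++ nseq m 1).
  rewrite sorted_pairwise; last by move=> a b c /= ba ac; exact: leq_trans ac ba.
  rewrite pairwise_cat; apply/and3P; split.
  - by apply/allrelP=> a b /nseqP [-> _] /nseqP [-> _].
  - exact: pairwise_geq_nseq.
  exact: pairwise_geq_nseq.
have pos : all (ltn 0) (nseq s 2 ++ nseq m 1).
  by rewrite all_cat !all_nseq !orbT.
rewrite nilp_orbitP //; last by rewrite sumn_cat !sumn_nseq; lia.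
split=> [[xT rk]|[xT xx rx]]; split=> //.
- by have := rk 2%N; rewrite map_cat sumn_cat !sumn_nseq_sub !mul0n => /mx_eq_of_rank0.
- by have := rk 1%N; rewrite expr1 map_cat sumn_cat !sumn_nseq_sub mul1n mul0n addn0.
move=> k; rewrite map_cat sumn_cat !sumn_nseq_sub.
case: k => [|[|k]]; first by rewrite expr0 mxrank1; lia.
  by rewrite expr1 rx; lia.
by rewrite !exprS mulrA -!mulmxE xx mul0mx mxrank0; lia.
Qed.

Lemma nilp3P n a b (x : 'M[K]_n) : (n = 3 + a + a + b)%N ->
  nilp_orbit K n (3 :: nseq a 2 ++ nseq b 1) x <->
  [/\ x^T = - x, x *m x *m x = 0, \rank x = a.+2 & \rank (x *m x) = 1%N].
Proof.
move=> nE; have tr : transitive geq by move=> c d e /= dc ce; exact: leq_trans ce dc.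
have srt : sorted geq (3 :: nseq a 2 ++ nseq b 1).
  rewrite sorted_pairwise //= pairwise_cat; apply/and4P; split.
  - by rewrite all_cat !all_nseq /= !orbT.
  - by apply/allrelP=> c d /nseqP [-> _] /nseqP [-> _].
  - exact: pairwise_geq_nseq.
  exact: pairwise_geq_nseq.
have pos : all (ltn 0) (3 :: nseq a 2 ++ nseq b 1).
  by rewrite /= all_cat !all_nseq !orbT.
rewrite nilp_orbitP //; last by rewrite /= sumn_cat !sumn_nseq; lia.
have sE k : sumn [seq (j - k)%N | j <- 3 :: nseq a 2 ++ nseq b 1] =
    ((3 - k) + (2 - k) * a + (1 - k) * b)%N.
  by rewrite /= map_cat sumn_cat !sumn_nseq_sub addnA.
split=> [[xT rk]|[xT xx rx rxx]]; split=> //.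
- by have := rk 3%N; rewrite sE !exprS expr0 mulr1 -!mulmxE mulmxA => /mx_eq_of_rank0.
- by have := rk 1%N; rewrite sE expr1 => ->; lia.
- by have := rk 2%N; rewrite sE expr2 -mulmxE => ->; lia.
move=> k; rewrite sE.
case: k => [|[|[|k]]]; first by rewrite expr0 mxrank1; lia.
- by rewrite expr1 rx; lia.
- by rewrite expr2 -mulmxE rxx; lia.
by rewrite !exprS !mulrA -!mulmxE xx mul0mx mxrank0; lia.
Qed.

Lemma nilp331P (x : 'M[K]_7) :
  nilp_orbit K 7 [:: 3; 3; 1]%N x <->
  [/\ x^T = - x, x *m x *m x = 0, \rank x = 4%N & \rank (x *m x) = 2%N].
Proof.
rewrite nilp_orbitP //.
split=> [[xT rk]|[xT xx rx rxx]]; split=> //.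
- by have := rk 3%N; rewrite !exprS expr0 mulr1 -!mulmxE mulmxA => /mx_eq_of_rank0.
- by have := rk 1%N; rewrite expr1.
- by have := rk 2%N; rewrite expr2.
move=> k; case: k => [|[|[|k]]]; first by rewrite expr0 mxrank1.
- by rewrite expr1 rx.
- by rewrite expr2 -mulmxE rxx.
by rewrite !exprS !mulrA -!mulmxE xx mul0mx mxrank0.
Qed.

End NilpRanks.

(** * Skew matrices of square zero *)

Section Exp3.
Variable K : closedFieldType.
Hypothesis char0 : [pchar K] =i pred0.

Definition exp3 n (B : 'M[K]_n) : 'M[K]_n := 1%:M + B + 2%:R^-1 *: (B *m B).

Lemma exp3M n (B : 'M[K]_n) (a b : K) : B *m B *m B = 0 ->
  exp3 (a *: B) *m exp3 (b *: B) = exp3 ((a + b) *: B).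
Proof.
move=> B3; have two := natr_neq0 char0 1.
rewrite /exp3 !(mulmxDl, mulmxDr, mul1mx, mulmx1, =^~ scalemxAl, =^~ scalemxAr, scalerA, mulmxA).
rewrite B3 mul0mx; apply/matrixP=> i j; rewrite !mxentE.
by field.
Qed.

Lemma exp3_tr n (B : 'M[K]_n) : B^T = - B -> (exp3 B)^T = exp3 (- B).
Proof.
move=> BT; rewrite /exp3 !linearD linearZ /= trmx1 trmx_mul BT.
by [].
Qed.

(** [exp3 B] is orthogonal and is the square of the orthogonal matrix [exp3 (B / 2)], so its
    determinant is 1. *)
Lemma exp3_SO n (B : 'M[K]_n) : B^T = - B -> B *m B *m B = 0 -> SO K n (exp3 B).
Proof.
move=> BT B3.
have h b : (exp3 (b *: B))^T *m exp3 (b *: B) = 1%:M.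
  rewrite exp3_tr; last by rewrite linearZ /= BT scalerN.
  by rewrite -scaleNr exp3M // addNr scale0r /exp3 mulmx0 scaler0 !addr0.
split; first by rewrite -[B]scale1r.
have -> : exp3 B = exp3 (2%:R^-1 *: B) *m exp3 (2%:R^-1 *: B).
  rewrite exp3M // -[in LHS](scale1r B); congr (exp3 (_ *: _)).
  by have two := natr_neq0 char0 1; field.
by rewrite det_mulmx; case: (orth_det (h 2%:R^-1)) => ->; rewrite ?mulr1 // mulrNN mulr1.
Qed.

Lemma polycurve_exp3 n (B : 'M[K]_n) : polycurve (fun t => exp3 (t *: B)).
Proof.
have pB : polycurve (fun t => t *: B).
  by apply: polycurveZ; [exact: polyfun_id|exact: polycurve_cst].
apply: polycurveD; first by apply: polycurveD => //; exact: polycurve_cst.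
by apply: polycurveZ; [exact: polyfun_cst|exact: polycurveM].
Qed.

End Exp3.

Section Null2.
Variable K : closedFieldType.
Hypothesis char0 : [pchar K] =i pred0.

Let two : 2%:R != 0 :> K := natr_neq0 char0 1.

Definition null2 N s (x : 'M[K]_N) := [/\ x^T = - x, x *m x = 0 & \rank x = s].

Lemma null2_conj_orth N s (g x : 'M[K]_N) : g^T *m g = 1%:M -> null2 s x ->
  null2 s (g *m x *m invmx g).
Proof.
move=> gg [xT xx rx]; have ug := orth_unit gg; split.
- exact: conj_skew.
- by rewrite !mulmxA mulmxKV // -(mulmxA _ x x) xx mulmx0 mul0mx.
by rewrite rank_conj.
Qed.

Lemma unit_nonker N (x : 'M[K]_N) : x != 0 -> exists2 v, dot v v = 1 & x *m v != 0.
Proof.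
case/matrix0Pn=> i [j xij]; exists (delta_mx j 0); first by rewrite dot_delta mxE !eqxx.
by apply/eqP=> /colP /(_ i); rewrite -colE !mxE; apply/eqP.
Qed.

Lemma orth_fixl N (g : 'M[K]_N) m (C C' : 'M_(N, m)) : g^T *m g = 1%:M -> g *m C = C' ->
  C'^T *m g = C^T.
Proof. by move=> gg <-; rewrite trmx_mul -mulmxA gg mulmx1. Qed.

(** In the frames of [null2_frame] the pairs [(x, v)] and [(y, w)] have the same coordinates, so the
    isometry between the frames carries one to the other. The vector [d] is a column of [D']: the
    reflection along it commutes with [y] and fixes [w], and serves to change the sign of a
    determinant. *)
Lemma null2_conj N s m (x y : 'M[K]_N) v w : (N = s + s + m)%N ->
  null2 s x -> null2 s y -> dot v v = 1 -> dot w w = 1 -> x *m v != 0 -> y *m w != 0 ->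
  exists2 g, [/\ g^T *m g = 1%:M, g *m x = y *m g & g *m v = w] &
  (0 < m)%N -> exists d, [/\ dot d d = 1, y *m d = 0 & dot d w = 0].
Proof.
move=> NE [xT xx rx] [yT yy ry] vv ww xv yw.
have [A [C [D [fr xE os s0 vE]]]] := null2_frame two NE xT xx rx vv xv.
have [A' [C' [D' [fr' yE _ _ wE]]]] := null2_frame two NE yT yy ry ww yw.
have [] := frame_conj fr fr'; set g := (X in X^T *m X) => gg gA gC gD.
exists g.
  split=> //; last by rewrite vE wE mulmxDr -scalemxAr !mulmxA gA gC.
  by rewrite xE yE !mulmxA gC -!mulmxA (orth_fixl gg gC).
move=> m0 {g gg gA gC gD}; have [_ _ _ DD' [DA' DC' _]] := fr'.
pose a : 'cV[K]_m := delta_mx (Ordinal m0) 0.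
exists (D' *m a); split.
- by rewrite dot_mulmxl mulmxA DD' mul1mx dot_delta mxE !eqxx.
- by rewrite yE -!mulmxA (mulmxA C'^T) (trmx_eq DC') trmx0 mul0mx !mulmx0.
rewrite dot_mulmxl wE mulmxDr -scalemxAr !mulmxA DA' DC' !mul0mx scaler0 addr0.
by rewrite dot0r.
Qed.

Lemma refl_comm N (y : 'M[K]_N) d : y^T = - y -> y *m d = 0 ->
  refl d *m y = y /\ y *m refl d = y.
Proof.
move=> yT yd; have dy : d^T *m y = 0.
  by rewrite -[y]opprK -yT mulmxN -trmx_mul yd trmx0 oppr0.
split; rewrite /refl ?mulmxBl ?mulmxBr ?mul1mx ?mulmx1 -?scalemxAl -?scalemxAr.
  by rewrite -mulmxA dy mulmx0 scaler0 subr0.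
by rewrite mulmxA yd mul0mx scaler0 subr0.
Qed.

Lemma null2_conj_SO n s m (x y : 'M[K]_(n + 1)) v w : (n + 1 = s + s + m)%N ->
  (0 < n)%N -> (0 < m)%N ->
  null2 s x -> null2 s y -> dot v v = 1 -> dot w w = 1 -> x *m v != 0 -> y *m w != 0 ->
  exists2 g, SO K (n + 1) g & g *m x = y *m g /\ g *m v = w.
Proof.
move=> NE n0 m0 nx ny vv ww xv yw.
have [g [gg gx gv] /(_ m0) [d [dd yd dw]]] := null2_conj NE nx ny vv ww xv yw.
case: (orth_det gg) => dg; first by exists g.
exists (refl d *m g).
  split; first by apply: orth_mul => //; exact: refl_orth.
  by rewrite det_mulmx dg det_refl // mulrNN mulr1.
have [yT _ _] := ny; have [ry yr] := refl_comm yT yd.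
split; first by rewrite -mulmxA gx !mulmxA ry yr.
by rewrite -mulmxA gv refl_mul dw mulr0 scale0r subr0.
Qed.

(** [g] preserves the image of [x], the span of [C], so in the basis [(A, C)] it is block
    triangular. Orthogonality makes the two diagonal blocks inverse transposes of each other, and
    their determinants cancel. *)
Lemma null2_comm_det N s (x g : 'M[K]_N) : (N = s + s)%N -> (0 < s)%N ->
  null2 s x -> g^T *m g = 1%:M -> g *m x = x *m g -> \det g = 1.
Proof.
move=> NE s0 [xT xx rx] gg gx.
have x0 : x != 0 by rewrite -mxrank_eq0 rx -lt0n.
have [v vv xv] := unit_nonker x0.
have NE' : (N = s + s + 0)%N by rewrite addn0.
have [A [C [D [[AA CC hAC DD [DA DC P1]] xE os _ vE]]]] := null2_frame two NE' xT xx rx vv xv.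
have {P1} PP : A *m C^T + C *m A^T = 1%:M.
  by rewrite -P1 [D]thinmx0 mul0mx addr0.
have uJ := altJ_unit K os; set J := altJ K s in xE uJ.
have CA : C^T *m A = 1%:M by rewrite (trmx_eq hAC) trmx1.
pose de := C^T *m g *m A; pose al := J *m de *m invmx J; pose be := A^T *m g *m A.
have gC : g *m C = C *m al.
  have CE : C = x *m A *m invmx J.
    by rewrite xE -!mulmxA (mulmxA C^T) CA mul1mx mulmxV // mulmx1.
  by rewrite [in LHS]CE !mulmxA gx xE.
have gA : g *m A = A *m de + C *m be.
  by rewrite /de /be !mulmxA -!mulmxDl PP mul1mx.
have da : de^T *m al = 1%:M.
  have -> : de^T = A^T *m g^T *m C by rewrite !trmx_mul trmxK mulmxA.
  by rewrite -mulmxA -gC -mulmxA (mulmxA g^T) gg mul1mx.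
have dda : \det de * \det al = 1 by rewrite -(det_tr de) -det_mulmx da det1.
subst N; pose P := row_mx A C.
have uP : P \in unitmx.
  have : P *m col_mx C^T A^T = 1%:M by rewrite mul_row_col.
  by case/mulmx1_unit.
have : g *m P = P *m block_mx de 0 be al.
  by rewrite mul_mx_row mul_row_block mulmx0 add0r gC gA.
move/(congr1 determinant); rewrite !det_mulmx det_lblock dda mulr1.
rewrite -[RHS]mul1r; apply: mulIf.
by move: uP; rewrite unitmxE unitfE.
Qed.

(** With [i i = -1] the columns [e_j + i e_(s+j)] span a totally isotropic subspace; [x] is a
    symplectic form on it, which exists since [s] is even. *)
Lemma null2_exists N s m : (N = s + s + m)%N -> ~~ odd s -> exists x : 'M[K]_N, null2 s x.
Proof.
move=> -> os; have [i ii] := sqrt_exists (-1 : K).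
pose C : 'M[K]_(s + s + m, s) := col_mx (col_mx 1%:M (i%:M)) 0.
have CC : C^T *m C = 0.
  rewrite !tr_col_mx !mul_row_col trmx1 mulmx1 trmx0 mulmx0 addr0 tr_scalar_mx.
  by rewrite -scalar_mxM ii -raddfD /= addrN raddf0.
have CM : C^T *m (col_mx (col_mx 1%:M 0) 0) = 1%:M.
  by rewrite !tr_col_mx !mul_row_col trmx1 mulmx1 !mulmx0 !addr0.
exists (C *m altJ K s *m C^T); split.
- by rewrite !trmx_mul trmxK altJ_tr mulNmx mulmxN mulmxA.
- by rewrite -!mulmxA (mulmxA C^T C) CC mul0mx !mulmx0.
by rewrite (mxrank_factor _ CM) mxrank_unit ?altJ_unit.
Qed.

(** Multiplying [C] by [r] and [A] by [r^-1] keeps the frame and scales [x = C J C^T] by [r^2]. The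
    isometry is applied twice to force determinant 1, which explains the exponent 4. *)
Lemma null2_scale N s m (x : 'M[K]_N) (r : K) : (N = s + s + m)%N -> (0 < s)%N ->
  null2 s x -> r != 0 -> exists2 g, SO K N g & g *m x = (r ^+ 4 *: x) *m g.
Proof.
move=> NE s0 [xT xx rx] r0.
have x0 : x != 0 by rewrite -mxrank_eq0 rx -lt0n.
have [v vv xv] := unit_nonker x0.
have [A [C [D [fr xE os _ vE]]]] := null2_frame two NE xT xx rx vv xv.
have fr' : hyp_frame (r^-1 *: A) (r *: C) D.
  have [AA CC hAC DD [DA DC PP]] := fr.
  rewrite /hyp_frame ![(_ *: _)^T]linearZ /= !(=^~ scalemxAl, =^~ scalemxAr) AA CC hAC DA DC !scaler0.
  by rewrite !scalerA mulVf // mulfV // !scale1r.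
have [] := frame_conj fr fr'; set g := (X in X^T *m X) => gg gA gC gD.
have Cg := orth_fixl gg gC.
have gx : g *m x = (r ^+ 2 *: x) *m g.
  rewrite xE !mulmxA gC -!scalemxAl expr2 -scalerA; congr (_ *: _).
  by rewrite -[C^T in LHS]Cg linearZ /= -scalemxAl -scalemxAr !mulmxA.
exists (g *m g).
  split; first exact: orth_mul.
  by rewrite det_mulmx; case: (orth_det gg) => ->; rewrite ?mulr1 // mulrNN mulr1.
rewrite -mulmxA gx !(=^~ scalemxAl, =^~ scalemxAr) (mulmxA g x) gx.
by rewrite !(=^~ scalemxAl, =^~ scalemxAr) scalerA -exprD mulmxA.
Qed.

End Null2.

(** * Projection to so_(N-1) *)

Section SoSub.
Variable K : closedFieldType.
Hypothesis char0 : [pchar K] =i pred0.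
Variable n : nat.
Local Notation e := (elast K n).

Lemma so_subP (x : 'M[K]_(n + 1)) : x \in so_sub K n <-> x^T = - x /\ x *m e = 0.
Proof.
split=> [/mem_so_sub [y /mem_so yT ->]|[xT xe]].
  split; last by rewrite /embed_lie /elast mul_block_col !mul0mx !mulmx0 !addr0 col_mx0.
  by rewrite /embed_lie tr_block_mx yT opp_block_mx !trmx0 !oppr0.
apply/mem_so_sub; move: xT xe (submxK x).
move: (ulsubmx x) (ursubmx x) (dlsubmx x) (drsubmx x) => a b c d xT xe xE.
rewrite -{x}xE in xT xe *.
move: xe; rewrite /elast mul_block_col !mulmx0 !mulmx1 !add0r -[0 in RHS]col_mx0.
move=> /eq_col_mx [b0 d00]; subst b d.
move: xT; rewrite tr_block_mx opp_block_mx !trmx0 !oppr0 => /eq_block_mx [aT c0 _ _].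
exists a; first exact/mem_so.
by rewrite /embed_lie -[c]trmxK c0 trmx0.
Qed.

Lemma so_sub_so : (so_sub K n <= so K (n + 1))%VS.
Proof. by apply/subvP=> x /so_subP [xT _]; apply/mem_so. Qed.

Definition cut (x : 'M[K]_(n + 1)) := x + wedge e (x *m e).

Lemma cut_so_sub x : x^T = - x -> cut x \in so_sub K n.
Proof.
move=> xT; have two := natr_neq0 char0 1; apply/so_subP; split.
  by rewrite /cut [LHS]linearD /= xT wedge_tr -opprD.
by rewrite /cut mulmxDl wedge_mul dot_elast dotC skew_dot0 // scale0r scale1r sub0r subrr.
Qed.

Lemma cut_orth x : (1 < n)%N -> x^T = - x -> x - cut x \in killing_orth (so K (n + 1)) (so_sub K n).
Proof.
move=> n1 xT; apply/killing_orth_so => //; [by lia|exact: so_sub_so|].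
have -> : x - cut x = wedge (x *m e) e by rewrite /cut opprD addrA subrr sub0r -wedgeC.
split; first exact: wedge_so.
move=> y /so_subP [yT ye]; set u := x *m e.
have ey : e^T *m y = 0 by rewrite -[y]opprK -yT mulmxN -trmx_mul ye trmx0 oppr0.
rewrite wedgeE mulmxBl linearB /= -mulmxA ey mulmx0 mxtrace0 sub0r mxtrace_mulC mulmxA ye.
by rewrite mul0mx mxtrace0 oppr0.
Qed.

Lemma phi_cut x : (1 < n)%N -> x^T = - x -> killing_proj (so K (n + 1)) (so_sub K n) x = cut x.
Proof.
move=> n1 xT; apply: (killing_projE char0); rewrite ?so_sub_so //; first by lia.
- move=> z /mem_so zT; exists (cut z); [exact: cut_so_sub|exact: cut_orth].
- exact: cut_so_sub.
exact: cut_orth.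
Qed.

Lemma embed_lieM (x y : 'M[K]_n) : embed_lie x *m embed_lie y = embed_lie (x *m y).
Proof. by rewrite /embed_lie mulmx_block !mul0mx !mulmx0 !addr0. Qed.

Lemma rank_embed_lie (x : 'M[K]_n) : \rank (embed_lie x) = \rank x.
Proof. by rewrite /embed_lie rank_diag_block_mx mxrank0 addn0. Qed.

Lemma embed_lie_eq0 (x : 'M[K]_n) : embed_lie x = 0 -> x = 0.
Proof. by move/(congr1 ulsubmx); rewrite block_mxKul => ->; apply/matrixP=> i j; rewrite !mxE. Qed.

End SoSub.

Section Null2Cut.
Variable K : closedFieldType.
Hypothesis char0 : [pchar K] =i pred0.
Variables n s : nat.
Local Notation e := (elast K n).
Implicit Types x y : 'M[K]_(n + 1).

Let two : 2%:R != 0 :> K := natr_neq0 char0 1.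

(* With [y y = u u^T] one recovers [y + wedge u e] from [y] by unipotent row and column operations *)
Lemma rank_uncut y u : y^T = - y -> y *m e = 0 -> u != 0 -> y *m y = u *m u^T ->
  y *m u = 0 -> \rank (y + wedge u e)%R = \rank y.
Proof.
move=> yT ye u0 yy yu; have [f uf] := dot_ex1 u0.
have ey : e^T *m y = 0 by rewrite -[y]opprK -yT mulmxN -trmx_mul ye trmx0 oppr0.
have uy : u^T *m y = 0 by rewrite -[y]opprK -yT mulmxN -trmx_mul yu trmx0 oppr0.
have yyf : y *m (y *m f) = u by rewrite mulmxA yy outer_mul uf scale1r.
have fyy : f^T *m y *m y = u^T by rewrite -mulmxA yy mulmxA dotE dotC uf mul1mx.
apply/eqP; rewrite eqn_leq; apply/andP; split.
  have -> : y + wedge u e = (1%:M - e *m (f^T *m y)) *m y *m (1%:M + (y *m f) *m e^T).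
    rewrite mulmxBl mul1mx -(mulmxA e) fyy mulmxDr mulmx1 mulmxBl.
    rewrite (mulmxA y (y *m f)) yyf -!mulmxA (mulmxA u^T y) uy mul0mx mulmx0 subr0.
    by rewrite wedgeE; mxring.
  exact: leq_trans (mxrankM_maxl _ _) (mxrankM_maxr _ _).
pose P := 1%:M - e *m e^T.
have Pe : P *m e = 0 by rewrite mulmxBl mul1mx outer_mul dot_elast scale1r subrr.
have eP : e^T *m P = 0 by rewrite mulmxBr mulmx1 mulmxA dotE dot_elast mul1mx subrr.
have yE : P *m (y + wedge u e) *m P = y.
  have Py : P *m y = y by rewrite mulmxBl mul1mx -mulmxA ey mulmx0 subr0.
  have yP : y *m P = y by rewrite mulmxBr mulmx1 mulmxA ye mul0mx subr0.
  have wP : wedge u e *m P = - (e *m (u^T *m P)).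
    by rewrite wedgeE mulmxBl -!mulmxA eP mulmx0 sub0r.
  by rewrite (mulmxDr P) (mulmxDl (P *m y)) Py yP -mulmxA wP mulmxN (mulmxA P e) Pe mul0mx oppr0 addr0.
rewrite -{1}yE; exact: leq_trans (mxrankM_maxl _ _) (mxrankM_maxr _ _).
Qed.

(** The vector [u] is isotropic, orthogonal to [e] and killed by [x], which gives [y y] and [y u].
    The rank follows from [rank_uncut], since [x = y + wedge u e]. *)
Lemma cut_null2 x : null2 s x -> x *m e != 0 -> let u := x *m e in let y := cut x in
  [/\ y^T = - y, y *m e = 0, y *m y = u *m u^T, y *m u = 0 & \rank y = s].
Proof.
move=> [xT xx rx] u0 u y.
have eu : dot e u = 0 by rewrite skew_dot0.
have xu : x *m u = 0 by rewrite mulmxA xx mul0mx.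
have uu : dot u u = 0 by rewrite /u dot_mulmxl xT mulNmx mulmxA xx mul0mx oppr0 dot0r.
have [yT ye] := (so_subP _).1 (cut_so_sub char0 xT); rewrite -/y in yT ye.
have yw w : y *m w = x *m w + dot u w *: e - dot e w *: u.
  by rewrite mulmxDl wedge_mul addrA.
have yu : y *m u = 0 by rewrite yw xu uu eu !scale0r subr0 addr0.
have yy : y *m y = u *m u^T.
  apply: mx_cV_ext => w; rewrite -mulmxA (yw w) !(mulmxDr, mulmxN) -!scalemxAr ye yu !scaler0.
  rewrite oppr0 !addr0 yw outer_mul mulmxA xx mul0mx add0r.
  have -> : dot u (x *m w) = 0 by rewrite skew_dot // xu dot0r oppr0.
  have -> : dot e (x *m w) = - dot u w by rewrite skew_dot // dotC.
  by rewrite scale0r add0r scaleNr opprK.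
split=> //; rewrite -(rank_uncut yT ye u0 yy yu).
by rewrite /y /cut [wedge u e]wedgeC addrK.
Qed.

Lemma uncut_null2 y u : y^T = - y -> y *m e = 0 -> u != 0 -> y *m y = u *m u^T ->
  y *m u = 0 -> \rank y = s -> let x := y + wedge u e in
  [/\ null2 s x, x *m e = u & cut x = y].
Proof.
move=> yT ye u0 yy yu ry x; have [f uf] := dot_ex1 u0.
have yyf : u = y *m (y *m f) by rewrite mulmxA yy outer_mul uf scale1r.
have eu : dot e u = 0 by rewrite yyf skew_dot // ye dot0r oppr0.
have uu : dot u u = 0 by rewrite {2}yyf skew_dot // yu dot0r oppr0.
have xw w : x *m w = y *m w + dot e w *: u - dot u w *: e.
  by rewrite mulmxDl wedge_mul addrA.
have xe : x *m e = u by rewrite xw ye dot_elast dotC eu scale0r subr0 add0r scale1r.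
split=> //; last by rewrite /cut xe /x [wedge u e]wedgeC subrK.
split; last by rewrite rank_uncut.
  by rewrite [LHS]linearD /= yT wedge_tr -opprD.
apply: mx_cV_ext => w; rewrite mul0mx -mulmxA (xw w) !(mulmxDr, mulmxN) -!scalemxAr xe.
rewrite !xw mulmxA yy outer_mul yu eu uu.
have -> : dot e (y *m w) = 0 by rewrite skew_dot // ye dot0r oppr0.
have -> : dot u (y *m w) = 0 by rewrite skew_dot // yu dot0r oppr0.
by rewrite !scale0r !subr0 !addr0 scaler0 addr0 subrr.
Qed.

End Null2Cut.

(** * Dense orbits and their projections for the pair of orthogonal groups *)

Section PartI.
Variable K : closedFieldType.
Hypothesis char0 : [pchar K] =i pred0.
Variables n s m : nat.
Hypotheses (NE : (n + 1 = s + s + m)%N) (n1 : (1 < n)%N) (s2 : (2 < s)%N) (os : ~~ odd s).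
Local Notation e := (elast K n).
Local Notation G := (SO K (n + 1)).
Local Notation H := (SO_sub K n).
Implicit Types (x y : 'M[K]_(n + 1)) (O : set 'M[K]_(n + 1)).

Let two : 2%:R != 0 :> K := natr_neq0 char0 1.
Let n0 : (0 < n)%N := ltnW n1.
Let n3 : (2 < n + 1)%N. Proof. by rewrite addn1. Qed.

Lemma null2_neq0 x : null2 s x -> x != 0.
Proof. by move=> [_ _ rx]; rewrite -mxrank_eq0 rx -lt0n (leq_trans _ s2). Qed.

Lemma null2_orbit : (0 < m)%N -> is_orbit G [set x | null2 s x].
Proof.
move=> m0; have [x nx] := null2_exists K NE os.
apply: (is_orbitI (mxgroup_SO _ _) nx) => [g y [gg _] ny|y ny].
  exact: null2_conj_orth.
have [v vv xv] := unit_nonker (null2_neq0 nx).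
have [w ww yw] := unit_nonker (null2_neq0 ny).
have [g Gg [gx _]] := null2_conj_SO char0 NE n0 m0 nx ny vv ww xv yw.
by exists g.
Qed.

Lemma null2_conj_any x y : null2 s x -> null2 s y ->
  exists2 g, g^T *m g = 1%:M & g *m x = y *m g.
Proof.
move=> nx ny.
have [v vv xv] := unit_nonker (null2_neq0 nx).
have [w ww yw] := unit_nonker (null2_neq0 ny).
by have [g [gg gx _] _] := null2_conj char0 NE nx ny vv ww xv yw; exists g.
Qed.

Lemma null2_orbits : m = 0%N -> exists OI OII : set 'M[K]_(n + 1),
  [/\ is_orbit G OI, is_orbit G OII, OI <> OII & [set x | null2 s x] = OI `|` OII].
Proof.
move=> m0; have [x nx] := null2_exists K NE os.
have [rr dr] := (refl_orth (dot_elast K n), det_refl two n0 (dot_elast K n)).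
set r := refl e in rr dr.
exists (conj_orbit G x), (conj_orbit G (r *m x *m invmx r)).
split; [by exists x|by exists (r *m x *m invmx r)| |].
  move=> E; have : conj_orbit G x (r *m x *m invmx r).
    by rewrite E; exact: conj_orbit_refl (mxgroup_SO _ _).
  move=> [g [gg dg] gx].
  have : \det (g^T *m r) = 1.
    have NE' : (n + 1 = s + s)%N by rewrite NE m0 addn0.
    apply: (null2_comm_det char0 NE' _ nx); first by rewrite (leq_trans _ s2).
      by apply: orth_mul => //; exact: orth_tr.
    move/(congr1 (mulmxr r)): gx => /=; rewrite mulmxKV ?(orth_unit rr) // orth_inv // => gx.
    by rewrite -mulmxA -gx !mulmxA gg mul1mx.
  rewrite det_mulmx det_tr dg dr mul1r => /eqP.
  by rewrite eq_sym -subr_eq0 opprK (negPf two).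
apply/seteqP; split=> y.
  move=> ny; have [g gg gx] := null2_conj_any nx ny.
  case: (orth_det gg) => dg; [left|right].
    by exists g => //; exact: orth_conj.
  have ur := orth_unit rr; have ug := orth_unit gg.
  exists (g *m invmx r); last first.
    rewrite invmx_mul ?unitmx_inv // invmxK !mulmxA mulmxKV // mulmxKV //.
    exact: orth_conj.
  rewrite orth_inv //; split; first by apply: orth_mul => //; exact: orth_tr.
  by rewrite det_mulmx det_tr dg dr mulrNN mulr1.
move=> [] [g [gg _] <-]; apply: null2_conj_orth => //.
exact: null2_conj_orth.
Qed.

Section OneOrbit.
Variable O : set 'M[K]_(n + 1).
Hypotheses (orbO : is_orbit G O) (Onull : forall x, O x -> null2 s x).

Lemma O_conj x g : O x -> G g -> O (g *m x *m invmx g).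
Proof. by case: orbO => x0 -> ? ?; apply: conj_orbit_mul => //; exact: mxgroup_SO. Qed.

Lemma O_ex : exists x, O x.
Proof. by case: orbO => x0 ->; exists x0; apply: conj_orbit_refl; exact: mxgroup_SO. Qed.

(** For [m > 0] the determinant is corrected by a reflection. For [m = 0] it is already 1: [x] and
    [y] lie in one orbit, so some [g0] of determinant 1 conjugates them, and [g0^T g] commutes with
    [x]. *)
Lemma O_trans x y v w : O x -> O y -> dot v v = 1 -> dot w w = 1 -> x *m v != 0 ->
  y *m w != 0 -> exists2 g, G g & g *m x = y *m g /\ g *m v = w.
Proof.
move=> Ox Oy vv ww xv yw; have [nx ny] := (Onull Ox, Onull Oy).
case: (posnP m) => [m0|m0]; last exact: null2_conj_SO NE n0 m0 nx ny vv ww xv yw.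
have [g [gg gx gv] _] := null2_conj char0 NE nx ny vv ww xv yw.
have [g0 G0 g0x] : exists2 g0, G g0 & g0 *m x = y *m g0.
  case: orbO => x0 O0; rewrite O0 in Ox Oy; have gG := mxgroup_SO K (n + 1).
  move: Oy; rewrite (conj_orbit_eq gG Ox) => -[h Gh hx]; exists h => //.
  by rewrite -hx mulmxKV //; have [_ u _ _] := gG; exact: u.
exists g => //; split=> //; have [gg0 dg0] := G0.
have NE' : (n + 1 = s + s)%N by rewrite NE m0 addn0.
have : \det (g0^T *m g) = 1.
  apply: (null2_comm_det char0 NE' _ nx); first by rewrite (leq_trans _ s2).
    by apply: orth_mul => //; exact: orth_tr.
  have g0y : x *m g0^T = g0^T *m y.
    have := congr1 (fun A => g0^T *m A *m g0^T) g0x.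
    by rewrite /= !mulmxA gg0 mul1mx => ->; rewrite -mulmxA orth_r // mulmx1.
  by rewrite -mulmxA gx !mulmxA g0y.
by rewrite det_mulmx det_tr dg0 mul1r.
Qed.

Definition Om := O `&` [set x | x *m e != 0].

Lemma Om_orbit x : Om x -> Om = conj_orbit H x.
Proof.
move=> [Ox xe]; apply/seteqP; split=> y.
  move=> [Oy ye]; have ee := dot_elast K n.
  have [g Gg [gx ge]] := O_trans Ox Oy ee ee xe ye.
  exists g; first exact/SO_subP.
  by apply: orth_conj gx; case: Gg.
move=> [g /SO_subP [Gg ge] <-]; split; first exact: O_conj.
have [gg _] := Gg; have ug := orth_unit gg.
have gie : invmx g *m e = e by rewrite -{1}ge mulKmx.
rewrite /= -(mulmxA _ (invmx g)) gie; apply: contraNneq xe => h.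
by rewrite -[x *m e](mulKmx ug) (mulmxA g) h mulmx0.
Qed.

(** With [u] isotropic, orthogonal to [e] and [x u] nonzero, [B = wedge e u] has cube zero, and
    conjugating by [exp3 (t B)] stays in the orbit. Since [exp3 (- t B) e = e + t u] and [x e = 0],
    the conjugate sends [e] to [t] times the nonzero vector [exp3 (t B) (x u)]. *)
Lemma Om_dense_curve x : O x -> x *m e = 0 -> zclosure Om x /\ exists y, Om y.
Proof.
move=> Ox xe; have [xT _ _] := Onull Ox; have x0 := null2_neq0 (Onull Ox).
have [i ii] := sqrt_exists (-1 : K).
pose b (a : 'I_n) : 'cV[K]_(n + 1) := col_mx (delta_mx a 0) 0.
have bb a c : dot (b a) (b c) = (a == c)%:R.
  rewrite dot_sum big_split_ord /= big_ord1 !col_mxEd !mxE mul0r addr0.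
  rewrite (bigD1 a) //= !col_mxEu !mxE !eqxx !andbT mul1r big1 ?addr0 // => j /negPf ja.
  by rewrite !col_mxEu !mxE ja mul0r.
have be a : dot (b a) e = 0.
  rewrite dot_sum big_split_ord /= big_ord1 !col_mxEd !mxE mul0r addr0 big1 // => j _.
  by rewrite !col_mxEu !mxE mulr0.
have [a xa] : exists a, x *m b a != 0.
  apply: contrapT => /forallNP h; move/eqP: x0; apply; apply/matrixP=> k l; rewrite mxE.
  case: (split_ordP l) => j ->.
    have := h j; move/negP; rewrite negbK => /eqP /colP /(_ k); rewrite [RHS]mxE => <-.
    have -> : b j = delta_mx (lshift 1 j) 0.
      apply/colP=> q; case: (split_ordP q) => q' ->; rewrite ?col_mxEu ?col_mxEd !mxE.
        by rewrite -!val_eqE.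
      by rewrite -val_eqE /= [_ == _]gtn_eqF // (leq_trans (ltn_ord j)) ?leq_addr.
    by rewrite -colE mxE.
  have := xe => /colP /(_ k); rewrite [RHS]mxE => <-.
  have -> : e = delta_mx (rshift n j) 0.
    apply/colP=> q; case: (split_ordP q) => q' ->; rewrite ?col_mxEu ?col_mxEd !mxE ?ord1.
      by rewrite -val_eqE /= [_ == _]ltn_eqF // (leq_trans (ltn_ord q')) ?leq_addr.
    by rewrite !eqxx.
  by rewrite -colE mxE.
have [c ca] : exists c : 'I_n, c != a.
  have [->|a0] := eqVneq a (Ordinal n0); first by exists (Ordinal n1).
  by exists (Ordinal n0); rewrite eq_sym.
(* Both [b a + i b c] and [b a - i b c] are isotropic and orthogonal to [e]; their sum is [2 b a],
   so [x] cannot kill both. *)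
have [u [uu ue xu]] : exists u, [/\ dot u u = 0, dot u e = 0 & x *m u != 0].
  have [h|h] := eqVneq (x *m (b a + i *: b c)) 0; last first.
    exists (b a + i *: b c); split=> //; rewrite !dot_lin !(bb, be) ?mulr0 ?addr0 //.
    by rewrite !eqxx eq_sym (negPf ca) !mulr1 !mulr0 addr0 add0r ii subrr.
  exists (b a - i *: b c); split; rewrite ?dot_lin ?(bb, be) ?mulr0 ?oppr0 ?addr0 //.
    by rewrite !eqxx eq_sym (negPf ca) mulr1 !mulr0 !oppr0 addr0 add0r opprK ii subrr.
  apply: contraNneq xa => h'; have := congr2 +%R h h'.
  rewrite -mulmxDr addrACA subrr addr0 addr0 -mulr2n -scaler_nat -scalemxAr => /eqP.
  by rewrite scaler_eq0 (negPf two).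
pose B := wedge e u; have BT : B^T = - B by exact: wedge_tr.
have ee := dot_elast K n; have eu : dot e u = 0 by rewrite dotC.
have Be : B *m e = - u by rewrite wedge_mul ue ee scale0r scale1r sub0r.
have Bu : B *m u = 0 by rewrite wedge_mul uu eu !scale0r subrr.
have B3 : B *m B *m B = 0.
  rewrite {3}/B wedgeE mulmxBr !mulmxA -(mulmxA B B e) Be mulmxN Bu oppr0 mul0mx.
  by rewrite -(mulmxA B B u) Bu mulmx0 mul0mx subrr.
have tB3 t : (t *: B) *m (t *: B) *m (t *: B) = 0.
  by rewrite -!scalemxAl -!scalemxAr -!scalemxAl B3 !scaler0.
have tBT t : (t *: B)^T = - (t *: B) by rewrite linearZ /= BT scalerN.
pose X t := exp3 (t *: B) *m x *m (exp3 (t *: B))^T.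
have pX : polycurve X.
  apply: polycurveM; last by apply: polycurve_tr; exact: polycurve_exp3.
  by apply: polycurveM; [exact: polycurve_exp3|exact: polycurve_cst].
have XO t : t != 0 -> Om (X t).
  move=> t0; have Gt := exp3_SO char0 (tBT t) (tB3 t); have [gg _] := Gt.
  split; first by rewrite /X -orth_inv //; exact: O_conj.
  rewrite /X /= exp3_tr // -mulmxA.
  have -> : exp3 (- (t *: B)) *m e = e + t *: u.
    rewrite /exp3 !(mulmxDl, mul1mx, mulNmx, mulmxN, opprK, =^~ scalemxAl, =^~ scalemxAr).
    by rewrite -(mulmxA B B e) Be mulmxN Bu oppr0 !scaler0 addr0 scalerN opprK.
  rewrite -mulmxA mulmxDr xe add0r -scalemxAr; apply/eqP=> /(congr1 (mulmx (exp3 (t *: B))^T)).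
  rewrite mulmxA gg mul1mx mulmx0 => /eqP; rewrite scaler_eq0 (negPf t0) (negPf xu) //.
split; last by exists (X 1); apply: XO; exact: oner_neq0.
have -> : x = X 0 by rewrite /X !scale0r /exp3 mul0mx scaler0 !addr0 trmx1 mulmx1 mul1mx.
by apply: (curve_zclosure char0 (t0 := 1) _ pX (polyfun_id K)) => //; exact: oner_neq0.
Qed.

Lemma Om_ex : exists x, Om x.
Proof.
have [x Ox] := O_ex; case: (eqVneq (x *m e) 0) => xe.
  by have [_] := Om_dense_curve Ox xe.
by exists x.
Qed.

Lemma Om_dense : dense_orbit H O Om.
Proof.
have [y Oy] := Om_ex; split; first by exists y; exact: Om_orbit.
- by move=> x [].
move=> x Ox; have [xe|xe] := eqVneq (x *m e) 0; first by have [] := Om_dense_curve Ox xe.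
by apply: zclosure_sub; split.
Qed.

Lemma Om_unique W : dense_orbit H O W -> W = Om.
Proof.
have [[y Oy] _ _] := Om_dense => dW.
apply: (dense_orbit_unique (F := fun x => x *m e)) => //.
- exact: mxgroup_SO_sub.
- by apply: polymapM; [exact: polymap_id|exact: polymap_cst].
- by exists y.
exact: dW.
Qed.

(** The equation [x x = 0] passes to the closure. An element of the complement has zero projection,
    so it is [wedge u e] with [u = x e]; then [u] is isotropic and orthogonal to [e], and evaluating
    [x x] on a vector pairing to 1 with [u] gives [- u]. Conversely 0 is a limit of multiples of an
    element, by [null2_scale]. *)
Lemma O_zclosure : zclosure O `&` [set x | x \in killing_orth (so K (n + 1)) (so_sub K n)] = [set 0].
Proof.
apply/seteqP; split=> [x [xO /= /(killing_orth_so char0 _ n3 (@so_sub_so K n))]|_ ->].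
  move=> [/mem_so xT xh].
  have xx : x *m x = 0.
    apply: (polymap_zclosure (F := fun x => x *m x)) xO => [|y /Onull [_ //]].
    by apply: polymapM; exact: polymap_id.
  have c0 : cut x = 0.
    apply: (tr_so_eq0 char0); first by apply: (subvP (@so_sub_so K n)); exact: cut_so_sub.
    move=> y /mem_so yT; have ch := cut_so_sub char0 xT.
    have [_ co] : cut y \in so K (n + 1) /\ \tr ((y - cut y) *m cut x) = 0.
      have /(killing_orth_so char0 _ n3 (@so_sub_so K n)) [_ h] := cut_orth char0 n1 yT.
      by split; [apply: (subvP (@so_sub_so K n)); exact: cut_so_sub|exact: h].
    have [_ co'] : cut x \in so K (n + 1) /\ \tr ((x - cut x) *m cut y) = 0.
      have /(killing_orth_so char0 _ n3 (@so_sub_so K n)) [_ h] := cut_orth char0 n1 xT.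
      by split; [apply: (subvP (@so_sub_so K n))|apply: h; exact: cut_so_sub].
    have xy : \tr (x *m cut y) = 0 by apply: xh; exact: cut_so_sub.
    rewrite -[y](subrK (cut y)) mulmxDr linearD /= mxtrace_mulC co add0r.
    by move: co'; rewrite mulmxBl linearB /= xy sub0r => /eqP; rewrite oppr_eq0 => /eqP.
  set u := x *m e in c0 *; have xE : x = wedge u e.
    by move/eqP: c0; rewrite /cut addr_eq0 => /eqP {1}->; rewrite -wedgeC.
  have eu : dot e u = 0 by rewrite skew_dot0.
  have uu : dot u u = 0 by rewrite {1}/u dot_mulmxl xT mulNmx mulmxA xx mul0mx oppr0 dot0r.
  have [u0|u0] := eqVneq u 0; first by rewrite xE u0 wedge0l.
  have [w uw] := dot_ex1 u0; have := congr1 (mulmxr w) xx.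
  rewrite /= mul0mx -mulmxA {2}xE wedge_mul uw scale1r mulmxBr -scalemxAr -/u.
  by rewrite {1}xE wedge_mul uu eu !scale0r subr0 scaler0 sub0r => /eqP; rewrite oppr_eq0 (negPf u0).
split; last by rewrite /= mem0v.
have [x Ox] := O_ex; have nx := Onull Ox.
suff : zclosure O (0 ^+ 4 *: x) by rewrite expr0n scale0r.
apply: (@curve_zclosure K char0 _ O (fun t => t ^+ 4 *: x) id 1 0).
- apply: polycurveZ; last exact: polycurve_cst.
  by apply: polyfunX; exact: polyfun_id.
- exact: polyfun_id.
- exact: oner_neq0.
move=> t t0; have [|g Gg gx] := null2_scale char0 NE _ nx t0; first by rewrite (leq_trans _ s2).
have [gg _] := Gg; rewrite -(orth_conj gg gx); exact: O_conj.
Qed.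

Local Notation phi := (killing_proj (so K (n + 1)) (so_sub K n)).
Local Notation mu3 := (3%N :: nseq (s - 2) 2%N ++ nseq m 1%N).
Local Notation mu3' := (3%N :: nseq (s - 2) 2%N ++ nseq m.+1 1%N).

Lemma phi_Om : phi @` Om = @embed_lie K n @` nilp_orbit K n mu3.
Proof.
have nE : (n = 3 + (s - 2) + (s - 2) + m)%N by lia.
have sE : s = (s - 2).+2 by lia.
apply/seteqP; split=> y.
  move=> [x [Ox xe] <-]; have nx := Onull Ox; have [xT _ _] := nx.
  rewrite phi_cut //; have [yT ye yy yu ry] := cut_null2 char0 nx xe.
  have /mem_so_sub [z /mem_so zT zE] := cut_so_sub char0 xT.
  exists z => //; apply/(nilp3P _ nE); split=> //.
  - apply: embed_lie_eq0; rewrite -!embed_lieM -zE yy.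
    have uy : (x *m e)^T *m cut x = 0.
      by rewrite -[cut x]opprK -yT mulmxN -trmx_mul yu trmx0 oppr0.
    by rewrite -(mulmxA (x *m e)) uy mulmx0.
  - by rewrite -rank_embed_lie -zE ry -sE.
  rewrite -rank_embed_lie -embed_lieM -zE yy.
  have [v uv] := dot_ex1 xe; rewrite -[v]trmxK in uv.
  rewrite -[X in \rank (X *m _)]mulmx1 (mxrank_factor (M := v)) ?mxrank1 //.
  by rewrite dotE -[v]trmxK uv.
move=> [z /(nilp3P _ nE) [zT z3 rz rz2] <-] {y}.
pose y := embed_lie z.
have ys : y \in so_sub K n by apply/mem_so_sub; exists z => //; apply/mem_so.
have [yT ye] := (so_subP _).1 ys.
have y3 : y *m y *m y = 0.
  by rewrite !embed_lieM z3 /embed_lie -(block_mx0 K n 1 n 1).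
have [u u0 yy] : exists2 u : 'cV_(n + 1), u != 0 & y *m y = u *m u^T.
  apply: (sym_rank1 char0); first exact: skew_sqr_sym.
  by rewrite embed_lieM rank_embed_lie.
have yu : y *m u = 0.
  have [f uf] := dot_ex1 u0; have := congr1 (mulmxr f) y3.
  by rewrite /= mul0mx -(mulmxA y) yy mulmxA outer_mul uf scale1r.
have ry : \rank y = s by rewrite rank_embed_lie rz -sE.
have [nx xe cx] := uncut_null2 yT ye u0 yy yu ry.
set x := y + wedge u e in nx xe cx.
have u0' : - u != 0 by rewrite oppr_eq0.
have yy' : y *m y = (- u) *m (- u)^T by rewrite linearN /= mulNmx mulmxN opprK.
have yu' : y *m (- u) = 0 by rewrite mulmxN yu oppr0.
have [nx' xe' cx'] := uncut_null2 yT ye u0' yy' yu' ry.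
set x' := y + wedge (- u) e in nx' xe' cx'.
(* Some orthogonal [g] takes an element of [O] to [x]. If its determinant is -1, composing with the
   reflection along [e] gives determinant 1 and the target [x']: the reflection commutes with [y],
   fixes [u] and negates [e]. So [x] or [x'] lies in [O]. *)
have [x1 Ox1] := O_ex; have [g gg gx] := null2_conj_any (Onull Ox1) nx.
case: (orth_det gg) => dg.
  exists x; last by rewrite phi_cut ?cx //; case: nx.
  split; last by rewrite /= xe.
  by rewrite -(orth_conj gg gx); exact: O_conj.
exists x'; last by rewrite phi_cut ?cx' //; case: nx'.
split; last by rewrite /= xe'.
have [rr dr] := (refl_orth (dot_elast K n), det_refl two n0 (dot_elast K n)).
set r := refl e in rr dr.
have rgrg : (r *m g)^T *m (r *m g) = 1%:M by exact: orth_mul.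
have rx : r *m x = x' *m r.
  have [ry1 ry2] := refl_comm yT ye; rewrite -/r in ry1 ry2.
  have ue : dot e u = 0 by rewrite -xe skew_dot0 //; case: nx.
  have re : r *m e = - e by rewrite refl_mul dot_elast mulr1 scaler_nat mulr2n opprD addrA subrr sub0r.
  have ru : r *m u = u by rewrite refl_mul ue mulr0 scale0r subr0.
  have rT : r^T = r by exact: refl_tr.
  rewrite /x /x' (mulmxDr r) (mulmxDl y) ry1 ry2; congr (_ + _).
  have -> : wedge (- u) e = r *m wedge u e *m r^T by rewrite wedge_conj ru re wedgeNl wedgeNr.
  by rewrite -[RHS]mulmxA rr mulmx1.
have rgx : (r *m g) *m x1 = x' *m (r *m g) by rewrite -mulmxA gx !mulmxA rx.
rewrite -(orth_conj rgrg rgx); apply: O_conj => //; split=> //.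
by rewrite det_mulmx dg dr mulrNN mulr1.
Qed.

(** Since [z z] is nonzero, [kernel_unit] yields a unit vector killed by [z]; moving it to [e] by an
    element of the group brings [z] into the subalgebra with the same ranks. *)
Lemma saturation_phi_Om : saturation G (phi @` Om) = nilp_orbit K (n + 1) mu3'.
Proof.
have nE : (n = 3 + (s - 2) + (s - 2) + m)%N by lia.
have nE' : (n + 1 = 3 + (s - 2) + (s - 2) + m.+1)%N by lia.
rewrite phi_Om; apply/seteqP; split=> z.
  move=> [_ [y /(nilp3P _ nE) [yT y3 ry ryy] <-] [g [gg _] <-]]; have ug := orth_unit gg.
  have ys : embed_lie y \in so_sub K n by apply/mem_so_sub; exists y => //; apply/mem_so.
  have [eT _] := (so_subP _).1 ys; apply/(nilp3P _ nE'); split.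
  - exact: conj_skew.
  - rewrite !mulmxA mulmxKV // mulmxKV // -!(mulmxA g) !embed_lieM y3.
    by rewrite /embed_lie (block_mx0 K n 1 n 1) mul0mx mulmx0.
  - by rewrite rank_conj // rank_embed_lie.
  by rewrite !mulmxA mulmxKV // -(mulmxA g) rank_conj // embed_lieM rank_embed_lie.
move=> /(nilp3P _ nE') [zT z3 rz rzz].
have [||d dd zd] := kernel_unit two zT; first by rewrite rz -addnn; lia.
  by right; rewrite -mxrank_eq0 rzz.
have [g Gg ge] := unit_transitive two n0 dd; have [gg _] := Gg.
pose y := g^T *m z *m g.
have yT : y^T = - y by rewrite /y !trmx_mul trmxK zT mulNmx mulmxN mulmxA.
have ye : y *m e = 0 by rewrite /y -!mulmxA ge zd mulmx0.
have /mem_so_sub [w /mem_so wT wE] := (so_subP y).2 (conj yT ye).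
have yE : y = g^T *m z *m invmx (g^T) by rewrite orth_inv ?trmxK //; exact: orth_r.
have ugt : g^T \in unitmx by rewrite unitmx_tr orth_unit.
exists y; last first.
  exists g => //; rewrite orth_inv // /y !mulmxA orth_r // mul1mx.
  by rewrite -mulmxA orth_r // mulmx1.
exists w; last by rewrite wE.
apply/(nilp3P _ nE); split=> //.
- apply: embed_lie_eq0; rewrite -!embed_lieM -wE /y !mulmxA.
  do 2!rewrite -[_ *m g *m g^T]mulmxA orth_r // mulmx1.
  by rewrite mul_cube0 ?mul0mx.
- by rewrite -rank_embed_lie -wE yE rank_conj.
rewrite -rank_embed_lie -embed_lieM -wE {1}yE yE !mulmxA mulmxKV // -(mulmxA g^T).
by rewrite rank_conj.
Qed.

Lemma height_saturation : orbit_height (so K (n + 1)) (nilp_orbit K (n + 1) mu3') 3.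
Proof.
have nE' : (n + 1 = 3 + (s - 2) + (s - 2) + m.+1)%N by lia.
split.
  rewrite -saturation_phi_Om; have [x Ox] := Om_ex; exists (phi x).
  by exists (phi x); [exists x | exact: conj_orbit_refl (mxgroup_SO _ _)].
move=> z /(nilp3P _ nE') [zT z3 rz rzz]; apply: height3 => //.
by rewrite rz; lia.
Qed.

Lemma height_O : orbit_height (so K (n + 1)) O 2.
Proof.
split; first by have [x Ox] := O_ex; exists x.
by move=> x /Onull nx; have [xT xx _] := nx; apply: height2 => //; exact: null2_neq0.
Qed.

End OneOrbit.
End PartI.

(** * Skew matrices of cube zero *)

Section Null3.
Variable K : closedFieldType.
Hypothesis char0 : [pchar K] =i pred0.

Let two : 2%:R != 0 :> K := natr_neq0 char0 1.

(** The nilpotents of partition [(3^r, 1^m)]: the cases [r = 1] and [r = 2] with [N = 7] are the two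
    orbits of part (ii). *)
Definition null3 N r (z : 'M[K]_N) :=
  [/\ z^T = - z, z *m z *m z = 0, \rank z = (r + r)%N & \rank (z *m z) = r].

(** Meant for chains [A -> B -> C -> 0] of a skew [z]. The sign in [B^T B = - 1] is forced by
    [(z a, z a') = - (a, z z a')]. *)
Definition null3_frame N r m (A B C : 'M[K]_(N, r)) (D : 'M[K]_(N, m)) :=
  [/\ [/\ A^T *m A = 0, A^T *m B = 0 & A^T *m C = 1%:M],
      [/\ B^T *m B = - 1%:M, B^T *m C = 0 & C^T *m C = 0],
      [/\ D^T *m A = 0, D^T *m B = 0, D^T *m C = 0 & D^T *m D = 1%:M] &
      A *m C^T + C *m A^T - B *m B^T + D *m D^T = 1%:M].

(** [C] comes from [z z = C C^T] and is isotropic because [z C = 0]. Any [M] dual to [C] starts the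
    chains, and it is corrected twice: by a multiple of [z M] to make [A] orthogonal to [z A], then
    by a multiple of [C] to make [A] isotropic. *)
Lemma null3_frame_exists N r m (z : 'M[K]_N) : (N = r + r + r + m)%N -> null3 r z ->
  exists (A B C : 'M_(N, r)) (D : 'M_(N, m)),
    null3_frame A B C D /\ z = B *m C^T - C *m B^T.
Proof.
move=> NE [zT z3 rz rzz].
have [C [M [zzE CM]]] := sym_factor two (skew_sqr_sym zT) rzz.
have MC : M^T *m C = 1%:M by rewrite (trmx_eq CM) trmx1.
have zC : z *m C = 0.
  have := congr1 (mulmxr M) z3.
  by rewrite /= mul0mx -(mulmxA z z z) zzE -!mulmxA CM mulmx1.
have Cz : C^T *m z = 0 by rewrite -[z]opprK -zT mulmxN -trmx_mul zC trmx0 oppr0.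
have CC : C^T *m C = 0.
  have := congr1 (fun X => M^T *m z *m X) zC.
  rewrite mulmx0 !mulmxA -(mulmxA _ z z) zzE mulmxA MC mul1mx => //.
have zzX (X : 'M_(N, r)) : C^T *m X = 1%:M -> z *m (z *m X) = C.
  by move=> CX; rewrite mulmxA zzE -mulmxA CX mulmx1.
pose B0 := z *m M; pose h : K := 2%:R^-1.
have B0T : B0^T = - (M^T *m z) by rewrite trmx_mul zT mulmxN.
have zB0 : z *m B0 = C by exact: zzX.
have BC0 : B0^T *m C = 0 by rewrite B0T mulNmx -mulmxA zC mulmx0 oppr0.
have CB0 : C^T *m B0 = 0 by rewrite mulmxA Cz mul0mx.
have BB0 : B0^T *m B0 = - 1%:M by rewrite B0T mulNmx -mulmxA zB0 MC.
(* [M^T z M] is skew, so half of it suffices: the correction enters [A1^T z A1] once through [S] and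
   once through its transpose. The symmetric [T] below plays the same role for the Gram matrix. *)
pose S := - (h *: (M^T *m B0)).
have ST : S^T = - S.
  rewrite linearN linearZ /= trmx_mul trmxK B0T mulNmx -mulmxA.
  by rewrite scalerN.
pose A1 := M + B0 *m S.
have A1E : A1 = M + B0 *m S by [].
have zA1 : z *m A1 = B0 + C *m S by rewrite (mulmxDr z) mulmxA zB0.
have A1T : A1^T = M^T + S^T *m B0^T by rewrite -trmx_mul -linearD.
have A1zA1 : A1^T *m (z *m A1) = 0.
  rewrite zA1 A1T (mulmxDl M^T) (mulmxDr M^T) (mulmxDr (S^T *m _)) (mulmxA M^T C) MC mul1mx.
  rewrite -!(mulmxA S^T) BB0 (mulmxA B0^T C) BC0 mul0mx mulmx0 addr0 mulmxN mulmx1 ST opprK.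
  have -> : M^T *m B0 = - (2%:R *: S) by rewrite scalerN scalerA divff // scale1r opprK.
  by mxring.
have CA1 : C^T *m A1 = 1%:M by rewrite (mulmxDr C^T) CM mulmxA CB0 mul0mx addr0.
have AC1 : A1^T *m C = 1%:M by rewrite (trmx_eq CA1) trmx1.
clearbody A1.
pose T := - (h *: (A1^T *m A1)).
have TT : T^T = T by rewrite linearN linearZ /= trmx_mul trmxK.
pose A := A1 + C *m T.
have AT : A^T = A1^T + T *m C^T by rewrite -[in RHS]TT -trmx_mul -linearD.
have zA : z *m A = z *m A1 by rewrite (mulmxDr z) mulmxA zC mul0mx addr0.
have CA : C^T *m A = 1%:M by rewrite (mulmxDr C^T) CA1 mulmxA CC mul0mx addr0.
have hAC : A^T *m C = 1%:M by rewrite (trmx_eq CA) trmx1.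
have AA : A^T *m A = 0.
  rewrite AT (mulmxDl A1^T) (mulmxDr A1^T) (mulmxA A1^T C) AC1 mul1mx -mulmxA CA mulmx1.
  have -> : A1^T *m A1 = - (2%:R *: T) by rewrite scalerN scalerA divff // scale1r opprK.
  by mxring.
pose B := z *m A.
have hAB : A^T *m B = 0.
  by rewrite /B zA AT mulmxDl A1zA1 -mulmxA (mulmxA C^T) Cz mul0mx mulmx0 addr0.
have BT : B^T = - (A^T *m z) by rewrite trmx_mul zT mulmxN.
have zB : z *m B = C by exact: zzX.
have BA : B^T *m A = 0 by rewrite (trmx_eq hAB) trmx0.
have BC : B^T *m C = 0 by rewrite BT mulNmx -mulmxA zC mulmx0 oppr0.
have CB : C^T *m B = 0 by rewrite (trmx_eq BC) trmx0.
have BB : B^T *m B = - 1%:M by rewrite BT mulNmx -mulmxA zB hAC.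
have zAE : z *m A = B by [].
clearbody A B.
pose E := A *m C^T + C *m A^T - B *m B^T.
have EU : E = row_mx (row_mx A C) B *m col_mx (col_mx C^T A^T) (- B^T).
  by rewrite !mul_row_col mulmxN.
have VU : col_mx (col_mx C^T A^T) (- B^T) *m row_mx (row_mx A C) B = 1%:M.
  rewrite mul_col_row mul_col_row !mul_mx_row !mul_col_mx !mulNmx CA CC CB AA hAC hAB BA BC BB.
  by rewrite !oppr0 opprK row_mx0 col_mx0 -!scalar_mx_block.
have rE : \rank E = (r + r + r)%N by rewrite EU rank_retract.
have EE : E *m E = E by rewrite {1}EU -mulmxA EU (mulmxA _ (row_mx _ _)) VU mul1mx.
have ET : E^T = E.
  by rewrite linearB linearD /= !trmx_mul !trmxK; congr (_ - _); rewrite addrC.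
have EA : E *m A = A.
  by rewrite (mulmxBl _ (B *m _)) (mulmxDl (A *m _)) -!mulmxA CA AA BA !mulmx0 mulmx1 addr0 subr0.
have EB : E *m B = B.
  rewrite (mulmxBl _ (B *m _)) (mulmxDl (A *m _)) -!mulmxA CB hAB BB !mulmx0.
  by rewrite mulmxN mulmx1 opprK !add0r.
have EC : E *m C = C.
  by rewrite (mulmxBl _ (B *m _)) (mulmxDl (A *m _)) -!mulmxA CC hAC BC !mulmx0 mulmx1 add0r subr0.
pose Q := 1%:M - E.
have QT : Q^T = Q by rewrite linearB /= trmx1 ET.
have QQ : Q *m Q = Q by rewrite mulmxBl mul1mx mulmxBr mulmx1 EE subrr subr0.
have rQ : \rank Q = m by have := rank_idem_compl EE; rewrite -/Q rE; lia.
have [D [QD DD]] := proj_factor two QT QQ rQ.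
have DQ : D^T *m Q = D^T by rewrite QD mulmxA DD mul1mx.
have DX (X : 'M_(N, r)) : E *m X = X -> D^T *m X = 0.
  by move=> EX; rewrite -DQ -mulmxA mulmxBl mul1mx EX subrr mulmx0.
have [DA DB DC] : [/\ D^T *m A = 0, D^T *m B = 0 & D^T *m C = 0] by split; exact: DX.
have PP : E + D *m D^T = 1%:M by rewrite -QD addrC subrK.
exists A, B, C, D; split; first by split; [split|split|split|].
(* By the rank of [z], the rows of [B^T] and [C^T] span its whole row space, and [D] is orthogonal
   to them. *)
have zD : z *m D = 0.
  have sub : (col_mx B^T C^T <= z)%MS.
    apply/submxP; exists (- col_mx A^T B^T); rewrite mulNmx mul_col_mx.
    have -> : A^T *m z = - B^T by rewrite BT opprK.
    have -> : B^T *m z = - C^T by rewrite -zB trmx_mul zT mulmxN opprK.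
    by rewrite opp_col_mx !opprK.
  have rk : \rank (col_mx B^T C^T) = (r + r)%N.
    apply/eqP; rewrite eqn_leq rank_leq_row /=.
    have VV : col_mx B^T C^T *m row_mx (- B) A = 1%:M.
      by rewrite mul_col_row !mulmxN BB CB BA CA opprK oppr0 -scalar_mx_block.
    have := mxrankM_maxl (col_mx B^T C^T) (row_mx (- B) A).
    by rewrite VV mxrank1.
  have := mxrank_leqif_sup sub; rewrite rk rz => -[_]; rewrite eqxx => /esym /submxP [W zW].
  by rewrite zW -mulmxA mul_col_mx (trmx_eq DB) (trmx_eq DC) !trmx0 col_mx0 mulmx0.
rewrite -[LHS]mulmx1 -PP (mulmxDr z E) mulmxA zD mul0mx addr0.
rewrite /E (mulmxBr z) (mulmxDr z) !mulmxA zAE zC zB mul0mx addr0.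
by [].
Qed.

Lemma null3_frame_conj N r m (A B C A' B' C' : 'M[K]_(N, r)) (D D' : 'M[K]_(N, m)) :
  null3_frame A B C D -> null3_frame A' B' C' D' ->
  exists g, [/\ g^T *m g = 1%:M, g *m A = A', g *m B = B', g *m C = C' & g *m D = D'].
Proof.
move=> [[AA hAB hAC] [BB BC CC] [DA DB DC DD] PP].
move=> [[AA' hAB' hAC'] [BB' BC' CC'] [DA' DB' DC' DD'] PP'].
have [CA CA'] : C^T *m A = 1%:M /\ C'^T *m A' = 1%:M.
  by rewrite (trmx_eq hAC) (trmx_eq hAC') trmx1.
have [BA BA'] : B^T *m A = 0 /\ B'^T *m A' = 0 by rewrite (trmx_eq hAB) (trmx_eq hAB') trmx0.
have [CB CB'] : C^T *m B = 0 /\ C'^T *m B' = 0 by rewrite (trmx_eq BC) (trmx_eq BC') trmx0.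
have [AD AD'] : A^T *m D = 0 /\ A'^T *m D' = 0 by rewrite (trmx_eq DA) (trmx_eq DA') trmx0.
have [BD BD'] : B^T *m D = 0 /\ B'^T *m D' = 0 by rewrite (trmx_eq DB) (trmx_eq DB') trmx0.
have [CD CD'] : C^T *m D = 0 /\ C'^T *m D' = 0 by rewrite (trmx_eq DC) (trmx_eq DC') trmx0.
pose g := A' *m C^T + C' *m A^T - B' *m B^T + D' *m D^T.
have gM p (X : 'M_(N, p)) : g *m X =
    A' *m (C^T *m X) + C' *m (A^T *m X) - B' *m (B^T *m X) + D' *m (D^T *m X).
  by rewrite /g mulmxDl mulmxBl mulmxDl !mulmxA.
have gT : g^T = C *m A'^T + A *m C'^T - B *m B'^T + D *m D'^T.
  by rewrite /g linearD linearB linearD /= !trmx_mul !trmxK.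
have gTM p (X : 'M_(N, p)) : g^T *m X =
    C *m (A'^T *m X) + A *m (C'^T *m X) - B *m (B'^T *m X) + D *m (D'^T *m X).
  by rewrite gT mulmxDl mulmxBl mulmxDl !mulmxA.
have gA : g *m A = A' by rewrite gM CA AA BA DA !mulmx0 mulmx1 subr0 !addr0.
have gB : g *m B = B' by rewrite gM CB hAB BB DB !mulmx0 mulmxN mulmx1 opprK addr0 !add0r.
have gC : g *m C = C' by rewrite gM CC hAC BC DC !mulmx0 mulmx1 subr0 add0r addr0.
have gD : g *m D = D' by rewrite gM CD AD BD DD !mulmx0 mulmx1 subr0 !add0r.
exists g; split=> //.
have gA' : g^T *m A' = A by rewrite gTM CA' AA' BA' DA' !mulmx0 mulmx1 subr0 add0r addr0.
have gB' : g^T *m B' = B by rewrite gTM CB' hAB' BB' DB' !mulmx0 mulmxN mulmx1 opprK addr0 !add0r.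
have gC' : g^T *m C' = C by rewrite gTM CC' hAC' BC' DC' !mulmx0 mulmx1 subr0 !addr0.
have gD' : g^T *m D' = D by rewrite gTM CD' AD' BD' DD' !mulmx0 mulmx1 subr0 !add0r.
rewrite {2}/g (mulmxDr g^T) (mulmxBr g^T) (mulmxDr g^T) !mulmxA gA' gB' gC' gD'.
by rewrite -PP; congr (_ - _ + _); rewrite addrC.
Qed.

Lemma null3_conj N r m (z z' : 'M[K]_N) : (N = r + r + r + m)%N -> null3 r z -> null3 r z' ->
  exists2 g, g^T *m g = 1%:M & g *m z = z' *m g.
Proof.
move=> NE /(null3_frame_exists NE) [A [B [C [D [fr zE]]]]].
move=> /(null3_frame_exists NE) [A' [B' [C' [D' [fr' zE']]]]].
have [g [gg gA gB gC gD]] := null3_frame_conj fr fr'; exists g => //.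
rewrite zE zE' mulmxBr mulmxBl !mulmxA gB gC.
by rewrite -!mulmxA (orth_fixl gg gB) (orth_fixl gg gC).
Qed.

(** In odd dimension [- g] has the opposite determinant and conjugates in the same way. *)
Lemma null3_conj_SO N r m (z z' : 'M[K]_N) : odd N -> (N = r + r + r + m)%N ->
  null3 r z -> null3 r z' -> exists2 g, SO K N g & g *m z = z' *m g.
Proof.
move=> oN NE nz nz'; have [g gg gz] := null3_conj NE nz nz'.
case: (orth_det gg) => dg; first by exists g.
exists (- g); last by rewrite mulNmx gz mulmxN.
split; first by rewrite [(- g)^T]linearN /= mulNmx mulmxN opprK.
by rewrite -scaleN1r detZ dg -signr_odd oN expr1 mulrNN mulr1.
Qed.

Lemma null3_conj_orth N r (g z : 'M[K]_N) : g^T *m g = 1%:M -> null3 r z ->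
  null3 r (g *m z *m invmx g).
Proof.
move=> gg [zT z3 rz rzz]; have ug := orth_unit gg.
have sq : g *m z *m invmx g *m (g *m z *m invmx g) = g *m (z *m z) *m invmx g.
  by rewrite !mulmxA mulmxKV.
split; rewrite ?sq ?rank_conj //; first exact: conj_skew.
by rewrite !mulmxA mulmxKV // mul_cube0 // mul0mx.
Qed.

(** [wedge A d], with [d] a unit vector among the columns of [D], survives the square of [ad z]: the
    result sends [d] to [C]. The cube vanishes because [z = wedge B C], [z z = C C^T] and
    [(C, y C) = 0] put [z y C] on the line of [C]. *)
Lemma height_null3_1 N m (z : 'M[K]_N) : (N = 3 + m)%N -> (0 < m)%N -> null3 1 z ->
  is_height (so K N) z 2.
Proof.
move=> NE m0 nz; have [zT z3 _ _] := nz.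
have NE' : (N = 1 + 1 + 1 + m)%N by rewrite NE.
have [A [B [C [D [fr zE]]]]] := null3_frame_exists NE' nz.
have [[AA hAB hAC] [BB BC CC] [DA DB DC DD] PP] := fr.
have CA : C^T *m A = 1%:M by rewrite (trmx_eq hAC) trmx1.
have CB : C^T *m B = 0 by rewrite (trmx_eq BC) trmx0.
have zC : z *m C = 0 by rewrite zE mulmxBl -!mulmxA CC BC !mulmx0 subrr.
have zz : z *m z = C *m C^T.
  rewrite {2}zE mulmxBr !mulmxA zC mul0mx subr0.
  have -> : z *m B = C by rewrite zE mulmxBl -!mulmxA CB BB mulmx0 sub0r mulmxN opprK mulmx1.
  by [].
have C0 : C != 0.
  by apply/eqP=> C0; move: CA; rewrite C0 trmx0 mul0mx => /matrixP/(_ 0 0)/eqP; rewrite !mxE eq_sym oner_eq0.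
have wz : z = wedge B C by rewrite wedgeE.
apply: is_heightI => [|y /mem_so yT].
  pose d := D *m (delta_mx (Ordinal m0) 0 : 'cV_m).
  have dd : dot d d = 1 by rewrite dot_mulmxl mulmxA DD mul1mx dot_delta mxE !eqxx.
  have Xd (X : 'cV_N) : D^T *m X = 0 -> dot X d = 0.
    by move=> DX; rewrite dotC dot_mulmxl DX dot0r.
  have zd : z *m d = 0 by rewrite wz wedge_mul !Xd // !scale0r subrr.
  exists (wedge A d); first exact: wedge_so.
  rewrite iter2_lie sandwich_wedge // zd wedge0r oppr0 scaler0 subr0 -(mulmxA (wedge A d)) zz.
  apply/eqP=> /(congr1 (mulmxr d)) /=; rewrite mul0mx mulmxDl -!mulmxA wedge_mul.
  rewrite dd !Xd // scale1r scale0r subr0 CA mulmx1 (mulmxA C) outer_mul Xd // scale0r.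
  by rewrite mulmx0 addr0; apply/eqP.
rewrite iter3_lie // -(mulmxA _ z z) zz.
have h : z *m y *m C = - dot B (y *m C) *: C.
  by rewrite -mulmxA wz wedge_mul skew_dot0 // scale0r sub0r scaleNr.
have h' : C^T *m y *m z = - dot B (y *m C) *: C^T.
  have -> : C^T *m y *m z = (z *m y *m C)^T.
    by rewrite !trmx_mul zT yT !(mulNmx, mulmxN, opprK) mulmxA.
  by rewrite h linearZ.
by rewrite mulmxA h -!(mulmxA C) h' -scalemxAl -scalemxAr subrr scaler0.
Qed.

(** The image of [z z] is a plane, so it carries a nonzero skew form: [y = A alt2 A^T] gives
    [z z y z z = C alt2 C^T], which is nonzero. With a line in place of the plane the fourth power
    would vanish. *)
Lemma height_null3_2 N m (z : 'M[K]_N) : (N = 6 + m)%N -> null3 2 z ->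
  is_height (so K N) z 4.
Proof.
move=> NE nz; have [zT z3 _ _] := nz.
have NE' : (N = 2 + 2 + 2 + m)%N by rewrite NE.
have [A [B [C [D [fr zE]]]]] := null3_frame_exists NE' nz.
have [[AA hAB hAC] [BB BC CC] [DA DB DC DD] PP] := fr.
have CA : C^T *m A = 1%:M by rewrite (trmx_eq hAC) trmx1.
have CB : C^T *m B = 0 by rewrite (trmx_eq BC) trmx0.
have zC : z *m C = 0 by rewrite zE mulmxBl -!mulmxA CC BC !mulmx0 subrr.
have zz : z *m z = C *m C^T.
  rewrite {2}zE mulmxBr !mulmxA zC mul0mx subr0.
  have -> : z *m B = C by rewrite zE mulmxBl -!mulmxA CB BB mulmx0 sub0r mulmxN opprK mulmx1.
  by [].
apply: is_heightI => [|y _]; last exact: iter5_lie.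
exists (A *m alt2 K *m A^T).
  by apply/mem_so; rewrite !trmx_mul trmxK alt2_tr mulNmx mulmxN mulmxA.
rewrite iter4_lie // -(mulmxA _ z z) zz !mulmxA scaler_eq0 negb_or natr_neq0 //=.
rewrite -!mulmxA (mulmxA C^T A) CA mul1mx (mulmxA A^T C) hAC mul1mx.
apply/eqP=> /(congr1 (fun X => A^T *m X *m A)).
rewrite mulmx0 mul0mx !mulmxA hAC mul1mx -mulmxA CA mulmx1 => h.
by have := alt2_sqr K; rewrite h mul0mx => /matrixP /(_ 0 0) /eqP; rewrite !mxE eqxx eq_sym oppr_eq0 oner_eq0.
Qed.

End Null3.

(** * The cross product *)

Section Coordinates.
Variable K : fieldType.

Definition o7 (i : nat) : 'I_7 := inord i.

Lemma ord7_ind (P : 'I_7 -> Prop) :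
  P (o7 0) -> P (o7 1) -> P (o7 2) -> P (o7 3) -> P (o7 4) -> P (o7 5) -> P (o7 6) ->
  forall i, P i.
Proof.
move=> P0 P1 P2 P3 P4 P5 P6 i; rewrite -[i](inord_val i).
by case: i => [[|[|[|[|[|[|[|i]]]]]]] hi].
Qed.

Lemma sum7 (V : nmodType) (f : 'I_7 -> V) :
  \sum_k f k = f (o7 0) + f (o7 1) + f (o7 2) + f (o7 3) + f (o7 4) + f (o7 5) + f (o7 6).
Proof.
have E n (g : 'I_n.+1 -> V) :
    \sum_k g k = g (inord 0) + \sum_(k < n) g (inord k.+1).
  rewrite big_ord_recl; congr (g _ + _); first by apply: val_inj; rewrite /= inordK.
  by apply: eq_bigr => i _; congr g; apply: val_inj; rewrite /= inordK ?ltnS.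
by rewrite E !big_ord_recr big_ord0 /= add0r !addrA.
Qed.

Lemma o7D i j : (i < 7)%N -> o7 i + (j%:R : 'I_7) = o7 ((i + j) %% 7)%N.
Proof.
move=> hi; apply: val_inj; rewrite /o7 /= !inordK ?ltn_mod //.
have -> : ((j%:R : 'I_7) : nat) = (j %% 7)%N by exact: (val_Zp_nat (p:=7)).
by rewrite modnDmr.
Qed.

Lemma o7D1 i : (i < 7)%N -> o7 i + (1 : 'I_7) = o7 ((i + 1) %% 7)%N.
Proof. by move=> ?; rewrite -o7D. Qed.

Lemma o7_eq i j : (i < 7)%N -> (j < 7)%N -> (o7 i == o7 j) = (i == j).
Proof. by move=> hi hj; rewrite -val_eqE /= !inordK. Qed.

Lemma dot7 (u v : 'cV[K]_7) : dot u v =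
  u (o7 0) 0 * v (o7 0) 0 + u (o7 1) 0 * v (o7 1) 0 + u (o7 2) 0 * v (o7 2) 0
  + u (o7 3) 0 * v (o7 3) 0 + u (o7 4) 0 * v (o7 4) 0 + u (o7 5) 0 * v (o7 5) 0
  + u (o7 6) 0 * v (o7 6) 0.
Proof. by rewrite dot_sum sum7. Qed.

Lemma mulmx7 (A : 'M[K]_7) (v : 'cV[K]_7) k : (A *m v) k 0 =
  A k (o7 0) * v (o7 0) 0 + A k (o7 1) * v (o7 1) 0 + A k (o7 2) * v (o7 2) 0
  + A k (o7 3) * v (o7 3) 0 + A k (o7 4) * v (o7 4) 0 + A k (o7 5) * v (o7 5) 0
  + A k (o7 6) * v (o7 6) 0.
Proof. by rewrite mxE sum7. Qed.

(** The linear map from skew matrices to vectors induced by the cross product, so that [wedge u v]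
    goes to [cross u v]. On skew matrices its kernel is [g2 K]. *)
Definition nvec (x : 'M[K]_7) : 'cV[K]_7 :=
  \col_(k < 7) (x (k + 1) (k + 3%:R) + x (k + 2%:R) (k + 6%:R) + x (k + 4%:R) (k + 5%:R)).

Lemma crossE (u v : 'cV[K]_7) k : cross u v k 0 =
  u (k + 1) 0 * v (k + 3%:R) 0 - u (k + 3%:R) 0 * v (k + 1) 0
  + (u (k + 2%:R) 0 * v (k + 6%:R) 0 - u (k + 6%:R) 0 * v (k + 2%:R) 0)
  + (u (k + 4%:R) 0 * v (k + 5%:R) 0 - u (k + 5%:R) 0 * v (k + 4%:R) 0).
Proof. by rewrite mxE. Qed.

Lemma nvecE (x : 'M[K]_7) k : nvec x k 0 =
  x (k + 1) (k + 3%:R) + x (k + 2%:R) (k + 6%:R) + x (k + 4%:R) (k + 5%:R).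
Proof. by rewrite mxE. Qed.

Lemma cross_o0 (u v : 'cV[K]_7) : cross u v (o7 0) 0 =
  u (o7 1) 0 * v (o7 3) 0 - u (o7 3) 0 * v (o7 1) 0
  + (u (o7 2) 0 * v (o7 6) 0 - u (o7 6) 0 * v (o7 2) 0)
  + (u (o7 4) 0 * v (o7 5) 0 - u (o7 5) 0 * v (o7 4) 0).
Proof. by rewrite crossE ?o7D1 ?o7D. Qed.
Lemma nvec_o0 (x : 'M[K]_7) : nvec x (o7 0) 0 =
  x (o7 1) (o7 3) + x (o7 2) (o7 6) + x (o7 4) (o7 5).
Proof. by rewrite nvecE ?o7D1 ?o7D. Qed.
Lemma cross_o1 (u v : 'cV[K]_7) : cross u v (o7 1) 0 =
  u (o7 2) 0 * v (o7 4) 0 - u (o7 4) 0 * v (o7 2) 0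
  + (u (o7 3) 0 * v (o7 0) 0 - u (o7 0) 0 * v (o7 3) 0)
  + (u (o7 5) 0 * v (o7 6) 0 - u (o7 6) 0 * v (o7 5) 0).
Proof. by rewrite crossE ?o7D1 ?o7D. Qed.
Lemma nvec_o1 (x : 'M[K]_7) : nvec x (o7 1) 0 =
  x (o7 2) (o7 4) + x (o7 3) (o7 0) + x (o7 5) (o7 6).
Proof. by rewrite nvecE ?o7D1 ?o7D. Qed.
Lemma cross_o2 (u v : 'cV[K]_7) : cross u v (o7 2) 0 =
  u (o7 3) 0 * v (o7 5) 0 - u (o7 5) 0 * v (o7 3) 0
  + (u (o7 4) 0 * v (o7 1) 0 - u (o7 1) 0 * v (o7 4) 0)
  + (u (o7 6) 0 * v (o7 0) 0 - u (o7 0) 0 * v (o7 6) 0).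
Proof. by rewrite crossE ?o7D1 ?o7D. Qed.
Lemma nvec_o2 (x : 'M[K]_7) : nvec x (o7 2) 0 =
  x (o7 3) (o7 5) + x (o7 4) (o7 1) + x (o7 6) (o7 0).
Proof. by rewrite nvecE ?o7D1 ?o7D. Qed.
Lemma cross_o3 (u v : 'cV[K]_7) : cross u v (o7 3) 0 =
  u (o7 4) 0 * v (o7 6) 0 - u (o7 6) 0 * v (o7 4) 0
  + (u (o7 5) 0 * v (o7 2) 0 - u (o7 2) 0 * v (o7 5) 0)
  + (u (o7 0) 0 * v (o7 1) 0 - u (o7 1) 0 * v (o7 0) 0).
Proof. by rewrite crossE ?o7D1 ?o7D. Qed.
Lemma nvec_o3 (x : 'M[K]_7) : nvec x (o7 3) 0 =
  x (o7 4) (o7 6) + x (o7 5) (o7 2) + x (o7 0) (o7 1).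
Proof. by rewrite nvecE ?o7D1 ?o7D. Qed.
Lemma cross_o4 (u v : 'cV[K]_7) : cross u v (o7 4) 0 =
  u (o7 5) 0 * v (o7 0) 0 - u (o7 0) 0 * v (o7 5) 0
  + (u (o7 6) 0 * v (o7 3) 0 - u (o7 3) 0 * v (o7 6) 0)
  + (u (o7 1) 0 * v (o7 2) 0 - u (o7 2) 0 * v (o7 1) 0).
Proof. by rewrite crossE ?o7D1 ?o7D. Qed.
Lemma nvec_o4 (x : 'M[K]_7) : nvec x (o7 4) 0 =
  x (o7 5) (o7 0) + x (o7 6) (o7 3) + x (o7 1) (o7 2).
Proof. by rewrite nvecE ?o7D1 ?o7D. Qed.
Lemma cross_o5 (u v : 'cV[K]_7) : cross u v (o7 5) 0 =
  u (o7 6) 0 * v (o7 1) 0 - u (o7 1) 0 * v (o7 6) 0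
  + (u (o7 0) 0 * v (o7 4) 0 - u (o7 4) 0 * v (o7 0) 0)
  + (u (o7 2) 0 * v (o7 3) 0 - u (o7 3) 0 * v (o7 2) 0).
Proof. by rewrite crossE ?o7D1 ?o7D. Qed.
Lemma nvec_o5 (x : 'M[K]_7) : nvec x (o7 5) 0 =
  x (o7 6) (o7 1) + x (o7 0) (o7 4) + x (o7 2) (o7 3).
Proof. by rewrite nvecE ?o7D1 ?o7D. Qed.
Lemma cross_o6 (u v : 'cV[K]_7) : cross u v (o7 6) 0 =
  u (o7 0) 0 * v (o7 2) 0 - u (o7 2) 0 * v (o7 0) 0
  + (u (o7 1) 0 * v (o7 5) 0 - u (o7 5) 0 * v (o7 1) 0)
  + (u (o7 3) 0 * v (o7 4) 0 - u (o7 4) 0 * v (o7 3) 0).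
Proof. by rewrite crossE ?o7D1 ?o7D. Qed.
Lemma nvec_o6 (x : 'M[K]_7) : nvec x (o7 6) 0 =
  x (o7 0) (o7 2) + x (o7 1) (o7 5) + x (o7 3) (o7 4).
Proof. by rewrite nvecE ?o7D1 ?o7D. Qed.

Definition cross_o := (cross_o0, cross_o1, cross_o2, cross_o3, cross_o4, cross_o5, cross_o6).
Definition nvec_o := (nvec_o0, nvec_o1, nvec_o2, nvec_o3, nvec_o4, nvec_o5, nvec_o6).

End Coordinates.

Ltac vec7 := apply/colP; apply: ord7_ind; rewrite ?(mxentE, cross_o, nvec_o, dot7).

Section Cross.
Variable K : fieldType.
Implicit Types u v w : 'cV[K]_7.

Lemma crossC u v : cross u v = - cross v u.
Proof. by vec7; ring. Qed.

Lemma cross_cross u v : cross u (cross u v) = dot u v *: u - dot u u *: v.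
Proof. by vec7; ring. Qed.

Lemma dot_cross u v w : dot (cross u v) w = dot u (cross v w).
Proof. by rewrite !dot7 !cross_o; ring. Qed.

Lemma crossDl u v w : cross (u + v) w = cross u w + cross v w.
Proof. by have := cross_is_linear_l w 1 u v; rewrite !scale1r. Qed.
Lemma crossDr u v w : cross w (u + v) = cross w u + cross w v.
Proof. by have := cross_is_linear w 1 u v; rewrite !scale1r. Qed.
Lemma crossZl a u v : cross (a *: u) v = a *: cross u v.
Proof. by vec7; ring. Qed.
Lemma crossZr a u v : cross u (a *: v) = a *: cross u v.
Proof. by vec7; ring. Qed.
Lemma crossNl u v : cross (- u) v = - cross u v.
Proof. by vec7; ring. Qed.
Lemma crossNr u v : cross u (- v) = - cross u v.
Proof. by vec7; ring. Qed.
Lemma cross0l u : cross 0 u = 0.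
Proof. by vec7; ring. Qed.
Lemma cross0r u : cross u 0 = 0.
Proof. by vec7; ring. Qed.
Lemma crossxx u : cross u u = 0.
Proof. by vec7; ring. Qed.

Definition cross_lin := (crossDl, crossDr, crossNl, crossNr, crossZl, crossZr, cross0l, cross0r, crossxx).

Lemma cross_swap u v w : cross u (cross v w) =
  - cross v (cross u w) + dot u w *: v + dot v w *: u - (2%:R * dot u v) *: w.
Proof. by vec7; ring. Qed.

Lemma dot_cross0l u v : dot u (cross u v) = 0.
Proof. by rewrite -dot_cross crossxx dot0l. Qed.

Lemma dot_cross0r u v : dot v (cross u v) = 0.
Proof. by rewrite crossC dotNr dot_cross0l oppr0. Qed.

Lemma dot_cross2 u v w : dot (cross u v) (cross u w) = dot u u * dot v w - dot u v * dot u w.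
Proof.
rewrite crossC dotNl dot_cross cross_cross !dot_lin [dot v u]dotC.
by ring.
Qed.

Definition Lmx u : 'M[K]_7 := \matrix_(i, j) cross u (delta_mx j 0) i 0.

Lemma Lmx_mul u v : Lmx u *m v = cross u v.
Proof.
apply/colP=> k; rewrite {1}mxE.
under eq_bigr => j _ do rewrite mxE.
rewrite [in RHS](matrix_sum_delta v); under [in RHS]eq_bigr => j _ do rewrite big_ord1.
suff h (r : seq 'I_7) : cross u (\sum_(i <- r) v i 0 *: delta_mx i 0) k 0 =
    \sum_(i <- r) cross u (delta_mx i 0) k 0 * v i 0 by rewrite h.
elim: r => [|a r IH]; first by rewrite !big_nil cross0r mxE.
by rewrite !big_cons crossDr crossZr !mxentE IH mulrC.
Qed.

Lemma LmxE u i j : Lmx u i j = cross u (delta_mx j 0) i 0.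
Proof. by rewrite mxE. Qed.

Lemma Lmx_tr u : (Lmx u)^T = - Lmx u.
Proof.
apply: mx_cV_ext => v; apply/eqP; rewrite -subr_eq0; apply/eqP/dot_eq0 => w.
rewrite mulNmx opprK dotDr Lmx_mul -dot_mulmxl Lmx_mul [cross u w]crossC dotNl dot_cross.
by rewrite addNr.
Qed.

Lemma LmxD u v : Lmx (u + v) = Lmx u + Lmx v.
Proof. by apply: mx_cV_ext => w; rewrite mulmxDl !Lmx_mul crossDl. Qed.
Lemma LmxZ a u : Lmx (a *: u) = a *: Lmx u.
Proof. by apply: mx_cV_ext => w; rewrite -scalemxAl !Lmx_mul crossZl. Qed.

Lemma nvecD x y : nvec (x + y) = nvec x + nvec y :> 'cV[K]_7.
Proof. by vec7; ring. Qed.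
Lemma nvecZ a x : nvec (a *: x) = a *: nvec x :> 'cV[K]_7.
Proof. by vec7; ring. Qed.

Lemma nvec_wedge u v : nvec (wedge u v) = cross u v.
Proof.
apply/colP=> k; rewrite nvecE crossE wedgeE !mxentE.
have E a b (p q : 'cV[K]_7) : (p *m q^T) a b = p a 0 * q b 0.
  by rewrite mxE big_ord1 mxE.
by rewrite !E; ring.
Qed.

Lemma delta7 i j : (i < 7)%N -> (j < 7)%N ->
  (delta_mx (o7 i) 0 : 'cV[K]_7) (o7 j) 0 = (i == j)%:R.
Proof. by move=> hi hj; rewrite mxE eqxx andbT eq_sym o7_eq. Qed.

(** Each basis vector is the product of three pairs of basis vectors, whence the 3; its inverse is
    the constant in the projection to [g2 K]. *)
Lemma nvec_Lmx u : nvec (Lmx u) = - (3%:R *: u).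
Proof.
apply/colP; apply: ord7_ind; rewrite nvec_o !LmxE !cross_o !delta7 // !mxentE /=; ring.
Qed.

Lemma skew_entry (x : 'M[K]_7) i j : x^T = - x -> x i j = - x j i.
Proof. by move/matrixP/(_ j i); rewrite !mxE. Qed.

Hypothesis char0 : [pchar K] =i pred0.

(* A skew [x] fails to be a derivation only through [nvec x]: the obstruction is the one of [Lmx (nvec x)] *)
Lemma derivation_nvec (x : 'M[K]_7) u v : x^T = - x ->
  x *m cross u v - cross (x *m u) v - cross u (x *m v) =
  dot (nvec x) v *: u - dot (nvec x) u *: v - cross (nvec x) (cross u v).
Proof.
move=> xT.
have dg i : x i i = 0.
  have two := natr_neq0 char0 1.
  by have /eqP := skew_entry i i xT; rewrite -addr_eq0 -mulr2n -mulr_natl mulf_eq0 (negPf two) => /eqP.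
have e10 := skew_entry (o7 1) (o7 0) xT.
have e20 := skew_entry (o7 2) (o7 0) xT.
have e21 := skew_entry (o7 2) (o7 1) xT.
have e30 := skew_entry (o7 3) (o7 0) xT.
have e31 := skew_entry (o7 3) (o7 1) xT.
have e32 := skew_entry (o7 3) (o7 2) xT.
have e40 := skew_entry (o7 4) (o7 0) xT.
have e41 := skew_entry (o7 4) (o7 1) xT.
have e42 := skew_entry (o7 4) (o7 2) xT.
have e43 := skew_entry (o7 4) (o7 3) xT.
have e50 := skew_entry (o7 5) (o7 0) xT.
have e51 := skew_entry (o7 5) (o7 1) xT.
have e52 := skew_entry (o7 5) (o7 2) xT.
have e53 := skew_entry (o7 5) (o7 3) xT.
have e54 := skew_entry (o7 5) (o7 4) xT.
have e60 := skew_entry (o7 6) (o7 0) xT.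
have e61 := skew_entry (o7 6) (o7 1) xT.
have e62 := skew_entry (o7 6) (o7 2) xT.
have e63 := skew_entry (o7 6) (o7 3) xT.
have e64 := skew_entry (o7 6) (o7 4) xT.
have e65 := skew_entry (o7 6) (o7 5) xT.
vec7; rewrite ?(mulmx7, cross_o, dot7, nvec_o);
rewrite ?(e10, e20, e21, e30, e31, e32, e40, e41, e42, e43, e50, e51, e52, e53, e54);
rewrite ?(e60, e61, e62, e63, e64, e65, dg).
all: ring.
Qed.
End Cross.

Section G2Algebra.
Variable K : closedFieldType.
Hypothesis char0 : [pchar K] =i pred0.
Implicit Types u v w : 'cV[K]_7.

Let two : 2%:R != 0 :> K := natr_neq0 char0 1.
Let three : 3%:R != 0 :> K := natr_neq0 char0 2.

Definition bas i : 'cV[K]_7 := delta_mx (o7 i) 0.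

Lemma basE i j : (i < 7)%N -> (j < 7)%N -> bas i (o7 j) 0 = (i == j)%:R.
Proof. exact: delta7. Qed.

Lemma mem_g2E (x : 'M[K]_7) : x \in g2 K <-> x^T = - x /\ nvec x = 0.
Proof.
split=> [/mem_g2 [/mem_so xT D]|[xT nx]]; last first.
  apply/mem_g2; split; first exact/mem_so.
  move=> u v; have := derivation_nvec char0 u v xT.
  rewrite nx !dot0l cross0l !scale0r subr0 subr0 => /eqP.
  by rewrite -addrA -opprD subr_eq0 => /eqP.
split=> //; set n := nvec x.
have h u v k : dot n v * u k 0 - dot n u * v k 0 - cross n (cross u v) k 0 = 0.
  have := derivation_nvec char0 u v xT; rewrite D [_ + cross u _]addrC addrK subrr.
  by move/esym/matrixP/(_ k 0); rewrite !mxentE.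
(* In each case two basis vectors and an index different from both are chosen, so that only the
   double cross product contributes and its entry is, up to sign, one coordinate of [n]. *)
apply/colP; apply: ord7_ind; rewrite [RHS]mxE.
- rewrite -[RHS](h (bas 3) (bas 4) (o7 2)) !cross_o !dot7 !basE //=; ring.
- rewrite -[RHS](h (bas 4) (bas 5) (o7 3)) !cross_o !dot7 !basE //=; ring.
- rewrite -[RHS](h (bas 5) (bas 6) (o7 4)) !cross_o !dot7 !basE //=; ring.
- rewrite -[RHS](h (bas 6) (bas 0) (o7 5)) !cross_o !dot7 !basE //=; ring.
- rewrite -[RHS](h (bas 0) (bas 1) (o7 6)) !cross_o !dot7 !basE //=; ring.
- rewrite -[RHS](h (bas 1) (bas 2) (o7 0)) !cross_o !dot7 !basE //=; ring.
- rewrite -[RHS](h (bas 2) (bas 3) (o7 1)) !cross_o !dot7 !basE //=; ring.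
Qed.

Lemma g2_so : (g2 K <= so K 7)%VS.
Proof. by apply/subvP=> x /mem_g2 []. Qed.

Lemma tr_Lmx u (d : 'M[K]_7) : d^T = - d -> \tr (Lmx u *m d) = 2%:R * dot u (nvec d).
Proof.
move=> dT.
have dg i : d i i = 0.
  by have /eqP := skew_entry i i dT; rewrite -addr_eq0 -mulr2n -mulr_natl mulf_eq0 (negPf two) => /eqP.
have E i : (Lmx u *m d) i i = cross u (col i d) i 0.
  by rewrite -Lmx_mul -col_mulmx [RHS]mxE.
have C i j : (col i d) j 0 = d j i by rewrite mxE.
rewrite /mxtrace sum7 !E !cross_o !C dot7 !nvec_o ?dg.
rewrite (skew_entry (o7 1) (o7 0) dT) (skew_entry (o7 2) (o7 0) dT) (skew_entry (o7 2) (o7 1) dT).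
rewrite (skew_entry (o7 3) (o7 0) dT) (skew_entry (o7 3) (o7 1) dT) (skew_entry (o7 3) (o7 2) dT).
rewrite (skew_entry (o7 4) (o7 0) dT) (skew_entry (o7 4) (o7 1) dT) (skew_entry (o7 4) (o7 2) dT).
rewrite (skew_entry (o7 4) (o7 3) dT).
rewrite (skew_entry (o7 5) (o7 0) dT) (skew_entry (o7 5) (o7 1) dT) (skew_entry (o7 5) (o7 2) dT).
rewrite (skew_entry (o7 5) (o7 3) dT) (skew_entry (o7 5) (o7 4) dT).
rewrite (skew_entry (o7 6) (o7 0) dT) (skew_entry (o7 6) (o7 1) dT) (skew_entry (o7 6) (o7 2) dT).
rewrite (skew_entry (o7 6) (o7 3) dT) (skew_entry (o7 6) (o7 4) dT) (skew_entry (o7 6) (o7 5) dT).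
by ring.
Qed.

(* The projection to [g2 K] along its orthogonal complement, which is the space of the [Lmx u] *)
Definition gphi (x : 'M[K]_7) := x + 3%:R^-1 *: Lmx (nvec x).

Lemma gphi_g2 (x : 'M[K]_7) : x^T = - x -> gphi x \in g2 K.
Proof.
move=> xT; apply/mem_g2E; split.
  by rewrite /gphi [LHS]linearD linearZ /= Lmx_tr xT scalerN -opprD.
by rewrite nvecD nvecZ nvec_Lmx scalerN scalerA mulVf // scale1r subrr.
Qed.

Lemma Lmx_orth u : Lmx u \in killing_orth (so K 7) (g2 K).
Proof.
apply/(killing_orth_so char0) => //; first exact: g2_so.
split; first by apply/mem_so; exact: Lmx_tr.
by move=> y /mem_g2E [yT ny]; rewrite tr_Lmx // ny dot0r mulr0.
Qed.

Lemma gphi_orth (x : 'M[K]_7) : x - gphi x \in killing_orth (so K 7) (g2 K).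
Proof.
have -> : x - gphi x = Lmx (- 3%:R^-1 *: nvec x).
  by rewrite LmxZ scaleNr /gphi opprD addrA subrr sub0r.
exact: Lmx_orth.
Qed.

Lemma phi_gphi (x : 'M[K]_7) : x^T = - x -> killing_proj (so K 7) (g2 K) x = gphi x.
Proof.
move=> xT; apply: (killing_projE char0); rewrite ?g2_so ?gphi_g2 ?gphi_orth //.
by move=> z /mem_so zT; exists (gphi z); rewrite ?gphi_g2 ?gphi_orth.
Qed.

Lemma gphiD x y : gphi (x + y) = gphi x + gphi y.
Proof. by rewrite /gphi nvecD LmxD scalerDr addrACA. Qed.
Lemma gphiZ a x : gphi (a *: x) = a *: gphi x.
Proof. by rewrite /gphi nvecZ LmxZ scalerDr !scalerA [a * _]mulrC. Qed.

Definition crossmorph (g : 'M[K]_7) := forall u v, g *m cross u v = cross (g *m u) (g *m v).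

Lemma crossmorph_inv g : g^T *m g = 1%:M -> crossmorph g -> crossmorph g^T.
Proof.
move=> gg gm u v; have ug := orth_unit gg.
apply: (can_inj (mulKmx ug)); rewrite gm !mulmxA orth_r // !mul1mx.
by [].
Qed.

Lemma crossmorph_ext (g : 'M[K]_7) :
  (forall i u, (i < 7)%N -> g *m cross (bas i) u = cross (g *m bas i) (g *m u)) -> crossmorph g.
Proof.
move=> h u v; apply/eqP; rewrite -subr_eq0; apply/eqP; move: u.
apply: linear_col_eq0 => [a x y|i].
  rewrite crossDl crossZl !mulmxDr -!scalemxAr crossDl crossZl.
  by mxring.
by rewrite -[i]inord_val h ?subrr.
Qed.

Lemma Lmx_conj g u : g^T *m g = 1%:M -> crossmorph g -> g *m Lmx u *m g^T = Lmx (g *m u).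
Proof.
move=> gg gm; apply: mx_cV_ext => v; rewrite -!mulmxA Lmx_mul gm mulmxA orth_r // mul1mx.
by rewrite Lmx_mul.
Qed.

Lemma gphi_wedge_conj g u v : g^T *m g = 1%:M -> crossmorph g ->
  g *m gphi (wedge u v) *m g^T = gphi (wedge (g *m u) (g *m v)).
Proof.
move=> gg gm; rewrite /gphi !nvec_wedge mulmxDr mulmxDl wedge_conj -scalemxAr -scalemxAl.
by rewrite Lmx_conj // gm.
Qed.

Lemma g2_conj g x : g^T *m g = 1%:M -> crossmorph g -> x \in g2 K -> g *m x *m g^T \in g2 K.
Proof.
move=> gg gm /mem_g2 [/mem_so xT D]; have gm' := crossmorph_inv gg gm.
apply/mem_g2; split.
  by apply/mem_so; rewrite !trmx_mul trmxK xT mulNmx mulmxN mulmxA.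
move=> u v; rewrite -!mulmxA gm' D mulmxDr !gm !mulmxA orth_r // !mul1mx.
by [].
Qed.

End G2Algebra.

(** * Automorphisms of the cross product *)

Section Frame7.
Variable K : closedFieldType.
Hypothesis char0 : [pchar K] =i pred0.
Implicit Types (a b c u v w : 'cV[K]_7) (g : 'M[K]_7).

Let two : 2%:R != 0 :> K := natr_neq0 char0 1.

Local Notation bas := (bas K).

(* The images of the standard basis under the automorphism sending e_1, e_3, e_2 to a, b, c *)
Definition fvec a b c (j : 'I_7) : 'cV[K]_7 :=
  nth 0 [:: cross a b; a; c; b; cross a c; cross c b; cross (cross a b) c] j.

Definition fmx a b c : 'M[K]_7 := \matrix_(i, j) fvec a b c j i 0.

Lemma fvec_o a b c i : (i < 7)%N -> fvec a b c (o7 i) =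
  nth 0 [:: cross a b; a; c; b; cross a c; cross c b; cross (cross a b) c] i.
Proof. by move=> hi; rewrite /fvec /o7 inordK. Qed.

Lemma fmx_bas a b c j : fmx a b c *m delta_mx j 0 = fvec a b c j.
Proof. by rewrite -colE; apply/colP=> i; rewrite !mxE. Qed.

Lemma fmx_gram a b c i j : ((fmx a b c)^T *m fmx a b c) i j = dot (fvec a b c i) (fvec a b c j).
Proof.
rewrite -!fmx_bas dot_mulmxl mulmxA dot_delta.
by rewrite -colE [in RHS]mxE.
Qed.

Definition orth_triple a b c :=
  [/\ dot a b = 0, dot a c = 0, dot b c = 0 & dot (cross a b) c = 0].

Definition fnorm a b c (j : 'I_7) : K :=
  let A := dot a a in let B := dot b b in let C := dot c c in
  nth 0 [:: A * B; A; C; B; A * C; C * B; A * B * C] j.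

(** The norms stay arbitrary because the determinant argument applies this along a family in which
    they vary and may vanish. *)
Lemma fmx_gram_diag a b c : orth_triple a b c ->
  (fmx a b c)^T *m fmx a b c = diag_mx (\row_j fnorm a b c j).
Proof.
move=> [ab ac bc abc].
have ba : dot b a = 0 by rewrite dotC.
have ca : dot c a = 0 by rewrite dotC.
have cb : dot c b = 0 by rewrite dotC.
have cab : dot c (cross a b) = 0 by rewrite dotC.
have d01 : dot (cross a b) (a) = 0 by rewrite dotC dot_cross0l.
have d02 : dot (cross a b) (c) = 0 by exact: abc.
have d03 : dot (cross a b) (b) = 0 by rewrite dotC dot_cross0r.
have d04 : dot (cross a b) (cross a c) = 0 by rewrite dot_cross2 ab bc mulr0 mul0r subrr.
have d05 : dot (cross a b) (cross c b) = 0 by rewrite crossC [cross c b]crossC dotNl dotNr opprK dot_cross2 ac ba mulr0 mul0r subrr.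
have d06 : dot (cross a b) (cross (cross a b) c) = 0 by exact: dot_cross0l.
have d12 : dot (a) (c) = 0 by exact: ac.
have d13 : dot (a) (b) = 0 by exact: ab.
have d14 : dot (a) (cross a c) = 0 by exact: dot_cross0l.
have d15 : dot (a) (cross c b) = 0 by rewrite crossC dotNr -dot_cross abc oppr0.
have d16 : dot (a) (cross (cross a b) c) = 0 by rewrite -dot_cross cross_cross !dot_lin ac bc !mulr0 oppr0 addr0.
have d23 : dot (c) (b) = 0 by exact: cb.
have d24 : dot (c) (cross a c) = 0 by exact: dot_cross0r.
have d25 : dot (c) (cross c b) = 0 by exact: dot_cross0l.
have d26 : dot (c) (cross (cross a b) c) = 0 by exact: dot_cross0r.
have d34 : dot (b) (cross a c) = 0 by rewrite -dot_cross crossC dotNl abc oppr0.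
have d35 : dot (b) (cross c b) = 0 by exact: dot_cross0r.
have d36 : dot (b) (cross (cross a b) c) = 0 by rewrite -dot_cross [cross a b]crossC crossNr cross_cross !dot_lin ac bc !mulr0 oppr0 addr0 oppr0.
have d45 : dot (cross a c) (cross c b) = 0 by rewrite crossC dotNl dot_cross2 ca ab mulr0 mul0r subrr oppr0.
have d46 : dot (cross a c) (cross (cross a b) c) = 0 by rewrite crossC [cross (cross a b) c]crossC dotNl dotNr opprK dot_cross2 dot_cross0l ca mulr0 mul0r subrr.
have d56 : dot (cross c b) (cross (cross a b) c) = 0 by rewrite [cross (cross a b) c]crossC dotNr dot_cross2 dot_cross0r cb mulr0 mul0r subrr oppr0.
have n0 : dot (cross a b) (cross a b) = dot a a * dot b b by rewrite dot_cross2 ab mul0r subr0.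
have n4 : dot (cross a c) (cross a c) = dot a a * dot c c by rewrite dot_cross2 ac mul0r subr0.
have n5 : dot (cross c b) (cross c b) = dot c c * dot b b by rewrite dot_cross2 cb mul0r subr0.
have n6 : dot (cross (cross a b) c) (cross (cross a b) c) = dot a a * dot b b * dot c c.
  by rewrite dot_cross2 abc mul0r subr0 n0.
have sym (S T : 'M[K]_7) : S^T = S -> T^T = T ->
    (forall p q, (p <= q < 7)%N -> S (o7 p) (o7 q) = T (o7 p) (o7 q)) -> S = T.
  move=> ST TT h; apply/matrixP=> i j; rewrite -[i]inord_val -[j]inord_val.
  case: (leqP i j) => ij; first by apply: h; rewrite ij ltn_ord.
  rewrite -ST -TT !mxE; apply: h; by rewrite (ltnW ij) ltn_ord.
apply: sym; first by rewrite trmx_mul trmxK.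
  by rewrite tr_diag_mx.
move=> p q /andP [pq q7]; have p7 : (p < 7)%N by exact: leq_ltn_trans q7.
rewrite fmx_gram !fvec_o // !mxE o7_eq // /fnorm /o7 inordK //.
move: pq q7; case: p {p7} => [|[|[|[|[|[|[|p]]]]]]]; case: q => [|[|[|[|[|[|[|q]]]]]]] //= _ _;
by rewrite ?mulr1n ?mulr0n.
Qed.

Ltac std_cross := apply/colP; apply: ord7_ind; rewrite cross_o ?mxentE !basE //=; ring.

Lemma cross_bas10 : cross (bas 1) (bas 0) = - bas 3.
Proof. by std_cross. Qed.
Lemma cross_bas11 : cross (bas 1) (bas 1) = 0.
Proof. by std_cross. Qed.
Lemma cross_bas12 : cross (bas 1) (bas 2) = bas 4.
Proof. by std_cross. Qed.
Lemma cross_bas13 : cross (bas 1) (bas 3) = bas 0.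
Proof. by std_cross. Qed.
Lemma cross_bas14 : cross (bas 1) (bas 4) = - bas 2.
Proof. by std_cross. Qed.
Lemma cross_bas15 : cross (bas 1) (bas 5) = bas 6.
Proof. by std_cross. Qed.
Lemma cross_bas16 : cross (bas 1) (bas 6) = - bas 5.
Proof. by std_cross. Qed.
Lemma cross_bas30 : cross (bas 3) (bas 0) = bas 1.
Proof. by std_cross. Qed.
Lemma cross_bas31 : cross (bas 3) (bas 1) = - bas 0.
Proof. by std_cross. Qed.
Lemma cross_bas32 : cross (bas 3) (bas 2) = - bas 5.
Proof. by std_cross. Qed.
Lemma cross_bas33 : cross (bas 3) (bas 3) = 0.
Proof. by std_cross. Qed.
Lemma cross_bas34 : cross (bas 3) (bas 4) = bas 6.
Proof. by std_cross. Qed.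
Lemma cross_bas35 : cross (bas 3) (bas 5) = bas 2.
Proof. by std_cross. Qed.
Lemma cross_bas36 : cross (bas 3) (bas 6) = - bas 4.
Proof. by std_cross. Qed.
Lemma cross_bas20 : cross (bas 2) (bas 0) = - bas 6.
Proof. by std_cross. Qed.
Lemma cross_bas21 : cross (bas 2) (bas 1) = - bas 4.
Proof. by std_cross. Qed.
Lemma cross_bas22 : cross (bas 2) (bas 2) = 0.
Proof. by std_cross. Qed.
Lemma cross_bas23 : cross (bas 2) (bas 3) = bas 5.
Proof. by std_cross. Qed.
Lemma cross_bas24 : cross (bas 2) (bas 4) = bas 1.
Proof. by std_cross. Qed.
Lemma cross_bas25 : cross (bas 2) (bas 5) = - bas 3.
Proof. by std_cross. Qed.
Lemma cross_bas26 : cross (bas 2) (bas 6) = bas 0.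
Proof. by std_cross. Qed.
Lemma cross_bas02 : cross (bas 0) (bas 2) = bas 6.
Proof. by std_cross. Qed.
Definition cross_basE := (cross_bas10, cross_bas11, cross_bas12, cross_bas13, cross_bas14, cross_bas15, cross_bas16, cross_bas30, cross_bas31, cross_bas32, cross_bas33, cross_bas34, cross_bas35, cross_bas36, cross_bas20, cross_bas21, cross_bas22, cross_bas23, cross_bas24, cross_bas25, cross_bas26, cross_bas02).

(** The vectors [u] for which [g] respects every product with [u] are closed under the cross
    product: [cross (cross p q) r] can be rewritten through products by [p] and by [q] on the left.
    So only the generators e_1, e_3, e_2 are compared with the basis. *)
Lemma fmx_crossmorph a b c : orth_triple a b c -> dot a a = 1 -> dot b b = 1 -> dot c c = 1 ->
  (fmx a b c)^T *m fmx a b c = 1%:M /\ crossmorph (fmx a b c).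
Proof.
move=> tr aa bb cc; have [ab ac bc abc] := tr.
have ba : dot b a = 0 by rewrite dotC.
have ca : dot c a = 0 by rewrite dotC.
have cb : dot c b = 0 by rewrite dotC.
set g := fmx a b c.
have gg : g^T *m g = 1%:M.
  rewrite fmx_gram_diag // -diag_const_mx; congr diag_mx; apply/rowP; apply: ord7_ind;
  by rewrite !mxE /fnorm /o7 inordK //= ?aa ?bb ?cc ?mulr1.
split=> //.
have gm_orth u v : dot (g *m u) (g *m v) = dot u v by exact: dot_orth.
have gb i : (i < 7)%N -> g *m bas i =
    nth 0 [:: cross a b; a; c; b; cross a c; cross c b; cross (cross a b) c] i.
  by move=> hi; rewrite /g fmx_bas fvec_o.
pose P u := forall v, g *m cross u v = cross (g *m u) (g *m v).
have Pgen u : (forall j, (j < 7)%N -> g *m cross u (bas j) = cross (g *m u) (g *m bas j)) -> P u.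
  move=> h v; apply/eqP; rewrite -subr_eq0; apply/eqP; move: v.
  apply: linear_col_eq0 => [k x y|i].
    by rewrite crossDr crossZr !mulmxDr -!scalemxAr crossDr crossZr; mxring.
  by rewrite -[i]inord_val h ?subrr.
have Pcross u w : P u -> P w -> P (cross u w).
  move=> Pu Pw v; have E p q r : cross (cross p q) r =
      - cross p (cross q r) - dot r q *: p - dot p q *: r + (2%:R * dot r p) *: q.
    rewrite crossC cross_swap [cross r q]crossC crossNr !opprD !opprK.
    by mxring.
  rewrite E Pu E !(mulmxDr, mulmxN, =^~ scalemxAr) Pu Pw.
  by rewrite !gm_orth.
have g0 := gb 0 isT; have g1 := gb 1 isT; have g2 := gb 2 isT; have g3 := gb 3 isT.
have g4 := gb 4 isT; have g5 := gb 5 isT; have g6 := gb 6 isT.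
rewrite /= in g0 g1 g2 g3 g4 g5 g6.
have aab : cross a (cross a b) = - b by rewrite cross_cross ab aa scale0r sub0r scale1r.
have aac : cross a (cross a c) = - c by rewrite cross_cross ac aa scale0r sub0r scale1r.
have bba : cross b (cross b a) = - a by rewrite cross_cross ba bb scale0r sub0r scale1r.
have bbc : cross b (cross b c) = - c by rewrite cross_cross bc bb scale0r sub0r scale1r.
have cca : cross c (cross c a) = - a by rewrite cross_cross ca cc scale0r sub0r scale1r.
have ccb : cross c (cross c b) = - b by rewrite cross_cross cb cc scale0r sub0r scale1r.
have ccab : cross c (cross c (cross a b)) = - cross a b.
  by rewrite cross_cross cc [dot c _]dotC abc scale0r sub0r scale1r.
have f6a : cross (cross a b) c = cross a (cross c b).
  rewrite crossC cross_swap cb ca ab mulr0 !scale0r subr0 !addr0 opprK.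
  by [].
have f6b : cross (cross a b) c = cross b (cross a c).
  rewrite f6a [cross c b]crossC crossNr cross_swap ac ab bc mulr0 !scale0r subr0 !addr0 opprK.
  by [].
have P1 : P (bas 1).
  apply: Pgen => [[|[|[|[|[|[|[|j]]]]]]]] //= _; rewrite !cross_basE ?mulmxN ?mulmx0 ?g0 ?g1 ?g2 ?g3 ?g4 ?g5 ?g6.
  - by rewrite aab.
  - by rewrite crossxx.
  - by [].
  - by [].
  - by rewrite aac.
  - by [].
  by rewrite f6a cross_cross -dot_cross ?aa; rewrite dot_cross [cross c b]crossC dotNr -dot_cross abc oppr0 scale0r sub0r scale1r.
have P3 : P (bas 3).
  apply: Pgen => [[|[|[|[|[|[|[|j]]]]]]]] //= _; rewrite !cross_basE ?mulmxN ?mulmx0 ?g0 ?g1 ?g2 ?g3 ?g4 ?g5 ?g6.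
  - by rewrite [cross a b]crossC crossNr bba opprK.
  - by rewrite [cross b a]crossC.
  - by rewrite [cross b c]crossC.
  - by rewrite crossxx.
  - by rewrite f6b.
  - by rewrite [cross c b]crossC crossNr bbc opprK.
  by rewrite f6b cross_cross -dot_cross [cross b a]crossC dotNl abc oppr0 scale0r sub0r bb scale1r.
have P2 : P (bas 2).
  apply: Pgen => [[|[|[|[|[|[|[|j]]]]]]]] //= _; rewrite !cross_basE ?mulmxN ?mulmx0 ?g0 ?g1 ?g2 ?g3 ?g4 ?g5 ?g6.
  - by rewrite [RHS]crossC.
  - by rewrite [RHS]crossC.
  - by rewrite crossxx.
  - by [].
  - by rewrite [cross a c]crossC crossNr cca opprK.
  - by rewrite ccb.
  by rewrite [cross (cross a b) c]crossC crossNr ccab opprK.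
have P0 : P (bas 0) by rewrite -cross_bas13; exact: Pcross.
have P4 : P (bas 4) by rewrite -cross_bas12; exact: Pcross.
have P5 : P (bas 5) by rewrite -cross_bas23; exact: Pcross.
have P6 : P (bas 6) by rewrite -cross_bas02; exact: Pcross.
by apply: crossmorph_ext => [[|[|[|[|[|[|[|i]]]]]]]] u.
Qed.

Lemma polycurve_cross (X Y : K -> 'cV[K]_7) : polycurve X -> polycurve Y ->
  polycurve (fun t => cross (X t) (Y t)).
Proof.
move=> pX pY k j; rewrite ord1.
apply: polyfun_ext (fun t => esym (crossE _ _ _)) _.
by do !apply: polyfunD; try apply: polyfunN; apply: polyfunM.
Qed.

(** Gram-Schmidt with cleared denominators, so that the results stay polynomial along a curve; [gsc]
    also removes the component along [cross a b]. *)
Definition gsb a b := dot a a *: b - dot a b *: a.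
Definition gsc a b c := (dot a a * dot b b) *: c - (dot b b * dot a c) *: a
  - (dot a a * dot b c) *: b - dot (cross a b) c *: cross a b.

Lemma gs_triple a b c : let b' := gsb a b in orth_triple a b' (gsc a b' c).
Proof.
have ab : dot a (gsb a b) = 0 by rewrite !dot_lin; ring.
move: (gsb a b) ab => b' ab; rewrite /=.
have ba : dot b' a = 0 by rewrite dotC.
have aab : dot a (cross a b') = 0 by exact: dot_cross0l.
have bab : dot b' (cross a b') = 0 by exact: dot_cross0r.
have aba : dot (cross a b') a = 0 by rewrite dotC.
have abb : dot (cross a b') b' = 0 by rewrite dotC.
have nn : dot (cross a b') (cross a b') = dot a a * dot b' b'.
  by rewrite dot_cross2 ab mul0r subr0.
split=> //; rewrite /gsc !dot_lin ?ab ?ba ?aab ?bab ?aba ?abb ?nn; ring.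
Qed.

(** Each of the three norms occurs in four of the seven diagonal entries of the Gram matrix, so its
    determinant is a fourth power; hence the determinant of [fmx] is, up to sign, a polynomial in
    the norms. *)
Lemma fmx_det a b c : orth_triple a b c ->
  \det (fmx a b c) ^+ 2 = ((dot a a * dot b b * dot c c) ^+ 2) ^+ 2.
Proof.
move=> tr; rewrite expr2 -{1}det_tr -det_mulmx fmx_gram_diag // det_diag.
have -> : \prod_i (\row_j fnorm a b c j) 0 i = \prod_(i < 7) fnorm a b c (inord i).
  by apply: eq_bigr => i _; rewrite mxE inord_val.
rewrite !big_ord_recl big_ord0 /fnorm /= !inordK //=.
by ring.
Qed.

Lemma fmx_std : fmx (bas 1) (bas 3) (bas 2) = 1%:M.
Proof.
have h j : fvec (bas 1) (bas 3) (bas 2) j = delta_mx j 0.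
  by move: j; apply: ord7_ind; rewrite fvec_o //= !cross_basE.
by apply/matrixP=> i j; rewrite mxE h !mxE eqxx andbT.
Qed.

Lemma crossmorph_fmx g : crossmorph g -> g = fmx (g *m bas 1) (g *m bas 3) (g *m bas 2).
Proof.
move=> gm; have h j : fvec (g *m bas 1) (g *m bas 3) (g *m bas 2) j = g *m delta_mx j 0.
  by move: j; apply: ord7_ind; rewrite fvec_o //= -?gm ?cross_basE // -gm.
by apply/matrixP=> i j; rewrite [RHS]mxE h -colE mxE.
Qed.

Lemma polycurve_fmx (X Y Z : K -> 'cV[K]_7) : polycurve X -> polycurve Y -> polycurve Z ->
  polycurve (fun t => fmx (X t) (Y t) (Z t)).
Proof.
move=> pX pY pZ i j.
apply: (@polyfun_ext _ (fun t => fvec (X t) (Y t) (Z t) j i 0)) => [t|]; first by rewrite mxE.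
move: j; apply: ord7_ind; rewrite /fvec /o7 inordK //=.
- exact: (polycurve_cross pX pY i 0).
- exact: (polycurve_cross pX pZ i 0).
- exact: (polycurve_cross pZ pY i 0).
exact: (polycurve_cross (polycurve_cross pX pY) pZ i 0).
Qed.

Lemma dot_bas i j : (i < 7)%N -> (j < 7)%N -> dot (bas i) (bas j) = (i == j)%:R.
Proof. by move=> hi hj; rewrite dot_delta (basE K hj hi) eq_sym. Qed.

(* Joining the given frame to the standard one by a segment and orthogonalising, both sides of [fmx_det]
   are polynomials on the segment with equal squares, so the sign between them is constant. *)
Lemma crossmorph_det g : g^T *m g = 1%:M -> crossmorph g -> \det g = 1.
Proof.
move=> gg gm; pose L i t := (1 - t) *: bas i + t *: (g *m bas i).
have pL i : polycurve (L i).
  apply: polycurveD; apply: polycurveZ; try exact: polycurve_cst; last exact: polyfun_id.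
  by apply: polyfunB; [exact: polyfun_cst|exact: polyfun_id].
pose b t := gsb (L 1 t) (L 3 t); pose c t := gsc (L 1 t) (b t) (L 2 t).
have pb : polycurve b.
  by apply: polycurveD; [|apply: polycurveN]; apply: polycurveZ => //; exact: polyfun_dot.
have pc : polycurve c.
  have pab := polycurve_cross (pL 1) pb.
  have pd (X Y : K -> 'cV[K]_7) : polycurve X -> polycurve Y -> polyfun (fun t => dot (X t) (Y t)).
    exact: polyfun_dot.
  have pB (X Y : K -> 'cV[K]_7) : polycurve X -> polycurve Y -> polycurve (fun t => X t - Y t).
    by move=> pX pY; apply: polycurveD => //; exact: polycurveN.
  by apply: (pB); [apply: (pB); [apply: (pB)|]|]; apply: polycurveZ => //;
    [apply: polyfunM|apply: polyfunM|apply: polyfunM|]; exact: (pd).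
pose F t := \det (fmx (L 1 t) (b t) (c t)).
pose G t := (dot (L 1 t) (L 1 t) * dot (b t) (b t) * dot (c t) (c t)) ^+ 2.
have pF : polyfun F by apply: polyfun_det; exact: polycurve_fmx.
have pG : polyfun G by apply: polyfunX; do 2?apply: polyfunM; exact: polyfun_dot.
have FG t : (F t - G t) * (F t + G t) = 0.
  by rewrite -subr_sqr /F (fmx_det (gs_triple _ _ _)) subrr.
have gd i j : (i < 7)%N -> (j < 7)%N -> dot (g *m bas i) (g *m bas j) = (i == j)%:R.
  by move=> hi hj; rewrite dot_orth // dot_bas.
have ends t (f : nat -> 'cV[K]_7) : (forall i, L i t = f i) ->
    (forall i j, (i < 7)%N -> (j < 7)%N -> dot (f i) (f j) = (i == j)%:R) ->
    dot (cross (f 1%N) (f 3%N)) (f 2%N) = 0 ->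
    G t = 1 /\ F t = \det (fmx (f 1%N) (f 3%N) (f 2%N)).
  move=> Lf fd f0.
  have bE : b t = f 3%N by rewrite /b !Lf /gsb !fd //= scale1r scale0r subr0.
  have cE : c t = f 2%N.
    by rewrite /c bE !Lf /gsc !fd //= f0 !mulr0 !mulr1 !scale0r !subr0 scale1r.
  by rewrite /G /F bE cE !Lf !fd //= !mulr1 expr1n.
have [G0 F0] : G 0 = 1 /\ F 0 = \det (fmx (bas 1) (bas 3) (bas 2)).
  apply: ends => [i||]; [by rewrite /L subr0 scale1r scale0r addr0|exact: dot_bas|].
  by rewrite cross_bas13 dot_bas.
have [G1 F1] : G 1 = 1 /\ F 1 = \det (fmx (g *m bas 1) (g *m bas 3) (g *m bas 2)).
  apply: (ends 1 (fun i => g *m bas i)) => [i||]; [by rewrite /L subrr scale1r scale0r add0r|exact: gd|].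
  by rewrite -gm cross_bas13 gd.
rewrite -crossmorph_fmx // in F1; rewrite fmx_std det1 in F0.
have [h|h] := polyfun_mul0 char0 (polyfunB pF pG) (polyfunD pF pG) FG.
  by move: (h 1); rewrite F1 G1 => /eqP; rewrite subr_eq0 => /eqP.
by move: (h 0) => /eqP; rewrite F0 G0 -mulr2n (negPf two).
Qed.

Lemma G2P g : G2 K g <-> g^T *m g = 1%:M /\ crossmorph g.
Proof.
split=> [[[gg _] gm]|[gg gm]]; first by split.
by split; [split=> //; exact: crossmorph_det|].
Qed.

Lemma mxgroup_G2 : mxgroup (G2 K).
Proof.
split.
- by apply/G2P; split=> [|u v]; rewrite ?trmx1 ?mulmx1 ?mul1mx.
- by move=> g /G2P [/orth_unit].
- move=> g h /G2P [gg gm] /G2P [hh hm]; apply/G2P; split; first exact: orth_mul.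
  by move=> u v; rewrite -mulmxA hm gm !mulmxA.
move=> g /G2P [gg gm]; rewrite orth_inv //; apply/G2P; split; first exact: orth_tr.
exact: crossmorph_inv.
Qed.

Lemma separate u v : (forall l, u != l *: v) -> exists w, dot w u = 1 /\ dot w v = 0.
Proof.
move=> uv; have [v0|v0] := eqVneq v 0.
  have u0 : u != 0 by have := uv 0; rewrite scale0r.
  by have [w uw] := dot_ex1 u0; exists w; rewrite dotC uw v0 dot0r.
have [f vf] := dot_ex1 v0; pose u' := u - dot f u *: v.
have u'0 : u' != 0 by rewrite subr_eq0.
have [h uh] := dot_ex1 u'0; exists (h - dot h v *: f).
have hE : dot h u - dot f u * dot h v = 1 by rewrite -uh [RHS]dotC !dot_lin.
split; rewrite !dot_lin; first by rewrite -hE; ring.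
by rewrite [dot f v]dotC vf mulr1 subrr.
Qed.

Section NullVectors.
Variable i : K.
Hypothesis ii : i * i = -1.

Definition X1 := bas 1 - i *: bas 3.

(** Write [p = a - i b] with [a], [b], [c] orthonormal; the automorphism attached to this triple
    sends e_1, e_3, e_2 to it. The condition [(cross a b, c) = 0] becomes that [a] is orthogonal to
    [cross p c], which is compatible with [(a, p) = 1] exactly because [p] is not a multiple of
    [cross p c]. *)
Lemma G2_transitive p c : dot p p = 0 -> dot c c = 1 -> dot p c = 0 ->
  (forall l, cross p c != l *: p) -> exists2 g, G2 K g & g *m X1 = p /\ g *m bas 2 = c.
Proof.
move=> pp cc pc; set r := cross p c => rp.
have p0 : p != 0.
  by apply/eqP=> p0; have := rp 0; rewrite /r p0 cross0l scaler0 eqxx.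
have pr l : p != l *: r.
  apply/eqP=> pE; have l0 : l != 0.
    by apply: contraNneq p0 => l0; rewrite pE l0 scale0r.
  by have := rp l^-1; rewrite pE scalerA mulVf // scale1r eqxx.
have [a1 [ap ar]] := separate pr.
have pr0 : dot p r = 0 by exact: dot_cross0l.
have cr0 : dot c r = 0 by exact: dot_cross0r.
have cp : dot c p = 0 by rewrite dotC.
pose a0 := a1 - dot a1 c *: c.
have a0p : dot a0 p = 1 by rewrite !dot_lin cp ap mulr0 subr0.
have a0r : dot a0 r = 0 by rewrite !dot_lin cr0 ar mulr0 subr0.
have a0c : dot a0 c = 0 by rewrite !dot_lin cc mulr1 subrr.
move: a0 a0p a0r a0c => {a1 ap ar} a0 a0p a0r a0c.
(* Adding a multiple of the isotropic [p] changes the norm of [a0] linearly, as [(a0, p) = 1], and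
   keeps the other conditions. *)
pose a := a0 + (2%:R^-1 * (1 - dot a0 a0)) *: p.
have aa : dot a a = 1.
  rewrite !dot_lin a0p [dot p a0]dotC a0p pp.
  by field.
have ap : dot a p = 1 by rewrite !dot_lin a0p pp mulr0 addr0.
have ar : dot a r = 0 by rewrite !dot_lin a0r pr0 mulr0 addr0.
have ac : dot a c = 0 by rewrite !dot_lin a0c pc mulr0 addr0.
move: a aa ap ar ac => {a0 a0p a0r a0c} a aa ap ar ac.
pose b := i *: (p - a).
have bb : dot b b = 1.
  by rewrite !dot_lin pp aa ap [dot p a]dotC ap; ring: ii.
have ab : dot a b = 0 by rewrite !dot_lin ap aa subrr mulr0.
have bc : dot b c = 0 by rewrite !dot_lin pc ac subrr mulr0.
have abc : dot (cross a b) c = 0.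
  by rewrite /b crossZr crossDr crossNr crossxx subr0 dotZl dot_cross -/r ar mulr0.
have [gg gm] : (fmx a b c)^T *m fmx a b c = 1%:M /\ crossmorph (fmx a b c).
  by apply: fmx_crossmorph => //; split.
exists (fmx a b c); first exact/G2P.
rewrite /X1 mulmxBr -scalemxAr !fmx_bas !fvec_o //=; split=> //.
by rewrite /b scalerA ii scaleN1r opprK addrC subrK.
Qed.

End NullVectors.
End Frame7.

(** * Nilpotent elements of g2 *)

(* Index 0 is the unit vector z, indices 1-3 are null vectors x_j and 4-6 the dual null vectors y_j:
   (x_j, y_j) = 2, x_1 x_2 = 2 y_3 and y_1 y_2 = 2 x_3 cyclically, x_j y_j = 2 i z *)
HB.lock Definition nullvec (K : closedFieldType) (i : K) (j : nat) : 'cV[K]_7 :=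
  nth 0 [:: bas K 0; bas K 1 - i *: bas K 3; bas K 2 - i *: bas K 6; bas K 4 - i *: bas K 5;
    bas K 1 + i *: bas K 3; bas K 2 + i *: bas K 6; bas K 4 + i *: bas K 5] j.

Section NullBasis.
Variable K : closedFieldType.
Hypothesis char0 : [pchar K] =i pred0.
Variable i : K.
Hypothesis ii : i * i = -1.
Implicit Types (u v w p q : 'cV[K]_7) (g x : 'M[K]_7).

Let two : 2%:R != 0 :> K := natr_neq0 char0 1.

Local Notation bas := (bas K).

Local Notation nz := (nullvec i 0).
Local Notation nx1 := (nullvec i 1).
Local Notation nx2 := (nullvec i 2).
Local Notation nx3 := (nullvec i 3).
Local Notation ny1 := (nullvec i 4).
Local Notation ny2 := (nullvec i 5).
Local Notation ny3 := (nullvec i 6).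


Lemma nx1_entry j : (j < 7)%N -> nx1 (o7 j) 0 = (1%N == j)%:R - i * (3%N == j)%:R.
Proof. by move=> hj; rewrite nullvec.unlock /= ?mxentE ?basE. Qed.
Lemma nx2_entry j : (j < 7)%N -> nx2 (o7 j) 0 = (2%N == j)%:R - i * (6%N == j)%:R.
Proof. by move=> hj; rewrite nullvec.unlock /= ?mxentE ?basE. Qed.
Lemma nx3_entry j : (j < 7)%N -> nx3 (o7 j) 0 = (4%N == j)%:R - i * (5%N == j)%:R.
Proof. by move=> hj; rewrite nullvec.unlock /= ?mxentE ?basE. Qed.
Lemma ny1_entry j : (j < 7)%N -> ny1 (o7 j) 0 = (1%N == j)%:R + i * (3%N == j)%:R.
Proof. by move=> hj; rewrite nullvec.unlock /= ?mxentE ?basE. Qed.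
Lemma ny2_entry j : (j < 7)%N -> ny2 (o7 j) 0 = (2%N == j)%:R + i * (6%N == j)%:R.
Proof. by move=> hj; rewrite nullvec.unlock /= ?mxentE ?basE. Qed.
Lemma ny3_entry j : (j < 7)%N -> ny3 (o7 j) 0 = (4%N == j)%:R + i * (5%N == j)%:R.
Proof. by move=> hj; rewrite nullvec.unlock /= ?mxentE ?basE. Qed.
Lemma nz_entry j : (j < 7)%N -> nz (o7 j) 0 = (0%N == j)%:R.
Proof. by move=> hj; rewrite nullvec.unlock /= ?mxentE ?basE. Qed.
Definition null_entry := (nx1_entry, nx2_entry, nx3_entry, ny1_entry, ny2_entry, ny3_entry, nz_entry).

Ltac null_cross := apply/colP; apply: ord7_ind; rewrite cross_o ?mxentE !null_entry //=; ring: ii.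
Ltac null_dot := rewrite dot7 !null_entry //=; ring: ii.

Lemma cr_x1x2 : cross nx1 nx2 = 2%:R *: ny3.
Proof. by null_cross. Qed.
Lemma cr_x2x1 : cross nx2 nx1 = (- 2%:R) *: ny3.
Proof. by rewrite crossC cr_x1x2 -?scaleNr ?opprK ?oppr0. Qed.
Lemma cr_x1x3 : cross nx1 nx3 = (- 2%:R) *: ny2.
Proof. by null_cross. Qed.
Lemma cr_x3x1 : cross nx3 nx1 = 2%:R *: ny2.
Proof. by rewrite crossC cr_x1x3 -?scaleNr ?opprK ?oppr0. Qed.
Lemma cr_x1y1 : cross nx1 ny1 = (2%:R * i) *: nz.
Proof. by null_cross. Qed.
Lemma cr_y1x1 : cross ny1 nx1 = (- (2%:R * i)) *: nz.
Proof. by rewrite crossC cr_x1y1 -?scaleNr ?opprK ?oppr0. Qed.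
Lemma cr_x1y2 : cross nx1 ny2 = 0.
Proof. by null_cross. Qed.
Lemma cr_y2x1 : cross ny2 nx1 = 0.
Proof. by rewrite crossC cr_x1y2 -?scaleNr ?opprK ?oppr0. Qed.
Lemma cr_x1y3 : cross nx1 ny3 = 0.
Proof. by null_cross. Qed.
Lemma cr_y3x1 : cross ny3 nx1 = 0.
Proof. by rewrite crossC cr_x1y3 -?scaleNr ?opprK ?oppr0. Qed.
Lemma cr_x1z : cross nx1 nz = (- i) *: nx1.
Proof. by null_cross. Qed.
Lemma cr_zx1 : cross nz nx1 = i *: nx1.
Proof. by rewrite crossC cr_x1z -?scaleNr ?opprK ?oppr0. Qed.
Lemma cr_x2x3 : cross nx2 nx3 = 2%:R *: ny1.
Proof. by null_cross. Qed.
Lemma cr_x3x2 : cross nx3 nx2 = (- 2%:R) *: ny1.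
Proof. by rewrite crossC cr_x2x3 -?scaleNr ?opprK ?oppr0. Qed.
Lemma cr_x2y1 : cross nx2 ny1 = 0.
Proof. by null_cross. Qed.
Lemma cr_y1x2 : cross ny1 nx2 = 0.
Proof. by rewrite crossC cr_x2y1 -?scaleNr ?opprK ?oppr0. Qed.
Lemma cr_x2y2 : cross nx2 ny2 = (2%:R * i) *: nz.
Proof. by null_cross. Qed.
Lemma cr_y2x2 : cross ny2 nx2 = (- (2%:R * i)) *: nz.
Proof. by rewrite crossC cr_x2y2 -?scaleNr ?opprK ?oppr0. Qed.
Lemma cr_x2y3 : cross nx2 ny3 = 0.
Proof. by null_cross. Qed.
Lemma cr_y3x2 : cross ny3 nx2 = 0.
Proof. by rewrite crossC cr_x2y3 -?scaleNr ?opprK ?oppr0. Qed.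
Lemma cr_x2z : cross nx2 nz = (- i) *: nx2.
Proof. by null_cross. Qed.
Lemma cr_zx2 : cross nz nx2 = i *: nx2.
Proof. by rewrite crossC cr_x2z -?scaleNr ?opprK ?oppr0. Qed.
Lemma cr_x3y1 : cross nx3 ny1 = 0.
Proof. by null_cross. Qed.
Lemma cr_y1x3 : cross ny1 nx3 = 0.
Proof. by rewrite crossC cr_x3y1 -?scaleNr ?opprK ?oppr0. Qed.
Lemma cr_x3y2 : cross nx3 ny2 = 0.
Proof. by null_cross. Qed.
Lemma cr_y2x3 : cross ny2 nx3 = 0.
Proof. by rewrite crossC cr_x3y2 -?scaleNr ?opprK ?oppr0. Qed.
Lemma cr_x3y3 : cross nx3 ny3 = (2%:R * i) *: nz.
Proof. by null_cross. Qed.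
Lemma cr_y3x3 : cross ny3 nx3 = (- (2%:R * i)) *: nz.
Proof. by rewrite crossC cr_x3y3 -?scaleNr ?opprK ?oppr0. Qed.
Lemma cr_x3z : cross nx3 nz = (- i) *: nx3.
Proof. by null_cross. Qed.
Lemma cr_zx3 : cross nz nx3 = i *: nx3.
Proof. by rewrite crossC cr_x3z -?scaleNr ?opprK ?oppr0. Qed.
Lemma cr_y1y2 : cross ny1 ny2 = 2%:R *: nx3.
Proof. by null_cross. Qed.
Lemma cr_y2y1 : cross ny2 ny1 = (- 2%:R) *: nx3.
Proof. by rewrite crossC cr_y1y2 -?scaleNr ?opprK ?oppr0. Qed.
Lemma cr_y1y3 : cross ny1 ny3 = (- 2%:R) *: nx2.
Proof. by null_cross. Qed.
Lemma cr_y3y1 : cross ny3 ny1 = 2%:R *: nx2.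
Proof. by rewrite crossC cr_y1y3 -?scaleNr ?opprK ?oppr0. Qed.
Lemma cr_y1z : cross ny1 nz = i *: ny1.
Proof. by null_cross. Qed.
Lemma cr_zy1 : cross nz ny1 = (- i) *: ny1.
Proof. by rewrite crossC cr_y1z -?scaleNr ?opprK ?oppr0. Qed.
Lemma cr_y2y3 : cross ny2 ny3 = 2%:R *: nx1.
Proof. by null_cross. Qed.
Lemma cr_y3y2 : cross ny3 ny2 = (- 2%:R) *: nx1.
Proof. by rewrite crossC cr_y2y3 -?scaleNr ?opprK ?oppr0. Qed.
Lemma cr_y2z : cross ny2 nz = i *: ny2.
Proof. by null_cross. Qed.
Lemma cr_zy2 : cross nz ny2 = (- i) *: ny2.
Proof. by rewrite crossC cr_y2z -?scaleNr ?opprK ?oppr0. Qed.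
Lemma cr_y3z : cross ny3 nz = i *: ny3.
Proof. by null_cross. Qed.
Lemma cr_zy3 : cross nz ny3 = (- i) *: ny3.
Proof. by rewrite crossC cr_y3z -?scaleNr ?opprK ?oppr0. Qed.

Definition crE := (cr_x1x2, cr_x2x1, cr_x1x3, cr_x3x1, cr_x1y1, cr_y1x1, cr_x1y2, cr_y2x1, cr_x1y3, cr_y3x1, cr_x1z, cr_zx1, cr_x2x3, cr_x3x2, cr_x2y1, cr_y1x2, cr_x2y2, cr_y2x2, cr_x2y3, cr_y3x2, cr_x2z, cr_zx2, cr_x3y1, cr_y1x3, cr_x3y2, cr_y2x3, cr_x3y3, cr_y3x3, cr_x3z, cr_zx3, cr_y1y2, cr_y2y1, cr_y1y3, cr_y3y1, cr_y1z, cr_zy1, cr_y2y3, cr_y3y2, cr_y2z, cr_zy2, cr_y3z, cr_zy3, @crossxx K).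

Lemma dt_x1x1 : dot nx1 nx1 = 0.
Proof. by null_dot. Qed.
Lemma dt_x1x2 : dot nx1 nx2 = 0.
Proof. by null_dot. Qed.
Lemma dt_x1x3 : dot nx1 nx3 = 0.
Proof. by null_dot. Qed.
Lemma dt_x1y1 : dot nx1 ny1 = 2%:R.
Proof. by null_dot. Qed.
Lemma dt_x1y2 : dot nx1 ny2 = 0.
Proof. by null_dot. Qed.
Lemma dt_x1y3 : dot nx1 ny3 = 0.
Proof. by null_dot. Qed.
Lemma dt_x1z : dot nx1 nz = 0.
Proof. by null_dot. Qed.
Lemma dt_x2x1 : dot nx2 nx1 = 0.
Proof. by rewrite dotC dt_x1x2. Qed.
Lemma dt_x2x2 : dot nx2 nx2 = 0.
Proof. by null_dot. Qed.
Lemma dt_x2x3 : dot nx2 nx3 = 0.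
Proof. by null_dot. Qed.
Lemma dt_x2y1 : dot nx2 ny1 = 0.
Proof. by null_dot. Qed.
Lemma dt_x2y2 : dot nx2 ny2 = 2%:R.
Proof. by null_dot. Qed.
Lemma dt_x2y3 : dot nx2 ny3 = 0.
Proof. by null_dot. Qed.
Lemma dt_x2z : dot nx2 nz = 0.
Proof. by null_dot. Qed.
Lemma dt_x3x1 : dot nx3 nx1 = 0.
Proof. by rewrite dotC dt_x1x3. Qed.
Lemma dt_x3x2 : dot nx3 nx2 = 0.
Proof. by rewrite dotC dt_x2x3. Qed.
Lemma dt_x3x3 : dot nx3 nx3 = 0.
Proof. by null_dot. Qed.
Lemma dt_x3y1 : dot nx3 ny1 = 0.
Proof. by null_dot. Qed.
Lemma dt_x3y2 : dot nx3 ny2 = 0.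
Proof. by null_dot. Qed.
Lemma dt_x3y3 : dot nx3 ny3 = 2%:R.
Proof. by null_dot. Qed.
Lemma dt_x3z : dot nx3 nz = 0.
Proof. by null_dot. Qed.
Lemma dt_y1x1 : dot ny1 nx1 = 2%:R.
Proof. by rewrite dotC dt_x1y1. Qed.
Lemma dt_y1x2 : dot ny1 nx2 = 0.
Proof. by rewrite dotC dt_x2y1. Qed.
Lemma dt_y1x3 : dot ny1 nx3 = 0.
Proof. by rewrite dotC dt_x3y1. Qed.
Lemma dt_y1y1 : dot ny1 ny1 = 0.
Proof. by null_dot. Qed.
Lemma dt_y1y2 : dot ny1 ny2 = 0.
Proof. by null_dot. Qed.
Lemma dt_y1y3 : dot ny1 ny3 = 0.
Proof. by null_dot. Qed.
Lemma dt_y1z : dot ny1 nz = 0.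
Proof. by null_dot. Qed.
Lemma dt_y2x1 : dot ny2 nx1 = 0.
Proof. by rewrite dotC dt_x1y2. Qed.
Lemma dt_y2x2 : dot ny2 nx2 = 2%:R.
Proof. by rewrite dotC dt_x2y2. Qed.
Lemma dt_y2x3 : dot ny2 nx3 = 0.
Proof. by rewrite dotC dt_x3y2. Qed.
Lemma dt_y2y1 : dot ny2 ny1 = 0.
Proof. by rewrite dotC dt_y1y2. Qed.
Lemma dt_y2y2 : dot ny2 ny2 = 0.
Proof. by null_dot. Qed.
Lemma dt_y2y3 : dot ny2 ny3 = 0.
Proof. by null_dot. Qed.
Lemma dt_y2z : dot ny2 nz = 0.
Proof. by null_dot. Qed.
Lemma dt_y3x1 : dot ny3 nx1 = 0.
Proof. by rewrite dotC dt_x1y3. Qed.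
Lemma dt_y3x2 : dot ny3 nx2 = 0.
Proof. by rewrite dotC dt_x2y3. Qed.
Lemma dt_y3x3 : dot ny3 nx3 = 2%:R.
Proof. by rewrite dotC dt_x3y3. Qed.
Lemma dt_y3y1 : dot ny3 ny1 = 0.
Proof. by rewrite dotC dt_y1y3. Qed.
Lemma dt_y3y2 : dot ny3 ny2 = 0.
Proof. by rewrite dotC dt_y2y3. Qed.
Lemma dt_y3y3 : dot ny3 ny3 = 0.
Proof. by null_dot. Qed.
Lemma dt_y3z : dot ny3 nz = 0.
Proof. by null_dot. Qed.
Lemma dt_zx1 : dot nz nx1 = 0.
Proof. by rewrite dotC dt_x1z. Qed.
Lemma dt_zx2 : dot nz nx2 = 0.
Proof. by rewrite dotC dt_x2z. Qed.
Lemma dt_zx3 : dot nz nx3 = 0.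
Proof. by rewrite dotC dt_x3z. Qed.
Lemma dt_zy1 : dot nz ny1 = 0.
Proof. by rewrite dotC dt_y1z. Qed.
Lemma dt_zy2 : dot nz ny2 = 0.
Proof. by rewrite dotC dt_y2z. Qed.
Lemma dt_zy3 : dot nz ny3 = 0.
Proof. by rewrite dotC dt_y3z. Qed.
Lemma dt_zz : dot nz nz = 1.
Proof. by null_dot. Qed.

Definition dtE := (dt_x1x1, dt_x1x2, dt_x1x3, dt_x1y1, dt_x1y2, dt_x1y3, dt_x1z, dt_x2x1, dt_x2x2, dt_x2x3, dt_x2y1, dt_x2y2, dt_x2y3, dt_x2z, dt_x3x1, dt_x3x2, dt_x3x3, dt_x3y1, dt_x3y2, dt_x3y3, dt_x3z, dt_y1x1, dt_y1x2, dt_y1x3, dt_y1y1, dt_y1y2, dt_y1y3, dt_y1z, dt_y2x1, dt_y2x2, dt_y2x3, dt_y2y1, dt_y2y2, dt_y2y3, dt_y2z, dt_y3x1, dt_y3x2, dt_y3x3, dt_y3y1, dt_y3y2, dt_y3y3, dt_y3z, dt_zx1, dt_zx2, dt_zx3, dt_zy1, dt_zy2, dt_zy3, dt_zz).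

Lemma null_expand v : v = 2%:R^-1 *: (dot ny1 v *: nx1 + dot ny2 v *: nx2 + dot ny3 v *: nx3
  + dot nx1 v *: ny1 + dot nx2 v *: ny2 + dot nx3 v *: ny3) + dot nz v *: nz.
Proof.
apply/colP; apply: ord7_ind; rewrite !mxentE !dot7 !null_entry //=; field: ii; exact: two.
Qed.

End NullBasis.

Section Actions.
Variable K : closedFieldType.
Hypothesis char0 : [pchar K] =i pred0.
Implicit Types (u v w p q r : 'cV[K]_7) (g x d : 'M[K]_7).

Let two : 2%:R != 0 :> K := natr_neq0 char0 1.
Let three : 3%:R != 0 :> K := natr_neq0 char0 2.

Lemma gphi_wedge_mul u v w : gphi (wedge u v) *m w =
  dot v w *: u - dot u w *: v + 3%:R^-1 *: cross (cross u v) w.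
Proof. by rewrite /gphi nvec_wedge mulmxDl wedge_mul -scalemxAl Lmx_mul. Qed.

Lemma gphi_wedge_g2 u v : gphi (wedge u v) \in g2 K.
Proof. by apply: (gphi_g2 char0); rewrite wedge_tr. Qed.

(** With [r = cross p w] one has [cross p r = 0] and [cross w r = (w, w) p], so only the rank one
    terms of [r] and [p] remain. This is where the rank of the square of a projection is read
    off. *)
Lemma gphi_null_sqr p w : dot p p = 0 -> dot p w = 0 ->
  gphi (wedge p w) *m gphi (wedge p w) =
  (9%:R^-1) *: (cross p w *m (cross p w)^T) - (dot w w / 3%:R) *: (p *m p^T).
Proof.
move=> pp pw; set r := cross p w.
have pr : cross p r = 0 by rewrite /r cross_cross pp pw !scale0r subrr.
have wr : cross w r = dot w w *: p.
  by rewrite /r [cross p w]crossC crossNr cross_cross [dot w p]dotC pw scale0r sub0r opprK.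
have rw : dot w r = 0 by exact: dot_cross0r.
have rp : dot p r = 0 by exact: dot_cross0l.
apply: mx_cV_ext => v; rewrite -mulmxA [gphi _ *m v]gphi_wedge_mul -/r.
rewrite mulmxDr mulmxBr -!scalemxAr !gphi_wedge_mul -/r.
rewrite pp pw [dot w p]dotC pw [cross r p]crossC pr [cross r w]crossC wr.
rewrite cross_cross -dot_cross -[dot p (cross r v)]dot_cross pr wr dot0l.
have -> : dot r r = 0 by rewrite /r dot_cross2 pp pw mul0r mulr0 subrr.
rewrite mulmxBl -!scalemxAl !outer_mul !dot_lin.
by mxfield; rewrite !(natr_neq0 char0).
Qed.

Lemma gphi_null_cube p w : dot p p = 0 -> dot p w = 0 ->
  gphi (wedge p w) *m gphi (wedge p w) *m gphi (wedge p w) = 0.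
Proof.
move=> pp pw; rewrite -mulmxA (gphi_null_sqr pp pw) mulmxBr -!scalemxAr !mulmxA !gphi_wedge_mul.
rewrite pp [dot w p]dotC pw dot_cross0l dot_cross0r crossxx [cross (cross p w) p]crossC.
rewrite cross_cross pp pw !scale0r !subrr !(oppr0, add0r, addr0, scaler0).
by rewrite !mul0mx !scaler0 subrr.
Qed.

Lemma g2_der d u v : d \in g2 K -> d *m cross u v = cross (d *m u) v + cross u (d *m v).
Proof. by move=> /mem_g2 [_ ->]. Qed.

Lemma g2_tr d : d \in g2 K -> d^T = - d.
Proof. by move=> /mem_g2 [/mem_so]. Qed.

(** The exponential of a nilpotent derivation is an automorphism once the terms of degree 3 and 4 in
    [cross (exp3 d u) (exp3 d v)] vanish. Those of degree 3 form a multiple of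
    [d^3 (cross u v) = 0]; applying [d] to that relation removes degree 4. *)
Lemma exp3_g2 d : d \in g2 K -> d *m d *m d = 0 -> G2 K (exp3 d).
Proof.
move=> dg d3; have dT := g2_tr dg.
apply/(G2P char0); split; first by have [] := exp3_SO char0 dT d3.
have D u v : d *m cross u v = cross (d *m u) v + cross u (d *m v) by exact: g2_der.
have d3v u : d *m (d *m (d *m u)) = 0 by rewrite 2!mulmxA d3 mul0mx.
move=> u v.
have e3 : 3%:R *: (cross (d *m (d *m u)) (d *m v) + cross (d *m u) (d *m (d *m v))) = 0.
  rewrite -[RHS](d3v (cross u v)) !(D, mulmxDr) !d3v !cross_lin.
  by mxring.
have e3' : cross (d *m (d *m u)) (d *m v) = - cross (d *m u) (d *m (d *m v)).
  by move/eqP: e3; rewrite scaler_eq0 (negPf three) /= addr_eq0 => /eqP.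
have e4 : cross (d *m (d *m u)) (d *m (d *m v)) = 0.
  have := congr1 (mulmx d) e3'; rewrite mulmxN !D !d3v cross0l cross0r add0r addr0.
  move/eqP; rewrite -addr_eq0 -mulr2n -scaler_nat scaler_eq0 (negPf two) => /eqP.
  by [].
rewrite /exp3 !(mulmxDl, mul1mx, =^~ scalemxAl) -!mulmxA !D mulmxDr !D !cross_lin e3' e4.
by mxfield; rewrite !(natr_neq0 char0).
Qed.

End Actions.

Section Borel.
Variable K : closedFieldType.
Hypothesis char0 : [pchar K] =i pred0.
Variable i : K.
Hypothesis ii : i * i = -1.
Implicit Types (u v w p q r : 'cV[K]_7) (g x d : 'M[K]_7).

Let two : 2%:R != 0 :> K := natr_neq0 char0 1.
Let i0 : i != 0.
Proof. by apply/eqP=> h; move/eqP: ii; rewrite h mul0r eq_sym oppr_eq0 oner_eq0. Qed.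

Local Notation bas := (bas K).
Local Notation nz := (nullvec i 0).
Local Notation nx1 := (nullvec i 1).
Local Notation nx2 := (nullvec i 2).
Local Notation nx3 := (nullvec i 3).
Local Notation ny1 := (nullvec i 4).
Local Notation ny2 := (nullvec i 5).
Local Notation ny3 := (nullvec i 6).
Let cr := (crE ii).
Let dt := (dtE ii).

Lemma nx1E : nx1 = X1 i.
Proof. by rewrite nullvec.unlock. Qed.

Lemma bas2E : bas 2 = 2%:R^-1 *: (nx2 + ny2).
Proof. by rewrite nullvec.unlock /=; mxfield. Qed.

(** The three null vectors [ny1], [ny2], [ny3] generate everything under the cross product, so they
    determine a derivation. *)
Lemma g2_ext x y : x \in g2 K -> y \in g2 K -> x *m ny1 = y *m ny1 -> x *m ny2 = y *m ny2 ->
  x *m ny3 = y *m ny3 -> x = y.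
Proof.
move=> xg yg h1 h2 h3; have dg : x - y \in g2 K by exact: rpredB.
move/eqP: h1; move/eqP: h2; move/eqP: h3; rewrite -!(subr_eq0 (x *m _)) -!mulmxBl.
move=> /eqP d3 /eqP d2 /eqP d1; apply/eqP; rewrite -subr_eq0; apply/eqP.
set d := x - y in dg d1 d2 d3 *; clearbody d.
have dc u v a w : d *m u = 0 -> d *m v = 0 -> a != 0 -> cross u v = a *: w -> d *m w = 0.
  move=> du dv a0 uv; have := g2_der u v dg; rewrite uv du dv cross0l cross0r addr0 -scalemxAr.
  by move/eqP; rewrite scaler_eq0 (negPf a0) => /eqP.
have x1 := dc _ _ _ _ d2 d3 two (cr_y2y3 ii).
have x2 := dc _ _ _ _ d3 d1 two (cr_y3y1 ii).
have x3 := dc _ _ _ _ d1 d2 two (cr_y1y2 ii).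
have z0 : d *m nz = 0 by apply: (dc _ _ _ _ x1 d1 _ (cr_x1y1 ii)); rewrite mulf_neq0.
apply: mx_cV_ext => v; rewrite mul0mx (null_expand char0 ii v).
by rewrite !(mulmxDr, =^~ scalemxAr) x1 x2 x3 z0 d1 d2 d3 !(scaler0, addr0).
Qed.

(* The nilradical of the Borel subalgebra stabilising the flag spanned by [nx1], then [ny3] *)
Definition bor c1 c2 c3 c4 c5 c6 := gphi (c1 *: wedge nx1 ny2 + c2 *: wedge nx1 ny3 +
  c3 *: wedge nx2 ny3 + c4 *: wedge nx1 nz + c5 *: wedge ny3 nz + c6 *: wedge ny2 nz).

Lemma bor_g2 c1 c2 c3 c4 c5 c6 : bor c1 c2 c3 c4 c5 c6 \in g2 K.
Proof. by rewrite /bor !gphiD !gphiZ !rpredD // rpredZ // gphi_wedge_g2. Qed.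

Let bor_mulE c1 c2 c3 c4 c5 c6 v : bor c1 c2 c3 c4 c5 c6 *m v =
  c1 *: (gphi (wedge nx1 ny2) *m v) + c2 *: (gphi (wedge nx1 ny3) *m v) +
  c3 *: (gphi (wedge nx2 ny3) *m v) + c4 *: (gphi (wedge nx1 nz) *m v) +
  c5 *: (gphi (wedge ny3 nz) *m v) + c6 *: (gphi (wedge ny2 nz) *m v).
Proof.
rewrite /bor !gphiD !gphiZ.
move: (gphi _) (gphi _) (gphi _) (gphi _) (gphi _) (gphi _) => x1 x2 x3 x4 x5 x6.
by rewrite !mulmxDl -!scalemxAl.
Qed.

Lemma bor_mul c1 c2 c3 c4 c5 c6 :
  [/\ bor c1 c2 c3 c4 c5 c6 *m ny1 = (2%:R / 3%:R * i * c5) *: nx2 - (2%:R / 3%:R * i * c6) *: nx3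
       - (2%:R * c1) *: ny2 - (2%:R * c2) *: ny3 - (4%:R / 3%:R * c4) *: nz,
      bor c1 c2 c3 c4 c5 c6 *m ny2 = - (2%:R / 3%:R * i * c5) *: nx1 - (2%:R * c3) *: ny3 &
      bor c1 c2 c3 c4 c5 c6 *m ny3 = (2%:R / 3%:R * i * c6) *: nx1].
Proof.
split; rewrite bor_mulE !gphi_wedge_mul !dt !cr ?cross_lin ?cr.
all: apply/matrixP=> k l; rewrite !mxentE.
all: field: ii; by rewrite ?(natr_neq0 char0).
Qed.

Lemma bor_mul0 c1 c2 c3 c4 c5 c6 :
  [/\ bor c1 c2 c3 c4 c5 c6 *m nx1 = 0,
      bor c1 c2 c3 c4 c5 c6 *m nx2 =
        (2%:R * c1) *: nx1 - (2%:R / 3%:R * i * c4) *: ny3 - (4%:R / 3%:R * c6) *: nz,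
      bor c1 c2 c3 c4 c5 c6 *m nx3 = (2%:R * c2) *: nx1 + (2%:R * c3) *: nx2
        + (2%:R / 3%:R * i * c4) *: ny2 - (4%:R / 3%:R * c5) *: nz &
      bor c1 c2 c3 c4 c5 c6 *m nz =
        (2%:R / 3%:R) *: (c4 *: nx1 + c5 *: ny3 + c6 *: ny2)].
Proof.
split; rewrite bor_mulE !gphi_wedge_mul !dt !cr ?cross_lin ?cr.
all: apply/matrixP=> k l; rewrite !mxentE.
all: field: ii; by rewrite ?(natr_neq0 char0).
Qed.

End Borel.

Section Nilpotents.
Variable K : closedFieldType.
Hypothesis char0 : [pchar K] =i pred0.
Variable i : K.
Hypothesis ii : i * i = -1.
Implicit Types (u v w p q r : 'cV[K]_7) (g x d : 'M[K]_7).

Let two : 2%:R != 0 :> K := natr_neq0 char0 1.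
Let i0 : i != 0.
Proof. by apply/eqP=> h; move/eqP: ii; rewrite h mul0r eq_sym oppr_eq0 oner_eq0. Qed.

Local Notation bas := (bas K).
Local Notation nz := (nullvec i 0).
Local Notation nx1 := (nullvec i 1).
Local Notation nx2 := (nullvec i 2).
Local Notation nx3 := (nullvec i 3).
Local Notation ny1 := (nullvec i 4).
Local Notation ny2 := (nullvec i 5).
Local Notation ny3 := (nullvec i 6).
Let cr := (crE ii).
Let dt := (dtE ii).

(** Take a nonzero value [x^(j-1) v] of the last nonzero power. Its norm is, up to sign,
    [(v, x^(2j-2) v)], and [2j - 2 >= j] since [j >= 2]. *)
Lemma nilp_null x k : x^T = - x -> x ^+ k = 0 ->
  exists p, [/\ p != 0, dot p p = 0 & x *m p = 0].
Proof.
move=> xT xk; have [x0|x0] := eqVneq x 0.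
  exists nx1; split; rewrite ?dt ?x0 ?mul0mx //.
  by apply/eqP=> h; have := dt_x1y1 ii; rewrite h dot0l => /esym/eqP; rewrite (negPf two).
have ex : exists j, x ^+ j == 0 by exists k; rewrite xk.
have [j /eqP xj jmin] := ex_minnP ex.
have j2 : (2 <= j)%N.
  case: j xj {jmin} => [|[|j]] //; last by rewrite expr1 => /eqP; rewrite (negPf x0).
  by move/eqP; rewrite expr0 oner_eq0.
have y0 : x ^+ j.-1 != 0 by apply/negP=> /jmin; rewrite leqNgt prednK ?leqnn // ltnW.
have [v v0] : exists v : 'cV_7, x ^+ j.-1 *m v != 0.
  apply: contrapT => h; case/eqP: y0; apply: mx_cV_ext => v; rewrite mul0mx.
  by apply/eqP; apply: contrapT => /negP h'; apply: h; exists v.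
exists (x ^+ j.-1 *m v); split=> //; last first.
  by rewrite mulmxA mulmxE -exprS prednK ?xj ?mul0mx // ltnW.
have S m u w : dot (x ^+ m *m u) w = (-1) ^+ m * dot u (x ^+ m *m w).
  elim: m u w => [|m IH] u w; first by rewrite !expr0 mul1r !mul1mx.
  rewrite (exprS x) -mulmxE -mulmxA dot_mulmxl xT mulNmx dotNr IH mulmxA mulmxE -exprSr.
  by rewrite [(-1) ^+ m.+1]exprS mulN1r mulNr -exprS.
rewrite S mulmxA mulmxE -exprD (_ : j.-1 + j.-1 = j + j.-2)%N; last by lia.
by rewrite exprD xj mul0r mul0mx dot0r mulr0.
Qed.

(* Otherwise [Lmx p] would be [wedge (cross p f) p] for a [f] with [dot p f = 1], and applying
   [nvec] would give [3 p = p]. *)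
Lemma null_unit p : p != 0 -> dot p p = 0 ->
  exists c, [/\ dot c c = 1, dot p c = 0 & forall l, cross p c != l *: p].
Proof.
move=> p0 pp.
have [[w pw rp]|h] := pselect (exists2 w, dot p w = 0 & forall l, cross p w != l *: p).
  have [v [vr vp]] := separate rp.
  set r := cross p w in vr rp.
  pose t := 2%:R^-1 * (dot w w - 1).
  have pv : dot p v = 0 by rewrite dotC.
  have ppv : cross p (cross p v) = 0 by rewrite cross_cross pv pp !scale0r subrr.
  have wpv : dot w (cross p v) = -1 by rewrite -dot_cross [cross w p]crossC dotNl dotC vr.
  exists (w + t *: cross p v); split.
  - rewrite !dot_lin [dot (cross p v) w]dotC wpv dot_cross2 pp pv mul0r mulr0 subrr /t.
    by field.
  - by rewrite !dot_lin pw dot_cross0l mulr0 addr0.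
  by move=> l; rewrite crossDr crossZr ppv scaler0 addr0.
have {}h w : dot p w = 0 -> exists l, cross p w = l *: p.
  move=> pw; apply: contrapT => h'; apply: h; exists w => // l.
  by apply/eqP=> h; apply: h'; exists l.
have [f pf] := dot_ex1 p0; pose r := cross p f.
have rf : dot r f = 0 by rewrite dotC /r dot_cross0r.
have LE : Lmx p = wedge r p.
  apply: mx_cV_ext => v; rewrite Lmx_mul wedge_mul.
  have [l pl] : exists l, cross p (v - dot p v *: f) = l *: p.
    by apply: h; rewrite !dot_lin pf mulr1 subrr.
  have pv : cross p v = l *: p + dot p v *: r.
    by rewrite -pl !cross_lin subrK.
  rewrite pv addrC; congr (_ + _); rewrite -scaleNr; congr (_ *: p).
  have := dot_cross p v f; rewrite pv [cross v f]crossC dotNr -dot_cross -/r => <-.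
  by rewrite !dot_lin pf rf mulr0 mulr1 addr0.
have := congr1 (@nvec K) LE; rewrite nvec_Lmx nvec_wedge crossC /r cross_cross pf pp.
rewrite scale0r subr0 scale1r => /oppr_inj /eqP; rewrite -subr_eq0 -[X in _ - X]scale1r -scalerBl.
have -> : 3%:R - 1 = 2%:R :> K by ring.
by rewrite scaler_eq0 (negPf two) (negPf p0).
Qed.

(** The products [cross u nx1] for [u] among [nx2], [nx3], [ny1], [nz] are multiples of [ny3],
    [ny2], [nz], [nx1], and all pair to zero with [q]. The kernel is the isotropic space of [nx1],
    [ny2], [ny3]. *)
Lemma ker_x1 q : cross nx1 q = 0 -> q =
  (2%:R^-1 * dot ny1 q) *: nx1 + (2%:R^-1 * dot nx2 q) *: ny2 + (2%:R^-1 * dot nx3 q) *: ny3.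
Proof.
move=> xq; rewrite {1}(null_expand char0 ii q).
have E u : dot (cross u nx1) q = 0 by rewrite dot_cross xq dot0r.
have ey2 : dot ny2 q = 0.
  by have /eqP := E nx3; rewrite cr dotZl mulf_eq0 (negPf two) => /eqP.
have ey3 : dot ny3 q = 0.
  by have /eqP := E nx2; rewrite cr dotZl mulf_eq0 oppr_eq0 (negPf two) => /eqP.
have ez : dot nz q = 0.
  by have /eqP := E ny1; rewrite cr dotZl mulf_eq0 oppr_eq0 mulf_eq0 (negPf two) (negPf i0) => /eqP.
have ex1 : dot nx1 q = 0.
  by have /eqP := E nz; rewrite cr dotZl mulf_eq0 (negPf i0) => /eqP.
by rewrite ey2 ey3 ez ex1; mxring.
Qed.

(** Because [ny3 = cross nx1 (bas 2)], it is enough to find a unit vector [c] orthogonal to [nx1]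
    with [cross nx1 c = q] and to apply [G2_transitive] to [nx1] and [c]. *)
Lemma flag_move q : cross nx1 q = 0 -> (forall l, q != l *: nx1) ->
  exists g, [/\ G2 K g, g *m nx1 = nx1 & g *m ny3 = q].
Proof.
move=> /ker_x1; move: (_ * dot ny1 q) (_ * dot nx2 q) (_ * dot nx3 q) => a s t qE ql.
(* The coordinates of [c] on [nx2], [nx3], [nz] are forced by [q]; those on [ny2], [ny3] are free,
   and this equation is [(c, c) = 1]. *)
have [b [b' bE]] : exists b b', t * b - s * b' = 2%:R^-1 * (1 + a * a).
  have [t0|t0] := eqVneq t 0; last by exists (2%:R^-1 * (1 + a * a) / t), 0; field; rewrite two t0.
  have [s0|s0] := eqVneq s 0; last by exists 0, (- (2%:R^-1 * (1 + a * a) / s)); field; rewrite two s0.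
  by have := ql a; rewrite qE s0 t0 !scale0r !addr0 eqxx.
pose c := (2%:R^-1 * t) *: nx2 - (2%:R^-1 * s) *: nx3 + (i * a) *: nz + b *: ny2 + b' *: ny3.
have cc : dot c c = 1.
  rewrite !dot_lin !dt; have bE' : 2%:R * (t * b - s * b') = 1 + a * a by rewrite bE; field.
  transitivity (2%:R * (t * b - s * b') - a * a); last by rewrite bE' addrK.
  by field: ii.
have xc : cross nx1 c = q.
  by rewrite qE !cross_lin !cr; apply/matrixP=> k l; rewrite !mxentE; field: ii.
have [g gG [gx gc]] : exists2 g, G2 K g & g *m X1 i = nx1 /\ g *m bas 2 = c.
  apply: (G2_transitive char0 ii) => [|//||l]; rewrite ?dt ?xc //.
  by rewrite !dot_lin !dt !mulr0 !(addr0, oppr0).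
have gx1 : g *m nx1 = nx1 by rewrite {1}nx1E.
exists g; split=> //.
have y3 : ny3 = cross nx1 (bas 2).
  by rewrite (bas2E char0 i) !cross_lin !cr; mxfield.
by have [_ gm] := gG; rewrite y3 gm gc gx1.
Qed.
End Nilpotents.

(** * Nilpotent elements moved into the nilradical of a Borel subalgebra *)

Section NormalForm.
Variable K : closedFieldType.
Hypothesis char0 : [pchar K] =i pred0.
Variable i : K.
Hypothesis ii : i * i = -1.
Implicit Types (u v w p q r : 'cV[K]_7) (g x d : 'M[K]_7).

Let two : 2%:R != 0 :> K := natr_neq0 char0 1.

Local Notation bas := (bas K).
Local Notation nz := (nullvec i 0).
Local Notation nx1 := (nullvec i 1).
Local Notation nx2 := (nullvec i 2).
Local Notation nx3 := (nullvec i 3).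
Local Notation ny1 := (nullvec i 4).
Local Notation ny2 := (nullvec i 5).
Local Notation ny3 := (nullvec i 6).
Let cr := (crE ii).
Let dt := (dtE ii).

Lemma G2_conj_nilp g x k : G2 K g -> x \in g2 K -> x ^+ k = 0 ->
  [/\ g^T *m x *m g \in g2 K, (g^T *m x *m g) ^+ k = 0 & x = g *m (g^T *m x *m g) *m g^T].
Proof.
move=> /(G2P char0) [gg gm] xg xk; have gT := orth_tr gg.
have E : invmx g^T = g by rewrite orth_inv // trmxK.
split.
- by have := g2_conj gT (crossmorph_inv gg gm) xg; rewrite trmxK.
- by rewrite -{2}E conj_exp ?xk ?mulmx0 ?mul0mx // orth_unit.
by rewrite !mulmxA orth_r // mul1mx -mulmxA orth_r // mulmx1.
Qed.

Lemma g2_ker x q : x \in g2 K -> x *m nx1 = 0 -> cross nx1 q = 0 -> cross nx1 (x *m q) = 0.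
Proof. by move=> xg x1 q0; have := g2_der nx1 q xg; rewrite q0 x1 cross0l mulmx0 add0r. Qed.

Lemma nx1_neq0 : nx1 != 0.
Proof.
by apply/eqP=> h; have := dt_x1y1 ii; rewrite h dot0l => /esym/eqP; rewrite (negPf two).
Qed.

(** [x] preserves the kernel of the product by [nx1] and acts nilpotently on its quotient by [nx1];
    [q] is the last iterate of [ny2] that is nonzero in this quotient. *)
Lemma flag_vector x k : x \in g2 K -> x ^+ k = 0 -> x *m nx1 = 0 ->
  exists q l, [/\ cross nx1 q = 0, forall l, q != l *: nx1 & x *m q = l *: nx1].
Proof.
move=> xg xk x1.
pose P j := `[< exists l, x ^+ j *m ny2 = l *: nx1 >].
have ex : exists j, P j by exists k; apply/asboolP; exists 0; rewrite xk mul0mx scale0r.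
have [j /asboolP [l xj] jmin] := ex_minnP ex.
have j0 : (0 < j)%N.
  case: j xj {jmin} => // /(congr1 (dot nx2)); rewrite expr0 mul1mx dotZr !dt mulr0 => /eqP.
  by rewrite (negPf two).
exists (x ^+ j.-1 *m ny2), l; split.
- elim: j.-1 => [|m IH]; first by rewrite expr0 mul1mx cr.
  by rewrite exprS -mulmxE -mulmxA g2_ker.
- move=> l'; apply/eqP=> h.
  by have /jmin : P j.-1 by [apply/asboolP; exists l'|]; rewrite leqNgt prednK ?leqnn.
by rewrite mulmxA mulmxE -exprS prednK.
Qed.

(** The only coordinate of [x] not accounted for by [bor] would be a diagonal one, the eigenvalue
    [d] on [ny2] modulo [nx1] and [ny3]; nilpotency kills it. The parameters are then read off the
    pairings with [ny1], [ny2], [ny3] by inverting [bor_mul]. *)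
Lemma borel_form x k a : x \in g2 K -> x ^+ k = 0 -> x *m nx1 = 0 -> x *m ny3 = a *: nx1 ->
  exists c1 c2 c3 c4 c5, x = bor i c1 c2 c3 c4 c5 (- (3%:R / 2%:R * i * a)).
Proof.
move=> xg xk x1 x3; have xT := g2_tr xg.
have x2 := ker_x1 char0 ii (g2_ker xg x1 (cr_x1y2 ii)).
set e1 := _ * _ in x2; set d := _ * _ in x2; set e3 := _ * _ in x2; clearbody e1 d e3.
have d0 : d = 0.
  have H m : exists a b, x ^+ m *m ny2 = a *: nx1 + (d ^+ m) *: ny2 + b *: ny3.
    elim: m => [|m [b [b' IH]]].
      by exists 0, 0; rewrite !expr0 mul1mx !scale0r scale1r add0r addr0.
    exists (d ^+ m * e1 + b' * a), (d ^+ m * e3).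
    rewrite exprS -mulmxE -mulmxA IH !mulmxDr -!scalemxAr x1 x2 x3 exprS.
    by mxring.
  have [b [b' E]] := H k; have := congr1 (dot nx2) E; rewrite xk mul0mx dot0r !dot_lin !dt.
  rewrite !mulr0 add0r addr0 => /esym/eqP; rewrite mulf_eq0 (negPf two) orbF.
  by rewrite expf_eq0 => /andP [_ /eqP].
rewrite {}d0 scale0r addr0 in x2.
have y11 : dot ny1 (x *m ny1) = 0 by exact: skew_dot0.
have y21 : dot ny2 (x *m ny1) = - (2%:R * e1).
  by rewrite (skew_dot _ _ xT) x2 !dot_lin !dt mulr0 addr0 mulrC.
have y31 : dot ny3 (x *m ny1) = - (2%:R * a).
  by rewrite (skew_dot _ _ xT) x3 !dot_lin !dt mulrC.
have x11 : dot nx1 (x *m ny1) = 0 by rewrite (skew_dot _ _ xT) x1 dot0r oppr0.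
pose h : K := 4%:R^-1.
pose c1 := - (h * dot nx2 (x *m ny1)); pose c2 := - (h * dot nx3 (x *m ny1)).
pose c3 := - (2%:R^-1 * e3); pose c4 := - (3%:R / 4%:R * dot nz (x *m ny1)).
pose c5 := 3%:R / 2%:R * i * e1; pose c6 := - (3%:R / 2%:R * i * a).
have [b1 b2 b3] := bor_mul char0 ii c1 c2 c3 c4 c5 c6.
exists c1, c2, c3, c4, c5; apply: (g2_ext char0 ii) => //; first exact: bor_g2.
all: rewrite ?b1 ?b2 ?b3 /c1 /c2 /c3 /c4 /c5 /c6.
- rewrite [LHS](null_expand char0 ii) y11 y21 y31 x11 /h.
  by apply/matrixP=> l m; rewrite !mxentE; field: ii; rewrite !(natr_neq0 char0).
- by rewrite x2; apply/matrixP=> l m; rewrite !mxentE; field: ii; rewrite !(natr_neq0 char0).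
by rewrite x3; apply/matrixP=> l m; rewrite !mxentE; field: ii; rewrite !(natr_neq0 char0).
Qed.

(** An isotropic vector of the kernel is moved to [nx1], then a flag vector to [ny3]. If this ends
    with [c3 = 0] and [c6] nonzero, another flag is chosen for which the last coordinate becomes
    zero. *)
Lemma g2_nilp_form x k : x \in g2 K -> x ^+ k = 0 ->
  exists g c1 c2 c3 c4 c5 c6, [/\ G2 K g, x = g *m bor i c1 c2 c3 c4 c5 c6 *m g^T &
    c6 = 0 \/ c3 != 0 /\ c6 != 0].
Proof.
have move q y a : y \in g2 K -> y ^+ k = 0 -> y *m nx1 = 0 -> cross nx1 q = 0 ->
    (forall l, q != l *: nx1) -> y *m q = a *: nx1 ->
    exists g c1 c2 c3 c4 c5, G2 K g /\ y = g *m bor i c1 c2 c3 c4 c5 (- (3%:R / 2%:R * i * a)) *m g^T.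
  move=> yg yk y1 q0 ql yq; have [g [gG g1 g3]] := flag_move char0 ii q0 ql.
  have [gg _] := (G2P char0 g).1 gG.
  have [zg zk yE] := G2_conj_nilp gG yg yk.
  have g1' : g^T *m nx1 = nx1 by rewrite -{1}g1 mulmxA gg mul1mx.
  have [||c1 [c2 [c3 [c4 [c5 zE]]]]] := borel_form (a := a) zg zk.
  - by rewrite -!mulmxA g1 y1 mulmx0.
  - by rewrite -!mulmxA g3 yq -scalemxAr g1'.
  by exists g, c1, c2, c3, c4, c5; split=> //; rewrite -zE.
have comb g g' (y : 'M_7) : g *m (g' *m y *m g'^T) *m g^T = (g *m g') *m y *m (g *m g')^T.
  by rewrite trmx_mul !mulmxA.
have [_ _ mulG _] := mxgroup_G2 char0.
move=> xg xk; have [p [p0 pp xp]] := nilp_null char0 ii (g2_tr xg) xk.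
have [c [cc pc pcl]] := null_unit char0 p0 pp.
have [g gG [g1 _]] := G2_transitive char0 ii pp cc pc pcl; rewrite -nx1E in g1.
have [yg yk xE] := G2_conj_nilp gG xg xk.
set y := g^T *m x *m g in yg yk xE.
have y1 : y *m nx1 = 0 by rewrite /y -!mulmxA g1 xp mulmx0.
have [q [a [q0 ql yq]]] := flag_vector yg yk y1.
have [g' [c1 [c2 [c3 [c4 [c5 [g'G yE]]]]]]] := move _ _ _ yg yk y1 q0 ql yq.
set c6 := - _ in yE.
have [c60|c60] := eqVneq c6 0.
  exists (g *m g'), c1, c2, c3, c4, c5, c6; split; [exact: mulG| |by left].
  by rewrite -comb -yE.
have [c30|c30] := eqVneq c3 0; last first.
  exists (g *m g'), c1, c2, c3, c4, c5, c6; split; [exact: mulG| |by right].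
  by rewrite -comb -yE.
have [zg zk yE'] := G2_conj_nilp g'G yg yk.
set z := g'^T *m y *m g' in zg zk yE'.
have zE : z = bor i c1 c2 c3 c4 c5 c6.
  have [gg _] := (G2P char0 g').1 g'G.
  by rewrite /z yE !mulmxA gg mul1mx -!mulmxA gg mulmx1.
have [b1 b2 b3] := bor_mul char0 ii c1 c2 c3 c4 c5 c6.
have [b0 _ _ _] := bor_mul0 char0 ii c1 c2 c3 c4 c5 c6.
(* When [c3 = 0] the vector [c6 ny2 + c5 ny3] is killed by [z]. Using it as flag vector gives
   [a = 0], so the new sixth coordinate is 0. *)
have [||||h [d1 [d2 [d3 [d4 [d5 [hG zE']]]]]]] := move (c6 *: ny2 + c5 *: ny3) z 0 zg zk.
- by rewrite zE.
- by rewrite crossDr !crossZr !cr !scaler0 addr0.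
- move=> l; apply/eqP=> /(congr1 (dot nx2)); rewrite !dot_lin !dt !mulr0 addr0 => /eqP.
  by rewrite mulf_eq0 (negPf two) (negPf c60).
- by rewrite zE mulmxDr -!scalemxAr b2 b3 c30 scale0r; mxring.
exists (g *m (g' *m h)), d1, d2, d3, d4, d5, 0; split; last by left.
  by apply: (mulG) => //; exact: mulG.
by rewrite mulr0 oppr0 in zE'; rewrite -!comb -zE' -yE'.
Qed.

End NormalForm.

(** * Reduction by root subgroups and a torus, and the singular elements *)

Section RegularOrbit.
Variable K : closedFieldType.
Hypothesis char0 : [pchar K] =i pred0.
Variable i : K.
Hypothesis ii : i * i = -1.
Implicit Types (u v w : 'cV[K]_7) (g x y : 'M[K]_7).

Let two : 2%:R != 0 :> K := natr_neq0 char0 1.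
Let three : 3%:R != 0 :> K := natr_neq0 char0 2.

Local Notation bas := (bas K).
Local Notation nz := (nullvec i 0).
Local Notation nx1 := (nullvec i 1).
Local Notation nx2 := (nullvec i 2).
Local Notation nx3 := (nullvec i 3).
Local Notation ny1 := (nullvec i 4).
Local Notation ny2 := (nullvec i 5).
Local Notation ny3 := (nullvec i 6).
Let cr := (crE ii).
Let dt := (dtE ii).

Lemma bor_ext c1 c2 c3 c4 c5 c6 d1 d2 d3 d4 d5 d6 :
  c1 = d1 -> c2 = d2 -> c3 = d3 -> c4 = d4 -> c5 = d5 -> c6 = d6 ->
  bor i c1 c2 c3 c4 c5 c6 = bor i d1 d2 d3 d4 d5 d6.
Proof. by do 6!move=> ->. Qed.

Lemma borD c1 c2 c3 c4 c5 c6 d1 d2 d3 d4 d5 d6 :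
  bor i c1 c2 c3 c4 c5 c6 + bor i d1 d2 d3 d4 d5 d6 =
  bor i (c1 + d1) (c2 + d2) (c3 + d3) (c4 + d4) (c5 + d5) (c6 + d6).
Proof. by rewrite /bor -gphiD; congr gphi; mxring. Qed.

Lemma borZ a c1 c2 c3 c4 c5 c6 : a *: bor i c1 c2 c3 c4 c5 c6 =
  bor i (a * c1) (a * c2) (a * c3) (a * c4) (a * c5) (a * c6).
Proof. by rewrite /bor -gphiZ; congr gphi; mxring. Qed.

Lemma lie_g2 x y : x \in g2 K -> y \in g2 K -> lie x y \in g2 K.
Proof.
move=> xg yg; apply/mem_g2; split.
  apply/mem_so; rewrite /lie linearB /= !trmx_mul (g2_tr xg) (g2_tr yg).
  by rewrite !mulmxN !mulNmx !opprK opprB.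
move=> u v; rewrite /lie !mulmxBl -!mulmxA (g2_der u v xg) (g2_der u v yg) !mulmxDr.
rewrite !(g2_der _ _ xg) !(g2_der _ _ yg) !cross_lin; mxring.
Qed.

(** Both sides are derivations, so [g2_ext] leaves three vectors to compare. The zeros in the third
    and sixth slots single out the simple root coordinates. *)
Lemma bor_lie b1 b2 b3 b4 b5 b6 c1 c2 c3 c4 c5 c6 :
  lie (bor i b1 b2 b3 b4 b5 b6) (bor i c1 c2 c3 c4 c5 c6) =
  bor i (2%:R / 3%:R * (b6 * c4 - b4 * c6))
    (2%:R * (b1 * c3 - b3 * c1) + 2%:R / 3%:R * (b5 * c4 - b4 * c5)) 0
    (4%:R / 3%:R * i * (b6 * c5 - b5 * c6)) (2%:R * (b6 * c3 - b3 * c6)) 0.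
Proof.
have [p1 p2 p3] := bor_mul char0 ii b1 b2 b3 b4 b5 b6.
have [p4 p5 p6 p7] := bor_mul0 char0 ii b1 b2 b3 b4 b5 b6.
have [q1 q2 q3] := bor_mul char0 ii c1 c2 c3 c4 c5 c6.
have [q4 q5 q6 q7] := bor_mul0 char0 ii c1 c2 c3 c4 c5 c6.
set d1 := 2%:R / 3%:R * _; set d2 := 2%:R * _ + _; set d4 := _ * (b6 * c5 - _); set d5 := 2%:R * _.
have [r1 r2 r3] := bor_mul char0 ii d1 d2 0 d4 d5 0.
have lg := lie_g2 (bor_g2 char0 i b1 b2 b3 b4 b5 b6) (bor_g2 char0 i c1 c2 c3 c4 c5 c6).
have rg := bor_g2 char0 i d1 d2 0 d4 d5 0.
move: (bor i b1 _ _ _ _ _) (bor i c1 _ _ _ _ _) (bor i d1 _ _ _ _ _) p1 p2 p3 p4 p5 p6 p7 q1 q2 q3 q4 q5 q6 q7 r1 r2 r3 lg rg.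
move=> B C D p1 p2 p3 p4 p5 p6 p7 q1 q2 q3 q4 q5 q6 q7 r1 r2 r3 lg rg.
apply: (g2_ext char0 ii lg rg).
all: rewrite /lie mulmxBl -!mulmxA ?p1 ?p2 ?p3 ?q1 ?q2 ?q3 ?r1 ?r2 ?r3 /d1 /d2 /d4 /d5.
all: rewrite !(mulmxBr, mulmxDr, =^~ scalemxAr, mulmxN, scaleNr).
all: rewrite ?(p1, p2, p3, p4, p5, p6, p7, q1, q2, q3, q4, q5, q6, q7).
all: by apply/matrixP=> l m; rewrite !mxentE; field: ii; rewrite !(natr_neq0 char0).
Qed.

(** Conjugation by an exponential is the exponential of [ad d]. The vanishing of the third power of
    [ad d] on [x] gives [d d x d = d x d d], and multiplying by [d] removes the term of degree 4. *)
Lemma exp3_conj n (d x : 'M[K]_n) : d^T = - d -> d *m d *m d = 0 -> lie d (lie d (lie d x)) = 0 ->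
  exp3 d *m x *m (exp3 d)^T = x + lie d x + 2%:R^-1 *: lie d (lie d x).
Proof.
move=> dT d3 ad3; rewrite exp3_tr //.
have e3 : d *m d *m x *m d = d *m x *m d *m d.
  have := ad3; rewrite /lie !(mulmxBr, mulmxBl) !mulmxA d3 mul0mx -!(mulmxA x) -!(mulmxA d).
  rewrite (mulmxA d d d) d3 mulmx0 !mulmxA => E.
  apply/eqP; rewrite -subr_eq0; have : 3%:R *: (d *m d *m x *m d - d *m x *m d *m d) = 0.
    by rewrite -[RHS]oppr0 -E; mxring.
  by move/eqP; rewrite scaler_eq0 (negPf three).
have e4 : d *m d *m x *m d *m d = 0.
  have := congr1 (mulmxr d) e3; rewrite /= => ->.
  by rewrite -!mulmxA (mulmxA d d d) d3 !mulmx0.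
rewrite /exp3 /lie mulNmx mulmxN opprK.
rewrite !(mulmxBr, mulmxBl, mulmxDr, mulmxDl, mulmxN, mulNmx, mul1mx, mulmx1, =^~ scalemxAl, =^~ scalemxAr).
rewrite !mulmxA e4 e3; by mxfield; rewrite !(natr_neq0 char0).
Qed.


Definition conjG2 x y := exists2 g, G2 K g & y = g *m x *m g^T.

Lemma conjG2_trans x y z : conjG2 x y -> conjG2 y z -> conjG2 x z.
Proof.
have [_ _ mulG _] := mxgroup_G2 char0.
by move=> [g gG ->] [h hG ->]; exists (h *m g); [exact: mulG|rewrite trmx_mul !mulmxA].
Qed.

Lemma unipotent_conj e u v x y : e = gphi (wedge u v) -> dot u u = 0 -> dot u v = 0 ->
  lie e (lie e (lie e x)) = 0 -> y = x + lie e x + 2%:R^-1 *: lie e (lie e x) -> conjG2 x y.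
Proof.
move=> eE uu uv ad3 ->; have eg : e \in g2 K by rewrite eE; exact: gphi_wedge_g2.
have e3 : e *m e *m e = 0 by rewrite eE; exact: (gphi_null_cube char0).
by exists (exp3 e); [exact: (exp3_g2 char0)|rewrite exp3_conj // (g2_tr eg)].
Qed.

Lemma unip3 t : bor i 0 0 t 0 0 0 = gphi (wedge nx2 (t *: ny3)).
Proof. by rewrite /bor !scale0r ?add0r ?addr0 wedgeZr. Qed.
Lemma unip5 t : bor i 0 0 0 0 t 0 = gphi (wedge ny3 (t *: nz)).
Proof. by rewrite /bor !scale0r ?add0r ?addr0 wedgeZr. Qed.
Lemma unip4 t : bor i 0 0 0 t 0 0 = gphi (wedge nx1 (t *: nz)).
Proof. by rewrite /bor !scale0r ?add0r ?addr0 wedgeZr. Qed.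
Lemma unip1 t : bor i t 0 0 0 0 0 = gphi (wedge nx1 (t *: ny2)).
Proof. by rewrite /bor !scale0r ?add0r ?addr0 wedgeZr. Qed.

Lemma bor0 : bor i 0 0 0 0 0 0 = 0.
Proof. by have := gphiZ 0 (0 : 'M[K]_7); rewrite /bor !scale0r !addr0. Qed.

(** By [bor_lie], with [c3 = c6 = 1] the root subgroups of slots 3, 5, 4, 1 shift [c5], [c4], [c1],
    [c2] by multiples of [t]. In this order no coordinate already cleared is disturbed; [c2'] and
    [c2''] record the side effects on [c2]. *)
Lemma unipotent_reduction c1 c2 c4 c5 :
  conjG2 (bor i c1 c2 1 c4 c5 1) (bor i 0 0 1 0 0 1).
Proof.
pose t3 := 2%:R^-1 * c5; pose c2' := c2 - 2%:R * t3 * c1.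
pose t5 := - (3%:R / 4%:R * i * c4).
pose c2'' := c2' + 2%:R / 3%:R * t5 * c4 - 4%:R / 9%:R * i * t5 * t5.
pose t4 := 3%:R / 2%:R * c1; pose t1 := - (2%:R^-1 * c2'').
apply: (@conjG2_trans _ (bor i c1 c2' 1 c4 0 1)).
  apply: (unipotent_conj (unip3 t3)); rewrite ?dot_lin ?dt ?mulr0 //.
    by rewrite !bor_lie -bor0; apply: bor_ext; field: ii; rewrite ?(natr_neq0 char0).
  rewrite !bor_lie borZ !borD; apply: bor_ext; rewrite /c2' /t3; field: ii; by rewrite ?(natr_neq0 char0).
apply: (@conjG2_trans _ (bor i c1 c2'' 1 0 0 1)).
  apply: (unipotent_conj (unip5 t5)); rewrite ?dot_lin ?dt ?mulr0 //.
    by rewrite !bor_lie -bor0; apply: bor_ext; field: ii; rewrite ?(natr_neq0 char0).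
  rewrite !bor_lie borZ !borD; apply: bor_ext; rewrite /c2'' /t5; field: ii; by rewrite ?(natr_neq0 char0).
apply: (@conjG2_trans _ (bor i 0 c2'' 1 0 0 1)).
  apply: (unipotent_conj (unip4 t4)); rewrite ?dot_lin ?dt ?mulr0 //.
    by rewrite !bor_lie -bor0; apply: bor_ext; field: ii; rewrite ?(natr_neq0 char0).
  rewrite !bor_lie borZ !borD; apply: bor_ext; rewrite /t4; field: ii; by rewrite ?(natr_neq0 char0).
apply: (unipotent_conj (unip1 t1)); rewrite ?dot_lin ?dt ?mulr0 //.
  by rewrite !bor_lie -bor0; apply: bor_ext; field: ii; rewrite ?(natr_neq0 char0).
rewrite !bor_lie borZ !borD; apply: bor_ext; rewrite /t1; field: ii; by rewrite ?(natr_neq0 char0).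
Qed.

(** The standard triple is [(nx1 + ny1) / 2], [i (nx1 - ny1) / 2], [(nx2 + ny2) / 2]. Scaling each
    [nx] and inversely its [ny] keeps it orthonormal with the same product [nz]; the weight of [ny3]
    follows from [cross nx1 nx2 = 2 ny3]. *)
Lemma torus a b : a != 0 -> b != 0 -> exists2 g, G2 K g &
  [/\ g *m nz = nz, g *m nx1 = a *: nx1, g *m nx2 = b *: nx2, g *m ny2 = b^-1 *: ny2 &
    g *m ny3 = (a * b) *: ny3].
Proof.
move=> a0 b0; pose h : K := 2%:R^-1.
pose p := h *: (a *: nx1 + a^-1 *: ny1); pose q := (h * i) *: (a *: nx1 - a^-1 *: ny1).
pose c := h *: (b *: nx2 + b^-1 *: ny2).
have pq : cross p q = nz.
  by rewrite !cross_lin !cr /h; apply/matrixP=> l m; rewrite !mxentE; field: ii; rewrite two a0.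
have [gg gm] : (fmx p q c)^T *m fmx p q c = 1%:M /\ crossmorph (fmx p q c).
  apply: fmx_crossmorph; first split; rewrite ?pq !dot_lin !dt /h;
  by field: ii; rewrite ?two ?a0 ?b0.
set g := fmx p q c in gg gm.
have gb j : (j < 7)%N -> g *m bas j = fvec p q c (o7 j) by move=> hj; rewrite /g fmx_bas.
have g1 : g *m bas 1 = p by rewrite gb // fvec_o.
have g3 : g *m bas 3 = q by rewrite gb // fvec_o.
have g2 : g *m bas 2 = c by rewrite gb // fvec_o.
have gz : g *m nz = nz.
  have -> : nz = cross (bas 1) (bas 3) by rewrite cross_bas13 nullvec.unlock.
  by rewrite gm g1 g3 pq cross_bas13 nullvec.unlock.
have gx1 : g *m nx1 = a *: nx1.
  rewrite {1}nx1E /X1 mulmxBr -scalemxAr g1 g3 /p /q /h.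
  by apply/matrixP=> l m; rewrite !mxentE; field: ii; rewrite ?two ?a0.
have x2E : nx2 = bas 2 - i *: cross nz (bas 2).
  by rewrite (bas2E char0 i) !cross_lin !cr; apply/matrixP=> l m; rewrite !mxentE; field: ii.
have y2E : ny2 = bas 2 + i *: cross nz (bas 2).
  by rewrite (bas2E char0 i) !cross_lin !cr; apply/matrixP=> l m; rewrite !mxentE; field: ii.
have gx2 : g *m nx2 = b *: nx2.
  rewrite {1}x2E mulmxBr -scalemxAr gm g2 gz /c !cross_lin !cr /h.
  by apply/matrixP=> l m; rewrite !mxentE; field: ii; rewrite ?two ?b0.
have gy2 : g *m ny2 = b^-1 *: ny2.
  rewrite {1}y2E mulmxDr -scalemxAr gm g2 gz /c !cross_lin !cr /h.
  by apply/matrixP=> l m; rewrite !mxentE; field: ii; rewrite ?two ?b0.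
have gy3 : g *m ny3 = (a * b) *: ny3.
  have := gm nx1 nx2; rewrite gx1 gx2 cr !cross_lin cr -scalemxAr => /(congr1 ( *:%R h)).
  by rewrite !scalerA /h mulVf // scale1r => ->; congr (_ *: _); field.
by exists g; [exact/(G2P char0)|split].
Qed.

Lemma torus_reduction c1 c2 c3 c4 c5 c6 : c3 != 0 -> c6 != 0 ->
  exists d1 d2 d4 d5, conjG2 (bor i c1 c2 c3 c4 c5 c6) (bor i d1 d2 1 d4 d5 1).
Proof.
(* With weights [a] and [b = c6], the third coordinate is multiplied by [a b^2] and the sixth by
   [b^-1]; both become 1 for this [a]. *)
move=> c30 c60; pose a := (c3 * c6 * c6)^-1.
have a0 : a != 0 by rewrite invr_eq0 !mulf_neq0.
have [g gG [gz gx1 gx2 gy2 gy3]] := torus a0 c60; have [gg gm] := (G2P char0 g).1 gG.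
exists (c1 * a * c6^-1), (c2 * a * (a * c6)), (c4 * a), (c5 * (a * c6)), g => //.
have C u v : g *m gphi (wedge u v) *m g^T = gphi (wedge (g *m u) (g *m v)) by exact: gphi_wedge_conj.
rewrite [in RHS]/bor !gphiD !gphiZ !(mulmxDr, mulmxDl) -!(scalemxAr, scalemxAl) !C.
rewrite gz gx1 gx2 gy2 gy3 !(wedgeZl, wedgeZr) !gphiZ !scalerA /bor !gphiD !gphiZ.
by do !congr (_ + _); congr (_ *: _); rewrite /a; field; rewrite ?c30 ?c60.
Qed.

Lemma bor_sing c1 c2 c3 c4 c5 : exists p w,
  [/\ p != 0, dot p p = 0, dot p w = 0 & bor i c1 c2 c3 c4 c5 0 = gphi (wedge p w)].
Proof.
have [b1 b2 b3] := bor_mul char0 ii c1 c2 c3 c4 c5 0.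
have bg := bor_g2 char0 i c1 c2 c3 c4 c5 0.
move: (bor i c1 _ _ _ _ _) b1 b2 b3 bg => x b1 b2 b3 xg.
have [c30|c30] := eqVneq c3 0.
  exists nx1, (c1 *: ny2 + c2 *: ny3 + c4 *: nz - (i * c5) *: nx2); split.
  - exact: nx1_neq0.
  - by rewrite dt.
  - by rewrite !dot_lin !dt; ring.
  apply: (g2_ext char0 ii) => //; first exact: gphi_wedge_g2;
  rewrite gphi_wedge_mul !dot_lin !dt ?(b1, b2, b3) !cross_lin !cr !cross_lin ?cr ?c30;
  apply/matrixP=> l m; rewrite !mxentE; field: ii; by rewrite ?(natr_neq0 char0).
(* With [p = ny3 + s nx1], the coordinates [c2] to [c5] determine [w] in terms of [s]. The
   coefficient of [wedge nx1 ny2] in [wedge p w] is then [- i s (c4 - s be)], and equating it to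
   [c1] is this cubic. *)
have [s sE] := @solve_monicpoly K 3
  (nth 0 [:: - (c1 / c3); - (i * c4 / c3); i * c5 / c3]) isT.
have {}sE : c3 * s ^+ 3 = - c1 - i * c4 * s + i * c5 * s ^+ 2.
  by rewrite sE !big_ord_recl big_ord0 /=; field; rewrite c30.
pose be := c5 + i * s * c3.
exists (ny3 + s *: nx1), ((- c3) *: nx2 + be *: nz - (i * (c4 - s * be)) *: ny2 - c2 *: nx1); split.
- apply/eqP=> /(congr1 (dot nx3)); rewrite dot0r !dot_lin !dt mulr0 addr0 => /eqP.
  by rewrite (negPf two).
- by rewrite !dot_lin !dt; ring.
- by rewrite !dot_lin !dt; ring.
apply: (g2_ext char0 ii) => //; first exact: gphi_wedge_g2.
all: rewrite gphi_wedge_mul !dot_lin !dt ?(b1, b2, b3) !cross_lin !cr !cross_lin ?cr.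
all: apply/matrixP=> l m; rewrite !mxentE /be.
- have c1E : c1 = i * c5 * s ^+ 2 - i * c4 * s - c3 * s ^+ 3 by rewrite sE; ring.
  by rewrite c1E; field: ii; rewrite ?(natr_neq0 char0).
- by field: ii; rewrite ?(natr_neq0 char0).
by field: ii; rewrite ?(natr_neq0 char0).
Qed.

End RegularOrbit.

(** * Projection to g2 *)

Section PartII.
Variable K : closedFieldType.
Hypothesis char0 : [pchar K] =i pred0.
Variable i : K.
Hypothesis ii : i * i = -1.
Implicit Types (u v w p q r : 'cV[K]_7) (g x d : 'M[K]_7).

Let two : 2%:R != 0 :> K := natr_neq0 char0 1.
Let three : 3%:R != 0 :> K := natr_neq0 char0 2.

Local Notation bas := (bas K).
Local Notation nx1 := (nullvec i 1).
Local Notation nx3 := (nullvec i 3).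
Local Notation ny3 := (nullvec i 6).
Let cr := (crE ii).
Let dt := (dtE ii).

Lemma polymap_nvec : polymap (fun x : 'M[K]_7 => nvec x).
Proof.
move=> k l; apply: (@mxpoly_ext _ _ (fun x : 'M[K]_7 =>
  x (k + 1) (k + 3%:R) + x (k + 2%:R) (k + 6%:R) + x (k + 4%:R) (k + 5%:R))) => [x|].
  by rewrite ord1 nvecE.
by apply: mxpolyD; [apply: mxpolyD|]; exact: mxpoly_entry.
Qed.

Lemma polymap_ext a b (F F' : 'M[K]_7 -> 'M[K]_(a, b)) : F =1 F' -> polymap F -> polymap F'.
Proof. by move=> FF' pF k l; apply: mxpoly_ext (pF k l) => x; rewrite FF'. Qed.

Lemma polymap_Lmx (F : 'M[K]_7 -> 'cV[K]_7) : polymap F -> polymap (fun x => Lmx (F x)).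
Proof.
move=> pF k l; apply: (@mxpoly_ext _ _ (fun x => \sum_j F x j 0 * Lmx (delta_mx j 0) k l)).
  move=> x; rewrite [in RHS](matrix_sum_delta (F x)).
  under [in RHS]eq_bigr => j _ do rewrite big_ord1.
  elim: (index_enum _) => [|j s IH]; first by rewrite !big_nil -[0 in RHS](scale0r 0) LmxZ scale0r mxE.
  by rewrite !big_cons IH LmxD LmxZ !mxentE.
by apply: mxpoly_sum => j; apply: mxpolyM; [exact: pF|exact: mxpoly_cst].
Qed.

Lemma wedge_sqr_null p w : dot p p = 0 -> dot p w = 0 ->
  wedge p w *m wedge p w = - dot w w *: (p *m p^T).
Proof.
move=> pp pw; apply: mx_cV_ext => v; rewrite -mulmxA [wedge p w *m v]wedge_mul.
rewrite mulmxBr -!scalemxAr !wedge_mul -scalemxAl outer_mul pp pw [dot w p]dotC pw.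
by mxring.
Qed.

Lemma null3_wedge p w : p != 0 -> dot p p = 0 -> dot p w = 0 -> dot w w != 0 ->
  null3 1 (wedge p w).
Proof.
move=> p0 pp pw ww; have zz := wedge_sqr_null pp pw.
have z3 : wedge p w *m wedge p w *m wedge p w = 0.
  rewrite zz -scalemxAl -mulmxA -[p^T *m _]trmxK trmx_mul trmxK wedge_tr mulNmx wedge_mul.
  by rewrite [dot w p]dotC pw pp !scale0r subrr oppr0 trmx0 mulmx0 scaler0.
have rzz : \rank (wedge p w *m wedge p w) = 1%N.
  rewrite zz mxrank_scale_nz ?oppr_eq0 //.
  apply/eqP; rewrite eqn_leq (leq_trans (mxrankM_maxl _ _)) ?rank_leq_col //=.
  have [f pf] := dot_ex1 p0; rewrite lt0n mxrank_eq0; apply/eqP=> /(congr1 (mulmxr f)).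
  by rewrite /= outer_mul pf scale1r mul0mx; apply/eqP.
split=> //; first exact: wedge_tr.
apply/eqP; rewrite eqn_leq; apply/andP; split.
  have -> : wedge p w = row_mx p (- w) *m col_mx w^T p^T by rewrite mul_row_col mulNmx wedgeE.
  by rewrite (leq_trans (mxrankM_maxl _ _)) // rank_leq_col.
have := mxrank_Frobenius (wedge p w) (wedge p w) (wedge p w).
by rewrite z3 mxrank0 rzz addn0.
Qed.

Lemma null3_is_wedge e : null3 1 e -> exists p w,
  [/\ p != 0, dot p p = 0, dot p w = 0, dot w w != 0 & e = wedge p w].
Proof.
move=> ne; have [A [B [C [D [[[AA hAB hAC] [BB BC CC] _ _] ->]]]]] :=
  null3_frame_exists char0 (r := 1) (m := 4) (erefl 7) ne.
have E (u v : 'cV[K]_7) (a : K) : u^T *m v = a%:M -> dot u v = a.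
  by rewrite dotE => /matrixP/(_ 0 0); rewrite !mxE eqxx !mulr1n.
exists C, (- B); split.
- apply/eqP=> C0; have := E _ _ _ hAC; rewrite C0 dot0r => /eqP.
  by rewrite eq_sym oner_eq0.
- by apply: E; rewrite CC raddf0.
- by rewrite dotNr dotC (E B C 0) ?oppr0 // BC raddf0.
- by rewrite dotNl dotNr opprK (E B B (-1)) ?oppr_eq0 ?oner_eq0 // BB raddfN.
by rewrite wedgeE linearN /= mulmxN mulNmx opprK addrC.
Qed.

Definition Om2 := conj_orbit (G2 K) (wedge nx1 (bas 2)).

Lemma Om2P p w : dot p p = 0 -> dot p w = 0 -> dot w w != 0 ->
  (forall l, cross p w != l *: p) -> Om2 (wedge p w).
Proof.
move=> pp pw ww pl; have [b bb] := sqrt_exists (dot w w).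
have b0 : b != 0 by apply: contraNneq ww => b0; rewrite -bb b0 mulr0.
have [|||l|g gG [gp gw]] := G2_transitive char0 ii (p := b *: p) (c := b^-1 *: w).
- by rewrite !dot_lin pp !mulr0.
- by rewrite !dot_lin -bb; field.
- by rewrite !dot_lin pw !mulr0.
- by rewrite !cross_lin scalerA mulfV // scale1r scalerA.
exists g => //; have [gg _] := (G2P char0 g).1 gG.
by rewrite orth_inv // wedge_conj nx1E gp gw wedgeZl wedgeZr scalerA mulfV // scale1r.
Qed.

(** On the line [w + t c], with [c] from [null_unit], both open conditions of [Om2P] hold for
    generic [t]. The norm of [w] is arbitrary here, so the closure also contains the [wedge p w]
    with [w] isotropic, which the subregular orbit requires. *)
Lemma Om2_zclosure p w : p != 0 -> dot p p = 0 -> dot p w = 0 -> zclosure Om2 (wedge p w).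
Proof.
move=> p0 pp pw; have [c [cc pc pcl]] := null_unit char0 p0 pp.
have [f [fr fp]] := separate pcl.
pose W t := w + t *: c; pose F t := dot (W t) (W t); pose L t := dot f (cross p (W t)).
have pW : polycurve W.
  by apply: polycurveD; [exact: polycurve_cst|apply: polycurveZ;
    [exact: polyfun_id|exact: polycurve_cst]].
have pF : polyfun F by exact: polyfun_dot.
have pL : polyfun L.
  by apply: polyfun_dot; [exact: polycurve_cst|apply: polycurve_cross => //; exact: polycurve_cst].
have LE t : L t = dot f (cross p w) + t by rewrite /L /W !cross_lin !dot_lin fr mulr1.
have FE t : F t = dot w w + 2%:R * t * dot w c + t * t.
  by rewrite /F /W !dot_lin cc [dot c w]dotC; ring.
have [t0 t0E] : exists t0, F t0 * L t0 != 0.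
  (* Neither factor is identically zero: [F] has second difference 2 and [L] has first difference
     1. *)
  apply: contrapT => h; have [h'|h'] := polyfun_mul0 char0 pF pL (fun t =>
    contrapT (fun k => h (ex_intro _ t (introN eqP k)))).
    have : 2%:R * F 0 = F 1 + F (-1) - 2%:R by rewrite !FE; ring.
    by rewrite !h' mulr0 addr0 sub0r => /eqP; rewrite eq_sym oppr_eq0 (negPf two).
  have : L 1 - L 0 = 1 by rewrite !LE; ring.
  by rewrite !h' subrr => /eqP; rewrite eq_sym oner_eq0.
have -> : w = W 0 by rewrite /W scale0r addr0.
apply: (@curve_zclosure K char0 _ Om2 (fun t => wedge p (W t)) (fun t => F t * L t) t0 0) => [||//|t].
  rewrite (_ : (fun t => _) = (fun t => p *m (W t)^T - W t *m p^T)); last by apply: funext => t; exact: wedgeE.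
  apply: polycurveD; [|apply: polycurveN]; apply: polycurveM => //; try exact: polycurve_cst.
  exact: polycurve_tr.
  exact: polyfunM.
rewrite mulf_eq0 negb_or => /andP [Ft Lt]; apply: Om2P => //.
  by rewrite /W !dot_lin pw pc mulr0 addr0.
by move=> l; apply: contraNneq Lt => pl; rewrite /L pl dotZr fp mulr0.
Qed.


Local Notation O31 := (nilp_orbit K 7 [:: 3; 1; 1; 1; 1]%N).
Local Notation so7 := (so K 7).
Local Notation phi := (killing_proj so7 (g2 K)).

Lemma O31P e : O31 e <-> null3 1 e.
Proof. exact: (@nilp3P K 7 0 4 e (erefl 7)). Qed.

Lemma cross_x1_bas2 : cross nx1 (bas 2) = ny3.
Proof. by rewrite (bas2E char0 i) !cross_lin !cr; mxfield. Qed.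

Lemma dot_x1_bas2 : dot nx1 (bas 2) = 0.
Proof. by rewrite (bas2E char0 i) !dot_lin !dt; ring. Qed.

Lemma ny3_neq l : ny3 != l *: nx1.
Proof.
apply/eqP=> /(congr1 (dot nx3)); rewrite dotZr !dt mulr0 => /eqP.
by rewrite (negPf two).
Qed.

Lemma Om2_wedge e : Om2 e -> exists p w,
  [/\ [/\ p != 0, dot p p = 0, dot p w = 0 & dot w w = 1],
   forall l, cross p w != l *: p & e = wedge p w].
Proof.
move=> [g gG <-]; have [gg gm] := (G2P char0 g).1 gG.
exists (g *m nx1), (g *m bas 2); rewrite !(dot_orth _ _ gg) -gm cross_x1_bas2; split; first split.
- apply/eqP=> h; have /eqP := nx1_neq0 char0 ii; apply; apply: (can_inj (mulKmx (orth_unit gg))).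
  by rewrite h mulmx0.
- by rewrite dt.
- exact: dot_x1_bas2.
- by rewrite dot_bas.
- move=> l; apply/eqP; rewrite scalemxAr => /(can_inj (mulKmx (orth_unit gg))) /eqP.
  exact/negP/ny3_neq.
by rewrite orth_inv // wedge_conj.
Qed.

(** Expresses the line condition by a polynomial map of the matrix, here [r r^T + (w, w) p p^T] with
    [r = cross p w]. If [r = l p], then [cross w r = (w, w) p] forces [(w, w) = - l^2]; conversely,
    evaluating at [f] with [(p, f) = 1] expresses [p] by [r]. *)
Lemma wedge_cross_line p w : p != 0 -> dot p p = 0 -> dot p w = 0 -> dot w w != 0 ->
  nvec (wedge p w) *m (nvec (wedge p w))^T - wedge p w *m wedge p w = 0 <->
  exists l, cross p w = l *: p.
Proof.
move=> p0 pp pw ww; rewrite nvec_wedge wedge_sqr_null // scaleNr opprK.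
set r := cross p w; split=> [h|[l rE]].
  have [f pf] := dot_ex1 p0; have := congr1 (mulmxr f) h.
  rewrite /= mulmxDl -scalemxAl !outer_mul pf scale1r mul0mx => E.
  have rf : dot r f != 0.
    apply/eqP=> rf; move/eqP: E; rewrite rf scale0r add0r scaler_eq0 (negPf ww) (negPf p0).
    by [].
  exists (- dot w w / dot r f); apply: (scalerI rf).
  by rewrite scalerA mulrCA divff // mulr1 scaleNr; apply/eqP; rewrite -addr_eq0 E.
have wr : cross w r = dot w w *: p.
  by rewrite /r [cross p w]crossC crossNr cross_cross [dot w p]dotC pw scale0r sub0r opprK.
have wwE : dot w w = - (l * l).
  have : dot w w *: p = - (l * l) *: p.
    by rewrite -wr rE crossZr [cross w p]crossC -/r rE scalerN scalerA scaleNr.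
  by move/eqP; rewrite -subr_eq0 -scalerBl scaler_eq0 (negPf p0) orbF subr_eq0 => /eqP.
by rewrite rE wwE linearZ /= -scalemxAl -scalemxAr scalerA scaleNr subrr.
Qed.

Lemma Om2E : Om2 = O31 `&` [set e | nvec e *m (nvec e)^T - e *m e != 0].
Proof.
apply/seteqP; split=> [e /Om2_wedge [p [w [[p0 pp pw ww] pl ->]]]|e [/O31P /null3_is_wedge]].
  have w0 : dot w w != 0 by rewrite ww oner_eq0.
  split; first by apply/O31P; exact: null3_wedge.
  apply/eqP=> /(wedge_cross_line p0 pp pw w0) [l lE].
  by have := pl l; rewrite lE eqxx.
move=> [p [w [p0 pp pw ww ->]]] /= /eqP h; apply: Om2P => // l.
by apply/eqP=> pl; apply: h; apply/(wedge_cross_line p0 pp pw ww); exists l.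
Qed.

Lemma Om2_dense : dense_orbit (G2 K) O31 Om2.
Proof.
split; first by exists (wedge nx1 (bas 2)).
  by rewrite Om2E => e [].
by move=> e /O31P /null3_is_wedge [p [w [p0 pp pw ww ->]]]; exact: Om2_zclosure.
Qed.

Lemma Om2_unique W : dense_orbit (G2 K) O31 W -> W = Om2.
Proof.
apply: (dense_orbit_unique (mxgroup_G2 char0) _ _ Om2E); last by have [] := Om2_dense.
apply: polymapD; first by apply: polymapM; [|apply: polymap_tr]; exact: polymap_nvec.
by apply: polymapN; apply: polymapM; exact: polymap_id.
Qed.

Lemma O31_orbit : is_orbit (SO K 7) O31.
Proof.
apply: (is_orbitI (x := wedge nx1 (bas 2)) (mxgroup_SO K 7)).
- apply/O31P/null3_wedge; rewrite ?dt ?dot_x1_bas2 ?dot_bas ?oner_eq0 //.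
  exact: nx1_neq0.
- by move=> g y [gg _] /O31P ny; apply/O31P; exact: null3_conj_orth.
move=> y /O31P ny; apply: (null3_conj_SO char0 (m := 4) _ _ _ ny) => //.
apply: null3_wedge; rewrite ?dt ?dot_x1_bas2 ?dot_bas ?oner_eq0 //; exact: nx1_neq0.
Qed.

Lemma killing_orth_g2E e : e \in killing_orth so7 (g2 K) -> e = - (3%:R^-1 *: Lmx (nvec e)).
Proof.
move=> em; have [es _] := (mem_killing_orth _ _ _).1 em.
have : phi e = 0.
  apply: (killing_projE char0); rewrite ?g2_so ?subr0 ?mem0v //.
  move=> z /mem_so zT; exists (gphi z); [exact: gphi_g2|exact: gphi_orth].
by rewrite phi_gphi //; [move/eqP; rewrite addr_eq0 => /eqP|exact/mem_so].
Qed.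

(** The relation [Lmx u e + e e = 0] with [u = nvec e] holds on the orbit and passes to the closure.
    On the complement [e = - Lmx u / 3], so it becomes [Lmx u Lmx u = 0]; the trace then gives
    [(u, u) = 0], and [cross u (cross u f) = (u, f) u] gives [u = 0]. *)
Lemma O31_zclosure : zclosure O31 `&` [set x | x \in killing_orth so7 (g2 K)] = [set 0].
Proof.
apply/seteqP; split=> [e [eO /= em]|_ ->].
  have E : Lmx (nvec e) *m e + e *m e = 0.
    apply: (polymap_zclosure (F := fun e => Lmx (nvec e) *m e + e *m e)) eO.
      apply: polymapD; apply: polymapM; try exact: polymap_id.
      by apply: polymap_Lmx; exact: polymap_nvec.
    move=> _ /O31P /null3_is_wedge [p [w [p0 pp pw ww ->]]]; rewrite wedge_sqr_null // nvec_wedge.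
    apply: mx_cV_ext => v; rewrite mulmxDl -mulmxA Lmx_mul wedge_mul -scalemxAl outer_mul.
    have rp : cross (cross p w) p = 0 by rewrite crossC cross_cross pp pw !scale0r subrr oppr0.
    have rw : cross (cross p w) w = - dot w w *: p.
      rewrite crossC [cross p w]crossC crossNr cross_cross [dot w p]dotC pw scale0r.
      by rewrite sub0r !opprK scaleNr.
    by rewrite !cross_lin rp rw mul0mx; mxring.
  have eE := killing_orth_g2E em; set u := nvec e in eE E.
  have uu : Lmx u *m Lmx u = 0.
    have : (2%:R / 9%:R) *: (Lmx u *m Lmx u) = 0.
      rewrite -[RHS]oppr0 -E eE mulmxN mulNmx mulmxN -!scalemxAr -!scalemxAl scalerA.
      by mxfield; rewrite !(natr_neq0 char0).
    move/eqP; rewrite scaler_eq0 mulf_eq0 invr_eq0 (negPf two) (negPf (natr_neq0 char0 8)) => /eqP.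
    by [].
  have u2 : dot u u = 0.
    have := tr_Lmx char0 u (Lmx_tr u); rewrite uu mxtrace0 nvec_Lmx dotNr dotZr => /esym/eqP.
    by rewrite mulrN oppr_eq0 !mulf_eq0 (negPf two) (negPf three) => /eqP.
  have u0 : u = 0.
    apply: contrapT => /eqP /dot_ex1 [f uf]; have := congr1 (mulmxr f) uu.
    rewrite /= -mulmxA !Lmx_mul cross_cross uf u2 scale1r scale0r subr0 mul0mx => u0.
    by move: uf; rewrite u0 dot0l => /eqP; rewrite eq_sym oner_eq0.
  by rewrite /= eE u0 -(scale0r 0) LmxZ !scale0r scaler0 oppr0.
split; last exact: mem0v.
have -> : 0 = (0 : K) *: wedge nx1 (bas 2) by rewrite scale0r.
apply: (@curve_zclosure K char0 _ O31 (fun t => t *: wedge nx1 (bas 2)) id 1 0).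
- by apply: polycurveZ; [exact: polyfun_id|exact: polycurve_cst].
- exact: polyfun_id.
- exact: oner_neq0.
move=> t t0; rewrite -wedgeZl; apply/O31P/null3_wedge.
- by rewrite scaler_eq0 negb_or t0 nx1_neq0.
- by rewrite !dot_lin dt !mulr0.
- by rewrite dotZl dot_x1_bas2 mulr0.
by rewrite dot_bas // oner_eq0.
Qed.

End PartII.

(** * Ranks of the projections and the regular orbit of g2 *)

Section Subregular.
Variable K : closedFieldType.
Hypothesis char0 : [pchar K] =i pred0.
Variable i : K.
Hypothesis ii : i * i = -1.
Implicit Types (u v w p q r : 'cV[K]_7) (g x d : 'M[K]_7).

Let two : 2%:R != 0 :> K := natr_neq0 char0 1.

Let i0 : i != 0.
Proof. by apply/eqP=> h; move/eqP: ii; rewrite h mul0r eq_sym oppr_eq0 oner_eq0. Qed.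

Local Notation bas := (bas K).
Local Notation nz := (nullvec i 0).
Local Notation nx1 := (nullvec i 1).
Local Notation nx2 := (nullvec i 2).
Local Notation nx3 := (nullvec i 3).
Local Notation ny1 := (nullvec i 4).
Local Notation ny2 := (nullvec i 5).
Local Notation ny3 := (nullvec i 6).
Let dt := (dtE ii).

Local Notation so7 := (so K 7).
Local Notation Om2 := (Om2 i).
Local Notation x0 := (bor i 0 0 1 0 0 1).

Lemma null3_gphi p w : p != 0 -> dot p p = 0 -> dot p w = 0 -> dot w w != 0 ->
  (forall l, cross p w != l *: p) -> null3 2 (gphi (wedge p w)).
Proof.
move=> p0 pp pw ww pl; set r := cross p w; set x := gphi _.
have xx : x *m x = 9%:R^-1 *: (r *m r^T) - (dot w w / 3%:R) *: (p *m p^T).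
  exact: gphi_null_sqr.
have x3 : x *m x *m x = 0 by exact: gphi_null_cube.
have [f [fr fp]] := separate pl.
have [f' [f'p f'r]] : exists f', dot f' p = 1 /\ dot f' r = 0.
  apply: separate => l; apply/eqP=> pE; have l0 : l != 0.
    by apply: contraNneq p0 => l0; rewrite pE l0 scale0r.
  by have := pl l^-1; rewrite {2}pE scalerA mulVf // scale1r eqxx.
have rxx : \rank (x *m x) = 2%N.
  apply/eqP; rewrite eqn_leq; apply/andP; split.
    have -> : x *m x = row_mx (9%:R^-1 *: r) (- (dot w w / 3%:R) *: p) *m col_mx r^T p^T.
      by rewrite mul_row_col -!scalemxAl scaleNr xx.
    by rewrite (leq_trans (mxrankM_maxl _ _)) // rank_leq_col.
  have E : x *m x *m row_mx f f' =
      row_mx r p *m block_mx (9%:R^-1)%:M 0 0 (- (dot w w / 3%:R))%:M.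
    rewrite mul_mx_row mul_row_block !mulmx0 addr0 add0r !mul_mx_scalar xx !mulmxBl -!scalemxAl.
    rewrite !outer_mul [dot r f]dotC fr [dot p f]dotC fp [dot p f']dotC f'p [dot r f']dotC f'r.
    by rewrite !scale0r !scaler0 !scale1r subr0 sub0r scaleNr.
  have E2 : col_mx f^T f'^T *m row_mx r p = 1%:M.
    rewrite mul_col_row !dotE fr fp f'r f'p !scalar_mx0 -scalar_mx_block.
    by [].
  have E3 : \rank (col_mx f^T f'^T *m (x *m x *m row_mx f f')) = 2%N.
    rewrite E mulmxA E2 mul1mx; apply: mxrank_unit.
    by rewrite unitmxE det_ublock !det_scalar1 unitfE mulf_neq0 ?invr_eq0 ?oppr_eq0 ?mulf_neq0 ?invr_eq0 ?(natr_neq0 char0).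
  rewrite -{1}E3 (leq_trans (mxrankM_maxr _ _)) // mxrankM_maxl.
  by [].
split=> //; first by apply: g2_tr; exact: gphi_wedge_g2.
(* The Frobenius inequality with [x^3 = 0] gives [rank x >= 2 rank (x x) = 4], and Sylvester's
   inequality in dimension 7 gives [2 rank x <= 7 + 2]. *)
have h1 := mxrank_Frobenius x x x; have h2 := mxrank_mul_min x x.
by rewrite x3 mxrank0 rxx in h1 h2; lia.
Qed.

Lemma gphi_wedge_nilcone p w : dot p p = 0 -> dot p w = 0 -> nilcone (g2 K) (gphi (wedge p w)).
Proof.
move=> pp pw; split; first exact: gphi_wedge_g2.
by exists 3%N; rewrite !exprS expr0 mulr1 mulrA; exact: gphi_null_cube.
Qed.

Lemma nilcone_conj g x : G2 K g -> nilcone (g2 K) x -> nilcone (g2 K) (g *m x *m g^T).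
Proof.
move=> /(G2P char0) [gg gm] [xg [k xk]]; split; first exact: g2_conj.
by exists k; rewrite -(orth_inv gg) conj_exp ?orth_unit // xk mulmx0 mul0mx.
Qed.

(** Projections of null wedges have cube zero, so this keeps them apart from the orbit of [x0]. *)
Lemma x0_cube : x0 *m x0 *m x0 != 0.
Proof.
apply/eqP=> h; have [b1 _ _] := bor_mul char0 ii 0 0 1 0 0 1.
have [_ b2 b3 _] := bor_mul0 char0 ii 0 0 1 0 0 1.
have : x0 *m (x0 *m (x0 *m ny1)) = (16%:R / 9%:R * i) *: nz.
  rewrite b1 !(mulmxBr, mulmxDr, mulmxN, =^~ scalemxAr) b3 !(mulmxBr, mulmxDr, mulmxN, =^~ scalemxAr) b2.
  rewrite !(mulr0, scale0r, subr0, add0r, addr0, sub0r, mulr1).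
  by apply/matrixP=> k l; rewrite !mxentE; field: ii; rewrite !(natr_neq0 char0).
rewrite !mulmxA h mul0mx => /(congr1 (dot nz)); rewrite dot0r dotZr dt mulr1 => /esym/eqP.
by rewrite !mulf_eq0 invr_eq0 (negPf i0) !(negPf (natr_neq0 char0 _)).
Qed.

(** Up to nonzero scalars [x0] acts as a single chain [ny1 -> nx3 -> nx2 -> nz -> ny2 -> ny3 -> nx1
    -> 0], whence the exponent 7. *)
Lemma x0_nilcone : nilcone (g2 K) x0.
Proof.
split; first exact: bor_g2.
exists 7; have [b1 b2 b3] := bor_mul char0 ii 0 0 1 0 0 1.
have [b4 b5 b6 b7] := bor_mul0 char0 ii 0 0 1 0 0 1.
have gg := bor_g2 char0 i 0 0 1 0 0 1.
move: x0 b1 b2 b3 b4 b5 b6 b7 {gg} => x.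
rewrite !(mulr0, scale0r, subr0, add0r, addr0, sub0r, mulr1, oppr0) scale1r => b1 b2 b3 b4 b5 b6 b7.
pose P k (v : 'cV[K]_7) := x ^+ k *m v = 0.
have PZ k a v : P k v -> P k (a *: v) by rewrite /P -scalemxAr => ->; rewrite scaler0.
have PN k v : P k v -> P k (- v) by rewrite /P mulmxN => ->; rewrite oppr0.
have PS k v : P k (x *m v) -> P k.+1 v by rewrite /P mulmxA mulmxE -exprSr.
have PW k v : P k v -> P k.+1 v by rewrite /P exprS -mulmxE -mulmxA => ->; rewrite mulmx0.
have P1 : P 1 nx1 by rewrite /P expr1.
have P2 : P 2 ny3 by apply: PS; rewrite b3; exact: PZ.
have P3 : P 3 ny2 by apply: PS; rewrite b2; apply: PN; exact: PZ.
have P4 : P 4 nz by apply: PS; rewrite b7; exact: PZ.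
have P5 : P 5 nx2 by apply: PS; rewrite b5; apply: PN; exact: PZ.
have P6 : P 6 nx3 by apply: PS; rewrite b6; exact: PZ.
have P7 : P 7 ny1 by apply: PS; rewrite b1; apply: PN; exact: PZ.
apply: mx_cV_ext => v; rewrite mul0mx (null_expand char0 ii v).
rewrite !(mulmxDr, =^~ scalemxAr) P7 !(PW _ _ P6) !(PW _ _ (PW _ _ P5)).
rewrite !(PW _ _ (PW _ _ (PW _ _ P4))) !(PW _ _ (PW _ _ (PW _ _ (PW _ _ P3)))).
rewrite !(PW _ _ (PW _ _ (PW _ _ (PW _ _ (PW _ _ P2))))).
rewrite !(PW _ _ (PW _ _ (PW _ _ (PW _ _ (PW _ _ (PW _ _ P1)))))).
by rewrite !(scaler0, addr0).
Qed.

Definition Oreg := conj_orbit (G2 K) x0.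

Lemma conjG2_orbit x y : conjG2 x y -> conj_orbit (G2 K) x y.
Proof. by move=> [g gG ->]; exists g => //; rewrite orth_inv //; have [[]] := gG. Qed.

Lemma bor_Oreg c1 c2 c3 c4 c5 c6 : c3 != 0 -> c6 != 0 -> Oreg (bor i c1 c2 c3 c4 c5 c6).
Proof.
move=> c30 c60; have [d1 [d2 [d4 [d5 h]]]] := torus_reduction char0 ii c1 c2 c4 c5 c30 c60.
have /conjG2_orbit h' := conjG2_trans char0 h (unipotent_reduction char0 ii d1 d2 d4 d5).
rewrite /Oreg -(conj_orbit_eq (mxgroup_G2 char0) h').
by apply: conj_orbit_refl; exact: mxgroup_G2.
Qed.

Lemma Oreg_conj g x : G2 K g -> Oreg x -> Oreg (g *m x *m g^T).
Proof.
move=> gG Ox; have [gg _] := (G2P char0 g).1 gG.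
by rewrite -(orth_inv gg); apply: conj_orbit_mul => //; exact: mxgroup_G2.
Qed.

(** An element with [c6 = 0] is the value at [t = 0] of the line obtained by adding [t x0], along
    which the two simple root coordinates are [c3 + t] and [t]. *)
Lemma Oreg_dense : dense_orbit (G2 K) (nilcone (g2 K)) Oreg.
Proof.
split; first by exists x0.
  move=> _ [g gG <-]; have [gg _] := (G2P char0 g).1 gG.
  by rewrite orth_inv //; apply: nilcone_conj => //; exact: x0_nilcone.
move=> x [xg [k xk]].
have [g [c1 [c2 [c3 [c4 [c5 [c6 [gG -> [->|[c30 c60]]]]]]]]]] := g2_nilp_form char0 ii xg xk; last first.
  by apply: zclosure_sub; apply: Oreg_conj => //; exact: bor_Oreg.
pose X t := g *m bor i c1 c2 c3 c4 c5 0 *m g^T + t *: (g *m x0 *m g^T).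
have XE t : X t = g *m bor i c1 c2 (c3 + t) c4 c5 t *m g^T.
  rewrite /X scalemxAl scalemxAr -mulmxDl -mulmxDr borZ borD; congr (_ *m _ *m _).
  by apply: bor_ext; ring.
have -> : g *m bor i c1 c2 c3 c4 c5 0 *m g^T = X 0 by rewrite /X scale0r addr0.
have [t0 t0E] : exists t, (c3 + t) * t != 0.
  have [h|h] := eqVneq (c3 + 1) 0; last by exists 1; rewrite mulr1.
  by exists 2%:R; rewrite (natrD _ 1 1) addrA h add0r mul1r -natrD.
apply: (@curve_zclosure K char0 _ Oreg X (fun t => (c3 + t) * t) t0 0) => //.
- apply: polycurveD; first exact: polycurve_cst.
  by apply: polycurveZ; [exact: polyfun_id|exact: polycurve_cst].
- by apply: polyfunM; [apply: polyfunD; [exact: polyfun_cst|]|]; exact: polyfun_id.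
move=> t; rewrite mulf_eq0 negb_or => /andP [h1 h2]; rewrite XE.
by apply: Oreg_conj => //; exact: bor_Oreg.
Qed.

End Subregular.

Section ZariskiImage.
Variable K : fieldType.

Lemma mxpoly_prod n (I : Type) (r : seq I) (F : I -> 'M[K]_n -> K) :
  (forall i, mxpoly (F i)) -> mxpoly (fun t => \prod_(i <- r) F i t).
Proof.
move=> pF; elim: r => [|a r IH].
  by apply: mxpoly_ext (mxpoly_cst _ 1) => t; rewrite big_nil.
by apply: mxpoly_ext (mxpolyM (pF a) IH) => t; rewrite big_cons.
Qed.
Lemma mxpolyX n (f : 'M[K]_n -> K) k : mxpoly f -> mxpoly (fun t => f t ^+ k).
Proof.
move=> pf; elim: k => [|k IH].
  by apply: mxpoly_ext (mxpoly_cst _ 1) => t; rewrite expr0.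
by apply: mxpoly_ext (mxpolyM pf IH) => t; rewrite exprS.
Qed.

Lemma mxpoly_eval n b (p : {mpoly K[b * b]}) (F : 'M[K]_n -> 'M[K]_b) :
  polymap F -> mxpoly (fun x => mx_eval p (F x)).
Proof.
move=> pF; apply: mxpoly_ext (fun x => esym (mevalE _ _)) _ => /=.
apply: mxpoly_sum => m; apply: mxpolyM; first exact: mxpoly_cst.
apply: mxpoly_prod => i; apply: mxpolyX; case/mxvec_indexP: i => i j.
by apply: mxpoly_ext (pF i j) => t; rewrite mxvecE.
Qed.

Lemma zclosure_image n b (F : 'M[K]_n -> 'M[K]_b) S x :
  polymap F -> zclosure S x -> zclosure (F @` S) (F x).
Proof.
move=> pF Sx p pS; apply: (mxpoly_zclosure (mxpoly_eval p pF)) Sx => y Sy.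
by apply: pS; exists y.
Qed.

End ZariskiImage.

(** * The image of the dense orbit in g2 and its saturation *)

Section Projection.
Variable K : closedFieldType.
Hypothesis char0 : [pchar K] =i pred0.
Variable i : K.
Hypothesis ii : i * i = -1.
Implicit Types (u v w p q r : 'cV[K]_7) (g x d : 'M[K]_7).


Local Notation bas := (bas K).
Local Notation nz := (nullvec i 0).
Local Notation nx1 := (nullvec i 1).

Local Notation O31 := (nilp_orbit K 7 [:: 3; 1; 1; 1; 1]%N).
Local Notation O331 := (nilp_orbit K 7 [:: 3; 3; 1]%N).
Local Notation so7 := (so K 7).
Local Notation phi := (killing_proj so7 (g2 K)).
Local Notation Om2 := (Om2 i).

Lemma O331P z : O331 z <-> null3 2 z.
Proof. exact: nilp331P. Qed.

Lemma phi_wedge p w : phi (wedge p w) = gphi (wedge p w).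
Proof. by rewrite phi_gphi //; exact: wedge_tr. Qed.

Lemma polymap_gphi : polymap (fun x : 'M[K]_7 => gphi x).
Proof.
apply: (@polymap_ext _ _ _ (fun x => x + Lmx (3%:R^-1%:M *m nvec x))) => [x|].
  by rewrite mul_scalar_mx LmxZ.
apply: polymapD; first exact: polymap_id.
by apply: polymap_Lmx; apply: polymapM; [exact: polymap_cst|exact: polymap_nvec].
Qed.

Lemma null3_phi_Om2 y : (phi @` Om2) y -> null3 2 y.
Proof.
move=> [e /(Om2_wedge char0 ii) [p [w [[p0 pp pw ww] pl ->]]] <-]; rewrite phi_wedge.
by apply: (null3_gphi char0 ii p0 pp pw _ pl); rewrite ww oner_eq0.
Qed.

Lemma phi_Om2 : phi @` Om2 = conj_orbit (G2 K) (gphi (wedge nx1 (bas 2))).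
Proof.
apply/seteqP; split=> [_ [_ [g gG <-] <-]|_ [g gG <-]]; have [gg gm] := (G2P char0 g).1 gG.
  exists g => //; rewrite orth_inv // gphi_wedge_conj // -wedge_conj.
  by rewrite wedge_conj phi_wedge.
exists (g *m wedge nx1 (bas 2) *m g^T); first by exists g => //; rewrite orth_inv.
by rewrite wedge_conj phi_wedge orth_inv // gphi_wedge_conj.
Qed.

Lemma phi_Om2_not_regular y : (phi @` Om2) y -> ~ Oreg i y.
Proof.
move=> /null3_phi_Om2 [_ y3 _ _] [g gG yE]; have [gg _] := (G2P char0 g).1 gG.
case/eqP: (x0_cube char0 ii).
move: y3; rewrite -yE orth_inv //; set x := bor _ _ _ _ _ _ _ => h.
have := congr1 (fun z => g^T *m z *m g) h; rewrite mulmx0 mul0mx => <-.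
by rewrite -!mulmxA gg mulmx1 !(mulmxA g^T g) gg !mul1mx.
Qed.

(** A nilpotent outside the regular orbit has [c6 = 0] in normal form, so [bor_sing] writes it as
    [gphi (wedge p w)]. As [gphi] is a polynomial map, the position of [wedge p w] in the closure of
    [Om2] transfers to the closure of the image. *)
Lemma subregular_phi_Om2 : is_subregular (G2 K) (g2 K) (phi @` Om2).
Proof.
exists (Oreg i); first exact: Oreg_dense.
split; first by exists (gphi (wedge nx1 (bas 2))); exact: phi_Om2.
  move=> y Oy; split; last exact: phi_Om2_not_regular.
  case: Oy => e /(Om2_wedge char0 ii) [p [w [[p0 pp pw ww] pl ->]]] <-.
  by rewrite phi_wedge; exact: gphi_wedge_nilcone.
move=> x [[xg [k xk]] xr].
have [g [c1 [c2 [c3 [c4 [c5 [c6 [gG xE [c60|[c30 c60]]]]]]]]]] := g2_nilp_form char0 ii xg xk; last first.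
  by case: xr; rewrite xE; apply: Oreg_conj => //; exact: bor_Oreg.
have [gg gm] := (G2P char0 g).1 gG.
have [p [w [p0 pp pw bE]]] := bor_sing char0 ii c1 c2 c3 c4 c5.
rewrite xE c60 bE gphi_wedge_conj //.
have gp0 : g *m p != 0.
  by apply: contraNneq p0 => gp; rewrite -(mulKmx (orth_unit gg) p) gp mulmx0.
have : zclosure Om2 (wedge (g *m p) (g *m w)) by apply: Om2_zclosure; rewrite ?dot_orth.
move/(zclosure_image polymap_gphi); congr (zclosure _ _).
by apply: eq_imagel => e /(Om2_wedge char0 ii) [p' [w' [_ _ ->]]]; rewrite phi_wedge.
Qed.

(** The image consists of elements of type [(3, 3, 1)], and in odd dimension these form a single
    orbit of the special orthogonal group, so one element of the image reaches all of them. *)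
Lemma saturation_phi_Om2 : saturation (SO K 7) (phi @` Om2) = O331.
Proof.
apply/seteqP; split=> [z [y /null3_phi_Om2 ny [g [gg _] <-]]|z /O331P nz].
  by apply/O331P; exact: null3_conj_orth.
have Oy : (phi @` Om2) (phi (wedge nx1 (bas 2))).
  exists (wedge nx1 (bas 2)) => //; apply: conj_orbit_refl; exact: mxgroup_G2.
have [g gS gz] := null3_conj_SO char0 (r := 2) (m := 1) (isT : odd 7) (erefl 7) (null3_phi_Om2 Oy) nz.
exists (phi (wedge nx1 (bas 2))) => //; exists g => //.
by apply: orth_conj gz; have [] := gS.
Qed.

Lemma height_O331 : orbit_height so7 O331 4.
Proof.
split; last by move=> z /O331P nz; exact: (@height_null3_2 _ char0 7 1).
rewrite -saturation_phi_Om2; exists (phi (wedge nx1 (bas 2))).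
exists (phi (wedge nx1 (bas 2))); last exact: conj_orbit_refl (mxgroup_SO _ _).
exists (wedge nx1 (bas 2)) => //; apply: conj_orbit_refl; exact: mxgroup_G2.
Qed.

Lemma height_O31 : orbit_height so7 O31 2.
Proof.
split; last by move=> z /O31P nz; exact: (@height_null3_1 _ char0 7 4).
by have [x ->] := O31_orbit char0 ii; exists x; exact: conj_orbit_refl (mxgroup_SO _ _).
Qed.

End Projection.

Theorem proposition4p7 (K : closedFieldType) (char0 : [pchar K] =i pred0) :
  (forall k m n : nat, (2 <= k)%N -> (n + 1 = 4 * k + m)%N ->
     let G := SO K (n + 1) in
     let H := SO_sub K n in
     let g := so K (n + 1) in
     let h := so_sub K n in
     let phi := killing_proj g h in
     let O2 := nilp_orbit K (n + 1) (nseq (2 * k) 2%N ++ nseq m 1%N) in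
     [/\ (0 < m)%N -> is_orbit G O2,
         m = 0%N -> exists OI OII : set 'M[K]_(n + 1),
           [/\ is_orbit G OI, is_orbit G OII, OI <> OII & O2 = OI `|` OII] &
         forall O : set 'M[K]_(n + 1), is_orbit G O -> O `<=` O2 ->
           [/\ zclosure O `&` [set x | x \in killing_orth g h] = [set 0],
               exists Omega, dense_orbit H O Omega,
               forall Omega, dense_orbit H O Omega ->
                 phi @` Omega =
                   @embed_lie K n @`
                     nilp_orbit K n
                       (3%N :: nseq (2 * k - 2) 2%N ++ nseq m 1%N) /\
                 let Ot := saturation G (phi @` Omega) in
                 Ot = nilp_orbit K (n + 1)
                        (3%N :: nseq (2 * k - 2) 2%N ++ nseq m.+1 1%N) /\
                 orbit_height g Ot 3 &
               orbit_height g O 2]])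
  /\
  (let G := SO K 7 in
   let H := G2 K in
   let g := so K 7 in
   let h := g2 K in
   let phi := killing_proj g h in
   let O := nilp_orbit K 7 [:: 3; 1; 1; 1; 1]%N in
   [/\ is_orbit G O,
       zclosure O `&` [set x | x \in killing_orth g h] = [set 0],
       exists Omega, dense_orbit H O Omega,
       forall Omega, dense_orbit H O Omega ->
         is_subregular H h (phi @` Omega) /\
         let Ot := saturation G (phi @` Omega) in
         Ot = nilp_orbit K 7 [:: 3; 3; 1]%N /\ orbit_height g Ot 4 &
       orbit_height g O 2]).
Proof.
split=> [k m n k2 nE G H g h phi O2|G H g h phi O].
  have NE : (n + 1 = 2 * k + 2 * k + m)%N by rewrite nE; lia.
  have s2 : (2 < 2 * k)%N by lia.
  have n1 : (1 < n)%N by lia.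
  have os : ~~ odd (2 * k) by rewrite oddM.
  have O2E : O2 = [set x | null2 (2 * k) x].
    by apply/seteqP; split=> x; [move/(nilp2P _ NE)|move=> ?; apply/(nilp2P _ NE)].
  split=> [m0|m0|O Oorb OO2].
  - by rewrite O2E; exact: (null2_orbit char0 NE n1 s2 os).
  - by rewrite O2E; exact: (null2_orbits char0 NE n1 s2 os).
  have On x : O x -> null2 (2 * k) x by move/OO2; rewrite O2E.
  split.
  - exact: (O_zclosure char0 NE n1 s2 Oorb On).
  - exists (Om O); exact: (Om_dense char0 NE n1 s2 Oorb On).
  - move=> Omega /(Om_unique char0 NE n1 s2 Oorb On) ->; split; first exact: (phi_Om char0 NE n1 s2 os Oorb On).
    rewrite (saturation_phi_Om char0 NE n1 s2 os Oorb On); split=> //.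
    exact: (height_saturation char0 NE n1 s2 os Oorb On).
  exact: (height_O char0 s2 Oorb On).
have [i ii] := sqrt_exists (-1 : K).
split.
- exact: (O31_orbit char0 ii).
- exact: (O31_zclosure char0 ii).
- by exists (Om2 i); exact: Om2_dense.
- move=> Omega /(Om2_unique char0 ii) ->; split; first exact: subregular_phi_Om2.
  by rewrite saturation_phi_Om2 //; split=> //; exact: (height_O331 char0 ii).
exact: (height_O31 char0 ii).
Qed.
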